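(* Let $T>0$, $\theta\in(-1,0]$ and $M>0$. Let $v^0,w^0\in\dot H^0$ with $\|v^0\|_{\dot H^0}+\|w^0\|_{\dot H^0}\le M$, and let $v,w\in C([0,T];\dot H^0)$ be the solutions on $[0,T]$ (in the sense described in the context) of the system $$\partial_t v_k=\tfrac12 ik\sum_{k_1+k_2=k}e^{3ikk_1k_2t}v_{k_1}v_{k_2},\qquad k\in\mathbb{Z}_0,$$ with $v(0)=v^0$, $w(0)=w^0$. Then $$\|v-w\|_{L_\infty([0,T];\dot H^\theta)}\le C'\,C_M^{\,T}\,\|v^0-w^0\|_{\dot H^\theta},$$ where $C'$ and $C_M$ depend only on $M$ and $\theta$.
   Context: Write $\mathbb{Z}_0=\mathbb{Z}\setminus\{0\}$. For $s\in\mathbb{R}$, $\dot H^s$ denotes the Hilbert space of sequences $v=(v_k)_{k\in\mathbb{Z}_0}$ of complex numbers with $v_{-k}=\overline{v_k}$ and $\|v\|_{\dot H^s}^2=\sum_{k\in\mathbb{Z}_0}|k|^{2s}|v_k|^2<\infty$ (so $\dot H^0\subset\dot H^\theta$ for $\theta\le 0$). The system above is the periodic KdV equation written for $v_k(t)=e^{ik^3t}u_k(t)$, $u_k$ the Fourier coefficients of the KdV solution $u$; sums are over $k_1,k_2\in\mathbb{Z}_0$. A function $v$ is a solution on $[0,T]$ with $v(0)=v^0$ if $v\in L_\infty([0,T];\dot H^0)$ and for every $k\in\mathbb{Z}_0$ and $t\in[0,T]$, $$v_k(t)-v^0_k=\tfrac12 ik\int_0^t\sum_{k_1+k_2=k}e^{3ikk_1k_2\tau}v_{k_1}(\tau)v_{k_2}(\tau)\,d\tau.$$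 For every $v^0\in\dot H^0$ such a solution in $C([0,T];\dot H^0)$ exists and is unique. *)

(* Defs.v *)
From Stdlib Require Import Reals ZArith.
From Coquelicot Require Import Coquelicot.
Open Scope R_scope.

(* A sequence indexed by Z; only indices k <> 0 (i.e. k in Z_0) are ever used. *)
Definition seqZ := Z -> C.

(* n-th term (n : nat, standing for |k| = n+1) of the series
   sum_{k in Z_0} |k|^{2s} |v_k|^2, grouping k and -k. *)
Definition hterm (s : R) (v : seqZ) (n : nat) : R :=
  Rpower (INR (S n)) (2 * s) *
  (Cmod (v (Z.of_nat (S n))) ^ 2 + Cmod (v (- Z.of_nat (S n))%Z) ^ 2).

Definition in_Hdot (s : R) (v : seqZ) : Prop := ex_series (hterm s v).

Definition Hnorm (s : R) (v : seqZ) : R := sqrt (Series (hterm s v)).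

Definition real_seq (v : seqZ) : Prop :=
  forall k : Z, k <> 0%Z -> v (- k)%Z = Cconj (v k).

Definition in_H0 (v : seqZ) : Prop := real_seq v /\ in_Hdot 0 v.

Definition vsub (v w : seqZ) : seqZ := fun k => Cminus (v k) (w k).

Definition cexpi (x : R) : C := (cos x, sin x).

Definition nl_summand (v : seqZ) (k : Z) (tau : R) (k1 : Z) : C :=
  if (Z.eqb k1 0 || Z.eqb k1 k)%bool then RtoC 0
  else Cmult (Cmult (cexpi (3 * IZR k * IZR k1 * IZR (k - k1) * tau)) (v k1)) (v (k - k1)%Z).

(* sum_{k1 + k2 = k, k1,k2 in Z_0} e^{3 i k k1 k2 tau} v_{k1} v_{k2}
   (absolutely convergent for v in dot-H^0); terms k1 and -k1 grouped. *)
Definition nl_term (v : seqZ) (k : Z) (tau : R) : C :=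
  let f := fun n : nat =>
    Cplus (nl_summand v k tau (Z.of_nat (S n))) (nl_summand v k tau (- Z.of_nat (S n))%Z) in
  (Series (fun n => fst (f n)), Series (fun n => snd (f n))).

Definition is_solution (T : R) (v0 : seqZ) (v : R -> seqZ) : Prop :=
  (forall t, 0 <= t <= T -> in_H0 (v t)) /\
  (forall t, 0 <= t <= T -> forall eps, 0 < eps ->
     exists delta, 0 < delta /\
       forall s, 0 <= s <= T -> Rabs (s - t) < delta ->
         Hnorm 0 (vsub (v s) (v t)) < eps) /\
  (forall k : Z, k <> 0%Z -> forall t, 0 <= t <= T ->
     exists I : C, is_RInt (fun tau => nl_term (v tau) k tau) 0 t I /\
       Cminus (v t k) (v0 k) = Cmult (Cmult (RtoC (1/2)) (Cmult Ci (RtoC (IZR k)))) I).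

(* Main.v *)
(** Write [z = v - w] and [s = v + w]; then [z_k' = (i k / 2) sum_{a+b=k} e^{3ikabt} s_a z_b], a linear
    equation for [z] whose phase [3kab] never vanishes. Differentiation by parts turns its quadratic
    energy into a quartic sum [sum_{a+b+c+d=0} (1/c) x_a x_b y_c y_d] with phase [3(a+b)(a+c)(b+c)]; the resonant
    part is bounded absolutely, and a second differentiation by parts of the rest gains enough for
    [L^2] bounds, with corrections made small by keeping only high frequencies. Applied to [v] itself
    with frequency cut-offs, where only terms with one high index remain, the same scheme yields
    conservation of the [L^2] norm, so all constants depend on [M] alone.

    For [theta < 0] the product [s z] is not defined by [z] in [H^theta], and this scheme does not close.
    Instead one uses the linear flow truncated to [|k| <= n]: it is bounded in [H^0] uniformly in [n] by the
    energy estimate, and it preserves the bilinear form [sum x_k y_{-k} / k], hence by duality it is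
    bounded in [H^{-1}], and by interpolation in [H^{-1-theta}]. Pairing [z] with a truncated flow
    through the same form conserves the pairing up to an error that vanishes as [n] grows, and
    [H^{-1-theta}] is dual to [H^theta] for this form. *)

Require Import Defs.
From Stdlib Require Import Reals ZArith.
From Stdlib Require Import List Permutation Lra Lia Psatz Classical.
From Coquelicot Require Import Coquelicot.
Import ListNotations.
Open Scope R_scope.

(** All sums are finite, over duplicate-free lists or boxes, with bounds independent of the list.
    The full nonlinearity enters only as the limit of [conv] on boxes, and the box is chosen after
    all other cutoffs.

    The obstacle is the factor [k]. Dividing a cubic sum by its phase [3abc] gains three inverse
    frequencies, but the time derivative released costs one, and the quartic weight [1/|c| + 1/|d|]
    that remains is not absolutely summable against four l2 sequences. The second division gains
    [1/((a+b)(a+c)(b+c))]; after the next loss three inverse factors in three free variables are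
    left, just enough for Cauchy-Schwarz.

    The order of the constants gives the shape of the final bound. The thresholds [N] and [K] of the
    energy estimate depend on the radius [M] alone, not on the truncation [n]. As the l2 norm does
    not grow, the same Gronwall rate serves on every interval, so that time enters only through an
    exponential of [T].

    Interpolation between [H^0] and [H^{-1}] uses the K-functional, which is explicit for weighted
    l2 spaces: a geometric sum of the weights [lam/(k^2 + lam)] over [lam = 4^j] reproduces the
    power weight. *)

Fixpoint rsum {A} (l : list A) (f : A -> R) : R :=
  match l with nil => 0 | a :: l' => f a + rsum l' f end.

Fixpoint csum {A} (l : list A) (f : A -> C) : C :=
  match l with nil => RtoC 0 | a :: l' => (f a + csum l' f)%C end.

Lemma rsum_ext {A} (l : list A) f g :
  (forall a, In a l -> f a = g a) -> rsum l f = rsum l g.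
Proof.
induction l as [|a l IH]; simpl; intros H; auto.
rewrite H, IH; auto.
Qed.

Lemma rsum_le {A} (l : list A) f g :
  (forall a, In a l -> f a <= g a) -> rsum l f <= rsum l g.
Proof.
induction l as [|a l IH]; simpl; intros H; [lra|].
apply Rplus_le_compat; auto.
Qed.

Lemma rsum_0 {A} (l : list A) : rsum l (fun _ => 0) = 0.
Proof. induction l; simpl; lra. Qed.

Lemma rsum_nonneg {A} (l : list A) f :
  (forall a, In a l -> 0 <= f a) -> 0 <= rsum l f.
Proof. intros H; rewrite <- (rsum_0 l); now apply rsum_le. Qed.

Lemma rsum_plus {A} (l : list A) f g :
  rsum l (fun a => f a + g a) = rsum l f + rsum l g.
Proof. induction l; simpl; lra. Qed.

Lemma rsum_scal {A} (l : list A) c f :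
  rsum l (fun a => c * f a) = c * rsum l f.
Proof. induction l as [|a l IH]; simpl; [|rewrite IH]; ring. Qed.

Lemma rsum_scal_r {A} (l : list A) c f :
  rsum l (fun a => f a * c) = rsum l f * c.
Proof. induction l as [|a l IH]; simpl; [|rewrite IH]; ring. Qed.

Lemma rsum_const {A} (l : list A) c : rsum l (fun _ => c) = INR (length l) * c.
Proof.
induction l as [|a l IH]; [simpl; ring|].
cbn [rsum length]; rewrite IH, S_INR; ring.
Qed.

Lemma rsum_exchange {A B} (l : list A) (l' : list B) f :
  rsum l (fun a => rsum l' (fun b => f a b)) =
  rsum l' (fun b => rsum l (fun a => f a b)).
Proof.
induction l as [|a l IH]; simpl; [now rewrite rsum_0|].
now rewrite IH, rsum_plus.
Qed.

Lemma rsum_app {A} (l l' : list A) f : rsum (l ++ l') f = rsum l f + rsum l' f.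
Proof. induction l; simpl; lra. Qed.

Lemma rsum_map {A B} (g : A -> B) (l : list A) f :
  rsum (map g l) f = rsum l (fun a => f (g a)).
Proof. induction l; simpl; [|rewrite IHl]; lra. Qed.

Lemma rsum_list_prod {A B} (l : list A) (l' : list B) f :
  rsum (list_prod l l') f = rsum l (fun a => rsum l' (fun b => f (a, b))).
Proof.
induction l as [|a l IH]; simpl; auto.
now rewrite rsum_app, rsum_map, IH.
Qed.

Lemma rsum_Permutation {A} (l l' : list A) f :
  Permutation l l' -> rsum l f = rsum l' f.
Proof. induction 1; simpl; lra. Qed.

Lemma rsum_incl {A} (l l' : list A) f :
  NoDup l -> incl l l' -> (forall a, 0 <= f a) -> rsum l f <= rsum l' f.
Proof.
revert l'; induction l as [|a l IH]; simpl; intros l' Hn Hi Hf.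
  now apply rsum_nonneg.
assert (Ha : In a l') by (apply Hi; now left).
destruct (in_split _ _ Ha) as (l1 & l2 & ->).
rewrite (rsum_Permutation (l1 ++ a :: l2) (a :: l1 ++ l2));
  [|apply Permutation_sym, Permutation_middle].
simpl; apply Rplus_le_compat_l, IH; auto.
  now inversion Hn.
intros b Hb.
assert (Hab : a <> b) by (intros ->; inversion Hn; auto).
specialize (Hi b (or_intror Hb)).
apply in_app_or in Hi; apply in_or_app; destruct Hi as [Hi|[Hi|Hi]]; auto.
congruence.
Qed.

Lemma rsum_single {A} (l : list A) f a :
  NoDup l -> In a l -> (forall b, In b l -> b <> a -> f b = 0) -> rsum l f = f a.
Proof.
induction l as [|b l IH]; simpl; intros Hn Ha Hf; [tauto|].
inversion Hn as [|? ? Hb Hl]; subst.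
destruct Ha as [->|Ha].
  rewrite (rsum_ext l f (fun _ => 0)), rsum_0; [lra|].
  intros c Hc; apply Hf; auto; congruence.
rewrite Hf, IH; auto; [lra|congruence].
Qed.

Lemma rsum_ge_term {A} (l : list A) f a :
  In a l -> (forall b, In b l -> 0 <= f b) -> f a <= rsum l f.
Proof.
induction l as [|b l IH]; simpl; intros Ha Hf; [tauto|].
destruct Ha as [->|Ha].
  assert (0 <= rsum l f) by (apply rsum_nonneg; auto); lra.
assert (0 <= f b) by auto; assert (f a <= rsum l f) by auto; lra.
Qed.

(** Used where a constraint such as [a + b + c + d = 0] determines the summed index: summing over it
    then costs nothing. *)
Lemma rsum_le_1 {A} (l : list A) (p : A -> bool) y :
  NoDup l -> 0 <= y -> (forall a b, p a = true -> p b = true -> a = b) ->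
  rsum l (fun a => if p a then y else 0) <= y.
Proof.
intros Hn Hy Hp; induction l as [|a l IH]; simpl; auto.
inversion Hn as [|? ? Ha Hl]; subst.
destruct (p a) eqn:Epa.
  rewrite (rsum_ext l _ (fun _ => 0)), rsum_0; [lra|].
  intros b Hb; destruct (p b) eqn:Epb; auto.
  rewrite (Hp a b) in Ha; tauto.
specialize (IH Hl); lra.
Qed.

(** The norms enter through upper bounds [u] and [v], which keeps square roots out. The induction
    step is [2 r <= p + q] whenever [r^2 <= p q], with [p = f^2 G] and [q = g^2 F]. *)
Lemma rsum_CS {A} (l : list A) (f g : A -> R) (u v : R) :
  0 <= u -> 0 <= v ->
  rsum l (fun a => f a ^ 2) <= u ^ 2 -> rsum l (fun a => g a ^ 2) <= v ^ 2 ->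
  rsum l (fun a => f a * g a) <= u * v.
Proof.
intros Hu Hv Hf Hg.
assert (HS : (rsum l (fun a => f a * g a)) ^ 2 <=
   rsum l (fun a => f a ^ 2) * rsum l (fun a => g a ^ 2)).
  clear; induction l as [|a l IH]; [simpl; lra|].
  cbn [rsum].
  set (S := rsum l (fun a => f a * g a)) in *.
  set (F := rsum l (fun a => f a ^ 2)) in *.
  set (G := rsum l (fun a => g a ^ 2)) in *.
  assert (HF : 0 <= F) by (apply rsum_nonneg; intros; nra).
  assert (HG : 0 <= G) by (apply rsum_nonneg; intros; nra).
  assert (H2 : 2 * (f a * g a * S) <= f a ^ 2 * G + g a ^ 2 * F).
    assert (Ha : (f a * g a * S) ^ 2 <= (f a ^ 2 * G) * (g a ^ 2 * F)).
      replace ((f a * g a * S) ^ 2) with ((f a * g a) ^ 2 * S ^ 2) by ring.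
      replace (f a ^ 2 * G * (g a ^ 2 * F)) with ((f a * g a) ^ 2 * (F * G)) by ring.
      apply Rmult_le_compat_l; nra.
    assert (Hp : 0 <= f a ^ 2 * G) by (apply Rmult_le_pos; nra).
    assert (Hq : 0 <= g a ^ 2 * F) by (apply Rmult_le_pos; nra).
    revert Ha Hp Hq; generalize (f a ^ 2 * G) (g a ^ 2 * F) (f a * g a * S).
    intros p q r Ha Hp Hq; apply Rnot_lt_le; intros Hlt.
    assert ((p + q) * (p + q) < (2 * r) * (2 * r)) by (apply Rmult_le_0_lt_compat; lra).
    assert (0 <= (p - q) ^ 2) by apply pow2_ge_0.
    lra.
  nra.
assert (0 <= rsum l (fun a => f a ^ 2)) by (apply rsum_nonneg; intros; nra).
assert (0 <= rsum l (fun a => g a ^ 2)) by (apply rsum_nonneg; intros; nra).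
assert (H3 : (rsum l (fun a => f a * g a)) ^ 2 <= (u * v) ^ 2).
  apply Rle_trans with (1 := HS).
  replace ((u * v) ^ 2) with (u ^ 2 * v ^ 2) by ring.
  now apply Rmult_le_compat.
assert (0 <= u * v) by now apply Rmult_le_pos.
nra.
Qed.

Lemma csum_ext {A} (l : list A) f g :
  (forall a, In a l -> f a = g a) -> csum l f = csum l g.
Proof.
induction l as [|a l IH]; simpl; intros H; auto.
rewrite H, IH; auto.
Qed.

Lemma csum_0 {A} (l : list A) : csum l (fun _ => RtoC 0) = RtoC 0.
Proof. induction l as [|a l IH]; simpl; auto; rewrite IH; ring. Qed.

Lemma csum_plus {A} (l : list A) f g :
  csum l (fun a => f a + g a)%C = (csum l f + csum l g)%C.
Proof. induction l as [|a l IH]; simpl; [|rewrite IH]; ring. Qed.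

Lemma csum_scal {A} (l : list A) c f :
  csum l (fun a => c * f a)%C = (c * csum l f)%C.
Proof. induction l as [|a l IH]; simpl; [|rewrite IH]; ring. Qed.

Lemma csum_scal_r {A} (l : list A) c f :
  csum l (fun a => f a * c)%C = (csum l f * c)%C.
Proof. induction l as [|a l IH]; simpl; [|rewrite IH]; ring. Qed.

Lemma csum_exchange {A B} (l : list A) (l' : list B) f :
  csum l (fun a => csum l' (fun b => f a b)) =
  csum l' (fun b => csum l (fun a => f a b)).
Proof.
induction l as [|a l IH]; simpl; [now rewrite csum_0|].
now rewrite IH, csum_plus.
Qed.

Lemma csum_app {A} (l l' : list A) f :
  csum (l ++ l') f = (csum l f + csum l' f)%C.
Proof. induction l as [|a l IH]; simpl; [|rewrite IH]; ring. Qed.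

Lemma csum_map {A B} (g : A -> B) (l : list A) f :
  csum (map g l) f = csum l (fun a => f (g a)).
Proof. induction l as [|a l IH]; simpl; [|rewrite IH]; auto. Qed.

Lemma csum_Permutation {A} (l l' : list A) f :
  Permutation l l' -> csum l f = csum l' f.
Proof.
induction 1 as [|a l l' _ IH|a b l|l l' l'' _ IH1 _ IH2]; simpl; auto.
- now rewrite IH.
- ring.
- congruence.
Qed.

Lemma csum_single {A} (l : list A) f a :
  NoDup l -> In a l -> (forall b, In b l -> b <> a -> f b = RtoC 0) -> csum l f = f a.
Proof.
induction l as [|b l IH]; simpl; intros Hn Ha Hf; [tauto|].
inversion Hn as [|? ? Hb Hl]; subst.
destruct Ha as [->|Ha].
  rewrite (csum_ext l f (fun _ => RtoC 0)), csum_0; [ring|].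
  intros c Hc; apply Hf; auto; congruence.
rewrite Hf, IH; auto; [ring|congruence].
Qed.

Lemma Cmod_csum {A} (l : list A) f : Cmod (csum l f) <= rsum l (fun a => Cmod (f a)).
Proof.
induction l as [|a l IH]; simpl; [rewrite Cmod_0; lra|].
eapply Rle_trans; [apply Cmod_triangle|lra].
Qed.

(** The value 0 at [k = 0] lets sums of inverse frequencies run over shifted lists, which may meet
    0; a vanishing factor then contributes nothing. *)
Definition inv (k : Z) : R := if (k =? 0)%Z then 0 else / Rabs (IZR k).

Lemma inv_0 : inv 0 = 0.
Proof. reflexivity. Qed.

Lemma Rabs_IZR_ge1 k : k <> 0%Z -> 1 <= Rabs (IZR k).
Proof. intros H; rewrite <- abs_IZR; apply IZR_le; lia. Qed.

Lemma inv_nonneg k : 0 <= inv k.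
Proof.
unfold inv; destruct (Z.eqb_spec k 0) as [_|H]; [lra|].
left; apply Rinv_0_lt_compat; generalize (Rabs_IZR_ge1 k H); lra.
Qed.

Lemma inv_le_1 k : inv k <= 1.
Proof.
unfold inv; destruct (Z.eqb_spec k 0) as [_|H]; [lra|].
rewrite <- Rinv_1; apply Rinv_le_contravar; [lra|now apply Rabs_IZR_ge1].
Qed.

Lemma inv_opp k : inv (- k) = inv k.
Proof.
unfold inv; rewrite opp_IZR, Rabs_Ropp.
destruct (Z.eqb_spec k 0); destruct (Z.eqb_spec (- k) 0); auto; lia.
Qed.

Lemma Rabs_inv_l k : k <> 0%Z -> Rabs (IZR k) * inv k = 1.
Proof.
intros H; unfold inv; destruct (Z.eqb_spec k 0); [lia|].
apply Rinv_r; generalize (Rabs_IZR_ge1 k H); lra.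
Qed.

Lemma Rabs_inv_le k : Rabs (IZR k) * inv k <= 1.
Proof.
destruct (Z.eq_dec k 0) as [->|H]; [rewrite inv_0; lra|].
rewrite Rabs_inv_l; auto; lra.
Qed.

(** * Symmetric frequency boxes and sums of inverse squares *)

Definition box (n : nat) : list Z :=
  map (fun j => Z.of_nat (S j)) (seq 0 n) ++ map (fun j => - Z.of_nat (S j))%Z (seq 0 n).

Lemma in_box n k : In k (box n) <-> (0 < Z.abs k <= Z.of_nat n)%Z.
Proof.
unfold box; rewrite in_app_iff, !in_map_iff; split.
  intros [(j & <- & Hj)|(j & <- & Hj)]; apply in_seq in Hj; lia.
intros H; destruct (Z_lt_le_dec 0 k) as [Hk|Hk]; [left|right];
  exists (Z.to_nat (Z.abs k - 1)); rewrite in_seq; split; lia.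
Qed.

Lemma NoDup_map_inj {A B} (f : A -> B) l :
  (forall a b, f a = f b -> a = b) -> NoDup l -> NoDup (map f l).
Proof.
intros Hf; induction 1 as [|a l Ha Hl IH]; simpl; constructor; auto.
rewrite in_map_iff; intros (b & E & Hb); apply Hf in E; congruence.
Qed.

Lemma NoDup_box n : NoDup (box n).
Proof.
unfold box; apply NoDup_app.
- apply NoDup_map_inj; [intros; lia|apply seq_NoDup].
- apply NoDup_map_inj; [intros; lia|apply seq_NoDup].
- intros a; rewrite !in_map_iff; intros (j & <- & _) (i & E & _); lia.
Qed.

Lemma box_opp n : Permutation (map Z.opp (box n)) (box n).
Proof.
apply NoDup_Permutation; [apply NoDup_map_inj; [intros; lia|apply NoDup_box]|apply NoDup_box|].
intros k; rewrite in_map_iff, in_box; split.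
  intros (j & <- & Hj); apply in_box in Hj; lia.
intros H; exists (- k)%Z; rewrite in_box; lia.
Qed.

Lemma csum_box_opp n f : csum (box n) (fun k => f (- k)%Z) = csum (box n) f.
Proof. rewrite <- csum_map; apply csum_Permutation, box_opp. Qed.

Lemma rsum_box_opp n f : rsum (box n) (fun k => f (- k)%Z) = rsum (box n) f.
Proof. rewrite <- rsum_map; apply rsum_Permutation, box_opp. Qed.

Lemma rsum_box_S n f :
  rsum (box (S n)) f =
  rsum (box n) f + f (Z.of_nat (S n)) + f (- Z.of_nat (S n))%Z.
Proof.
unfold box; rewrite seq_S, !map_app, !rsum_app; rewrite Nat.add_0_l; cbn [map rsum]; lra.
Qed.

Lemma csum_box_S n f :
  csum (box (S n)) f =
  (csum (box n) f + f (Z.of_nat (S n)) + f (- Z.of_nat (S n))%Z)%C.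
Proof.
unfold box; rewrite seq_S, !map_app, !csum_app; rewrite Nat.add_0_l; cbn [map csum]; ring.
Qed.

Lemma list_bound (l : list Z) : exists n, forall k, In k l -> (Z.abs k <= Z.of_nat n)%Z.
Proof.
induction l as [|a l [n Hn]]; [exists O; simpl; tauto|].
exists (Z.to_nat (Z.abs a) + n)%nat; simpl; intros k [<-|Hk]; [|specialize (Hn k Hk)]; lia.
Qed.

(** Comparison with a telescoping series: the pair [j], [-j] contributes [2/j^2], which is at most
    [4/j - 4/(j+1)] for [j >= 1]. The index 0 is harmless because [inv 0 = 0]. *)
Lemma rsum_NoDup_inv2 (N : nat) l :
  NoDup l -> (forall k, In k l -> k = 0%Z \/ (Z.of_nat N < Z.abs k)%Z) ->
  rsum l (fun k => inv k ^ 2) <= 4 / INR (S N).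
Proof.
intros Hn Hl.
destruct (list_bound l) as [m Hm].
set (g := fun k => if (Z.of_nat N <? Z.abs k)%Z then inv k ^ 2 else 0).
assert (Hg0 : forall k, 0 <= g k).
  intros k; unfold g; destruct (_ <? _)%Z; nra.
apply Rle_trans with (rsum (0%Z :: box (N + m)) g).
  rewrite (rsum_ext l _ g).
    apply rsum_incl; auto.
    intros k Hk; destruct (Z.eq_dec k 0) as [->|]; [now left|right].
    apply in_box; specialize (Hm k Hk); lia.
  intros k Hk; unfold g; destruct (Z.ltb_spec (Z.of_nat N) (Z.abs k)); auto.
  destruct (Hl k Hk) as [->|]; [rewrite inv_0; ring|lia].
assert (Hg00 : g 0%Z = 0).
  unfold g; destruct (_ <? _)%Z; auto; rewrite inv_0; ring.
cbn [rsum]; rewrite Hg00, Rplus_0_l.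
assert (Hbox : rsum (box (N + m)) g <= 4 / INR (S N) - 4 / INR (S (N + m))).
  clear -Hg0.
  induction m as [|m IH].
    rewrite Nat.add_0_r; replace (_ - _) with 0 by ring.
    rewrite (rsum_ext _ g (fun _ => 0)), rsum_0; [lra|].
    intros k Hk; apply in_box in Hk; unfold g.
    destruct (Z.ltb_spec (Z.of_nat N) (Z.abs k)); auto; lia.
  rewrite Nat.add_succ_r, rsum_box_S.
  assert (Hp : g (Z.of_nat (S (N + m))) = / INR (S (N + m)) ^ 2).
    unfold g; destruct (Z.ltb_spec (Z.of_nat N) (Z.abs (Z.of_nat (S (N + m))))); [|lia].
    unfold inv; destruct (Z.eqb_spec (Z.of_nat (S (N + m))) 0); [lia|].
    rewrite <- abs_IZR, Z.abs_eq, <- INR_IZR_INZ, pow_inv; auto; lia.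
  assert (Hq : g (- Z.of_nat (S (N + m)))%Z = / INR (S (N + m)) ^ 2).
    rewrite <- Hp; unfold g; now rewrite Z.abs_opp, inv_opp.
  rewrite Hp, Hq.
  assert (Hj : 1 <= INR (S (N + m))) by (rewrite S_INR; generalize (pos_INR (N + m)); lra).
  rewrite (S_INR (S (N + m))).
  revert Hj IH; generalize (INR (S (N + m))); intros j Hj IH.
  enough (2 * / j ^ 2 <= 4 / j - 4 / (j + 1)) by lra.
  apply Rmult_le_reg_l with (j ^ 2 * (j + 1)); [nra|].
  replace (j ^ 2 * (j + 1) * (2 * / j ^ 2)) with (2 * (j + 1)) by (field; lra).
  replace (j ^ 2 * (j + 1) * (4 / j - 4 / (j + 1))) with (4 * j) by (field; lra).
  lra.
assert (0 < / INR (S (N + m))) by (apply Rinv_0_lt_compat, lt_0_INR; lia).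
lra.
Qed.

Lemma rsum_inv2_shift l b (s : Z) :
  NoDup l -> (s = 1 \/ s = -1)%Z -> rsum l (fun a => inv (b + s * a) ^ 2) <= 2 ^ 2.
Proof.
intros Hn Hs.
rewrite <- (rsum_map (fun a => b + s * a)%Z l (fun k => inv k ^ 2)).
apply Rle_trans with (4 / INR 1); [|simpl; lra].
apply rsum_NoDup_inv2; [|intros; lia].
apply NoDup_map_inj; auto; intros ? ? ?; destruct Hs; nia.
Qed.

(** * Square-summable sequences against inverse frequencies *)

Definition l2le (l : list Z) (x : Z -> R) (m : R) : Prop :=
  0 <= m /\ (forall k, 0 <= x k) /\ rsum l (fun k => x k ^ 2) <= m ^ 2.

Lemma l2le_term l x m k : l2le l x m -> In k l -> x k <= m.
Proof.
intros (Hm & H0 & H) Hk.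
assert (x k ^ 2 <= m ^ 2).
  apply Rle_trans with (2 := H); apply (rsum_ge_term l (fun k => x k ^ 2)); auto; intros; nra.
specialize (H0 k); nra.
Qed.

Lemma l2le_mono l x y m m' : l2le l y m -> (forall k, 0 <= x k <= y k) -> m <= m' -> l2le l x m'.
Proof.
intros (Hm & H0 & H) Hxy Hmm; split; [lra|split; [intros k; apply Hxy|]].
apply Rle_trans with (m ^ 2); [|nra].
apply Rle_trans with (2 := H); apply rsum_le; intros k _; specialize (Hxy k); nra.
Qed.

Lemma sum_inv_shift l x m b : NoDup l -> l2le l x m -> rsum l (fun a => x a * inv (b + a)) <= 2 * m.
Proof.
intros Hn (Hm & H0 & H); replace (2 * m) with (m * 2) by ring; apply rsum_CS; auto; [lra|].
rewrite (rsum_ext l _ (fun a => inv (b + 1 * a) ^ 2)).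
  apply rsum_inv2_shift; auto.
intros a _; now rewrite Z.mul_1_l.
Qed.

Lemma sum_inv l x m : NoDup l -> l2le l x m -> rsum l (fun a => x a * inv a) <= 2 * m.
Proof. intros Hn H; exact (sum_inv_shift l x m 0 Hn H). Qed.

(** Cauchy-Schwarz in [a]. For each [a] at most one [b] meets the constraint, so the inner sum [p]
    is a rearranged part of [y] and inherits its l2 bound. *)
Lemma sum_conv l x y m m' n :
  NoDup l -> l2le l x m -> l2le l y m' ->
  rsum l (fun a => rsum l (fun b => if (a + b =? n)%Z then x a * y b else 0)) <= m * m'.
Proof.
intros Hn (Hm & Hx0 & Hx) (Hm' & Hy0 & Hy).
set (p := fun a => rsum l (fun b => if (a + b =? n)%Z then y b else 0)).
rewrite (rsum_ext l _ (fun a => x a * p a)).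
2:{ intros a _; unfold p; rewrite <- rsum_scal; apply rsum_ext; intros b _.
    destruct (_ =? _)%Z; ring. }
apply rsum_CS; auto.
apply Rle_trans with (rsum l (fun a => rsum l (fun b => if (a + b =? n)%Z then y b ^ 2 else 0))).
  apply rsum_le; intros a _; unfold p.
  destruct (in_dec Z.eq_dec (n - a)%Z l) as [Hi|Hi].
    rewrite !(rsum_single l _ (n - a)%Z); auto.
    - destruct (Z.eqb_spec (a + (n - a)) n); [lra|lia].
    - intros b _ Hb; destruct (Z.eqb_spec (a + b) n); auto; lia.
    - intros b _ Hb; destruct (Z.eqb_spec (a + b) n); auto; lia.
  assert (HE : forall b, In b l -> (a + b =? n)%Z = false).
    intros b Hb; apply Z.eqb_neq; intros E; apply Hi; now replace (n - a)%Z with b by lia.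
  rewrite (rsum_ext l (fun b => if (a + b =? n)%Z then y b else 0) (fun _ => 0)).
    rewrite (rsum_ext l (fun b => if (a + b =? n)%Z then y b ^ 2 else 0) (fun _ => 0)); [rewrite rsum_0; lra|].
    intros b Hb; now rewrite HE.
  intros b Hb; now rewrite HE.
rewrite rsum_exchange.
apply Rle_trans with (2 := Hy); apply rsum_le; intros b _.
apply rsum_le_1; auto; [nra|].
intros a a' Ha Ha'; apply Z.eqb_eq in Ha; apply Z.eqb_eq in Ha'; lia.
Qed.

(** With [c] frozen, the sums over [b] and [d] decouple and each costs a factor 2 by Cauchy-Schwarz;
    the remaining [inv c] pays for the sum over [c] with another 2. *)
Lemma sum_type_Q l x y z m1 m2 m3 :
  NoDup l -> l2le l x m1 -> l2le l y m2 -> l2le l z m3 ->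
  rsum l (fun b => rsum l (fun c => rsum l (fun d =>
    x b * y c * z d * (inv c * inv (c + b) * inv (c + d))))) <= 8 * (m1 * m2 * m3).
Proof.
intros Hn Hx Hy Hz; rewrite rsum_exchange.
apply Rle_trans with (rsum l (fun c => (y c * inv c) * ((2 * m1) * (2 * m3)))).
  apply rsum_le; intros c _.
  rewrite (rsum_ext l _ (fun b => (y c * inv c) * ((x b * inv (c + b)) *
     rsum l (fun d => z d * inv (c + d))))).
    rewrite rsum_scal, rsum_scal_r.
    apply Rmult_le_compat_l.
      destruct Hy as (_ & Hy & _); apply Rmult_le_pos; auto; apply inv_nonneg.
    assert (Hp : forall u, (forall k, 0 <= u k) -> 0 <= rsum l (fun k => u k * inv (c + k))).
      intros u Hu; apply rsum_nonneg; intros; apply Rmult_le_pos; auto; apply inv_nonneg.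
    apply Rmult_le_compat; try apply Hp; try apply Hx; try apply Hz; now apply sum_inv_shift.
  intros b _; rewrite <- !rsum_scal; apply rsum_ext; intros d _; ring.
rewrite rsum_scal_r.
replace (8 * (m1 * m2 * m3)) with (2 * m2 * ((2 * m1) * (2 * m3))) by ring.
apply Rmult_le_compat_r; [|now apply sum_inv].
destruct Hx as (? & _), Hz as (? & _); repeat apply Rmult_le_pos; lra.
Qed.

(* Cauchy-Schwarz on triples, splitting the kernel as [inv (c+d)] against [inv (b+c) * inv (d+b)]. *)
Lemma sum_type_P l x y z m1 m2 m3 :
  NoDup l -> l2le l x m1 -> l2le l y m2 -> l2le l z m3 ->
  rsum l (fun b => rsum l (fun c => rsum l (fun d =>
    x b * y c * z d * (inv (b + c) * inv (c + d) * inv (d + b))))) <= 8 * (m1 * m2 * m3).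
Proof.
intros Hn (Hm1 & Hx0 & Hx) (Hm2 & Hy0 & Hy) (Hm3 & Hz0 & Hz).
set (L := list_prod l (list_prod l l)).
set (f := fun q : Z * (Z * Z) => x (fst q) * y (fst (snd q)) * inv (fst (snd q) + snd (snd q))).
set (g := fun q : Z * (Z * Z) => z (snd (snd q)) * inv (fst q + fst (snd q)) * inv (snd (snd q) + fst q)).
replace (rsum l _) with (rsum L (fun q => f q * g q)).
2:{ unfold L; rewrite rsum_list_prod; apply rsum_ext; intros b _.
    rewrite rsum_list_prod; apply rsum_ext; intros c _; apply rsum_ext; intros d _.
    unfold f, g; cbn [fst snd]; ring. }
replace (8 * (m1 * m2 * m3)) with ((2 * m1 * m2) * (4 * m3)) by ring.
assert (Hinv : forall b, rsum l (fun a => inv (b + a) ^ 2) <= 4).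
  intros b; rewrite (rsum_ext l _ (fun a => inv (b + 1 * a) ^ 2)).
    eapply Rle_trans; [apply rsum_inv2_shift; auto|lra].
  intros a _; now rewrite Z.mul_1_l.
assert (Hinv' : forall b, rsum l (fun a => inv (a + b) ^ 2) <= 4).
  intros b; rewrite (rsum_ext l _ (fun a => inv (b + a) ^ 2)); auto.
  intros a _; now rewrite Z.add_comm.
apply rsum_CS.
- apply Rmult_le_pos; lra.
- lra.
- unfold L; rewrite rsum_list_prod.
  apply Rle_trans with (rsum l (fun b => x b ^ 2 * (m2 ^ 2 * 4))).
    apply rsum_le; intros b _; rewrite rsum_list_prod.
    apply Rle_trans with (rsum l (fun c => x b ^ 2 * (y c ^ 2 * 4))).
      apply rsum_le; intros c _.
      rewrite (rsum_ext l _ (fun d => (x b ^ 2 * y c ^ 2) * inv (c + d) ^ 2)).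
        rewrite rsum_scal, <- Rmult_assoc; apply Rmult_le_compat_l; auto.
        apply Rmult_le_pos; nra.
      intros d _; unfold f; cbn [fst snd]; ring.
    rewrite rsum_scal, rsum_scal_r; apply Rmult_le_compat_l; nra.
  rewrite rsum_scal_r; replace ((2 * m1 * m2) ^ 2) with (m1 ^ 2 * (m2 ^ 2 * 4)) by ring.
  apply Rmult_le_compat_r; nra.
- unfold L; rewrite rsum_list_prod.
  apply Rle_trans with (rsum l (fun b => rsum l (fun d => (z d * inv (d + b)) ^ 2 * 4))).
    apply rsum_le; intros b _; rewrite rsum_list_prod, rsum_exchange.
    apply rsum_le; intros d _.
    rewrite (rsum_ext l _ (fun c => (z d * inv (d + b)) ^ 2 * inv (b + c) ^ 2)).
      rewrite rsum_scal; apply Rmult_le_compat_l; auto; nra.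
    intros c _; unfold g; cbn [fst snd]; ring.
  rewrite rsum_exchange.
  apply Rle_trans with (rsum l (fun d => z d ^ 2 * 16)).
    apply rsum_le; intros d _.
    rewrite (rsum_ext l _ (fun b => (z d ^ 2 * 4) * inv (d + b) ^ 2)) by (intros; ring).
    rewrite rsum_scal; replace (z d ^ 2 * 16) with (z d ^ 2 * 4 * 4) by ring.
    apply Rmult_le_compat_l; auto; nra.
  rewrite rsum_scal_r; nra.
Qed.

(** * Quartic kernels *)

Definition rsum3 (l : list Z) (F : Z -> Z -> Z -> R) : R :=
  rsum l (fun a => rsum l (fun b => rsum l (fun c => F a b c))).

Definition qsum (l : list Z) (F : Z -> Z -> Z -> Z -> R) : R :=
  rsum l (fun a => rsum l (fun b => rsum l (fun c => rsum l (fun d =>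
    if (a + b + c + d =? 0)%Z then F a b c d else 0)))).

Lemma rsum3_le l F G :
  (forall a b c, In a l -> In b l -> In c l -> F a b c <= G a b c) ->
  rsum3 l F <= rsum3 l G.
Proof. intros H; do 3 (apply rsum_le; intros); auto. Qed.

Lemma qsum_le l F G :
  (forall a b c d, In a l -> In b l -> In c l -> In d l ->
     (a + b + c + d = 0)%Z -> F a b c d <= G a b c d) ->
  qsum l F <= qsum l G.
Proof.
intros H; do 4 (apply rsum_le; intros).
destruct (Z.eqb_spec (a + a0 + a1 + a2) 0); [auto|lra].
Qed.

Lemma qsum_plus l F G :
  qsum l (fun a b c d => F a b c d + G a b c d) = qsum l F + qsum l G.
Proof.
unfold qsum; do 3 (rewrite <- rsum_plus; apply rsum_ext; intros).
rewrite <- rsum_plus; apply rsum_ext; intros.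
destruct (_ =? _)%Z; ring.
Qed.

Lemma qsum_scal l k F : qsum l (fun a b c d => k * F a b c d) = k * qsum l F.
Proof.
unfold qsum; do 3 (rewrite <- rsum_scal; apply rsum_ext; intros).
rewrite <- rsum_scal; apply rsum_ext; intros.
destruct (_ =? _)%Z; ring.
Qed.

(** The constraint leaves at most one value of [d], so the fourth sum is free. *)
Lemma qsum_free_4 l F :
  NoDup l -> (forall a b c, 0 <= F a b c) ->
  qsum l (fun a b c d => F a b c) <= rsum3 l F.
Proof.
intros Hn HF; do 3 (apply rsum_le; intros).
apply rsum_le_1; auto.
intros d d' E E'; apply Z.eqb_eq in E; apply Z.eqb_eq in E'; lia.
Qed.

Lemma qsum_swap34 l F : qsum l F = qsum l (fun a b c d => F a b d c).
Proof.
apply rsum_ext; intros a _; apply rsum_ext; intros b _.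
rewrite rsum_exchange; apply rsum_ext; intros c _; apply rsum_ext; intros d _.
now replace (a + b + d + c)%Z with (a + b + c + d)%Z by ring.
Qed.

Lemma qsum_swap23 l F : qsum l F = qsum l (fun a b c d => F a c b d).
Proof.
apply rsum_ext; intros a _.
rewrite rsum_exchange; apply rsum_ext; intros b _; apply rsum_ext; intros c _.
apply rsum_ext; intros d _.
now replace (a + c + b + d)%Z with (a + b + c + d)%Z by ring.
Qed.

Lemma qsum_swap12 l F : qsum l F = qsum l (fun a b c d => F b a c d).
Proof.
unfold qsum; rewrite rsum_exchange.
apply rsum_ext; intros a _; apply rsum_ext; intros b _; apply rsum_ext; intros c _.
apply rsum_ext; intros d _.
now replace (b + a + c + d)%Z with (a + b + c + d)%Z by ring.
Qed.

Lemma qsum_free_3 l F :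
  NoDup l -> (forall a b c, 0 <= F a b c) ->
  qsum l (fun a b c d => F a b d) <= rsum3 l F.
Proof. intros; rewrite qsum_swap34; now apply qsum_free_4. Qed.

Lemma qsum_free_2 l F :
  NoDup l -> (forall a b c, 0 <= F a b c) ->
  qsum l (fun a b c d => F a c d) <= rsum3 l F.
Proof. intros; rewrite qsum_swap23; now apply qsum_free_3. Qed.

Lemma qsum_free_1 l F :
  NoDup l -> (forall a b c, 0 <= F a b c) ->
  qsum l (fun a b c d => F b c d) <= rsum3 l F.
Proof. intros; rewrite qsum_swap12; now apply qsum_free_2. Qed.

(** These are the shapes left once a derivative has cancelled one inverse factor of [wt]: two
    kernels centred at a single frequency, and [kerP], made of pair sums only. *)
Definition kerQ2 b c d := inv c * inv (c + b) * inv (c + d).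
Definition kerQ3 b c d := inv d * inv (d + b) * inv (d + c).
Definition kerP b c d := inv (b + c) * inv (c + d) * inv (d + b).

Definition ker b c d := kerQ2 b c d + kerQ3 b c d + kerP b c d.

Lemma kerQ2_pos b c d : 0 <= kerQ2 b c d.
Proof. unfold kerQ2; repeat apply Rmult_le_pos; apply inv_nonneg. Qed.
Lemma kerQ3_pos b c d : 0 <= kerQ3 b c d.
Proof. unfold kerQ3; repeat apply Rmult_le_pos; apply inv_nonneg. Qed.
Lemma kerP_pos b c d : 0 <= kerP b c d.
Proof. unfold kerP; repeat apply Rmult_le_pos; apply inv_nonneg. Qed.

Lemma ker_pos b c d : 0 <= ker b c d.
Proof.
unfold ker; generalize (kerQ2_pos b c d) (kerQ3_pos b c d) (kerP_pos b c d); lra.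
Qed.

(** Each of the three kernels costs 8; [kerQ3] is [kerQ2] with the last two variables exchanged. *)
Lemma rsum3_ker l x y z m1 m2 m3 :
  NoDup l -> l2le l x m1 -> l2le l y m2 -> l2le l z m3 ->
  rsum3 l (fun b c d => x b * y c * z d * ker b c d) <= 24 * (m1 * m2 * m3).
Proof.
intros Hn Hx Hy Hz.
assert (H2 : rsum3 l (fun b c d => x b * y c * z d * kerQ2 b c d) <= 8 * (m1 * m2 * m3)).
  now apply sum_type_Q.
assert (H3 : rsum3 l (fun b c d => x b * y c * z d * kerQ3 b c d) <= 8 * (m1 * m2 * m3)).
  replace (m1 * m2 * m3) with (m1 * m3 * m2) by ring.
  refine (Rle_trans _ _ _ _ (sum_type_Q l x z y m1 m3 m2 Hn Hx Hz Hy)).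
  apply rsum_le; intros b _; rewrite rsum_exchange; apply Req_le.
  apply rsum_ext; intros c _; apply rsum_ext; intros d _; unfold kerQ3; ring.
assert (HP : rsum3 l (fun b c d => x b * y c * z d * kerP b c d) <= 8 * (m1 * m2 * m3)).
  now apply sum_type_P.
replace (rsum3 l _) with
  (rsum3 l (fun b c d => x b * y c * z d * kerQ2 b c d) +
   rsum3 l (fun b c d => x b * y c * z d * kerQ3 b c d) +
   rsum3 l (fun b c d => x b * y c * z d * kerP b c d)); [lra|].
unfold rsum3; rewrite <- !rsum_plus; apply rsum_ext; intros b _.
rewrite <- !rsum_plus; apply rsum_ext; intros c _.
rewrite <- !rsum_plus; apply rsum_ext; intros d _; unfold ker; ring.
Qed.

Lemma l2le_prod_pos l x y z m1 m2 m3 :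
  l2le l x m1 -> l2le l y m2 -> l2le l z m3 ->
  forall b c d, 0 <= x b * y c * z d * ker b c d.
Proof.
intros (_ & Hx & _) (_ & Hy & _) (_ & Hz & _) b c d.
apply Rmult_le_pos; [|apply ker_pos]; repeat apply Rmult_le_pos; auto.
Qed.

Section Ker.
Variables (l : list Z) (x y z : Z -> R) (m1 m2 m3 : R).
Hypotheses (Hn : NoDup l) (Hx : l2le l x m1) (Hy : l2le l y m2) (Hz : l2le l z m3).

Let Hpos : forall b c d, 0 <= x b * y c * z d * ker b c d.
Proof. exact (l2le_prod_pos _ _ _ _ _ _ _ Hx Hy Hz). Qed.

Lemma qsum_ker_1 : qsum l (fun a b c d => x b * y c * z d * ker b c d) <= 24 * (m1 * m2 * m3).
Proof.
eapply Rle_trans; [apply (qsum_free_1 l (fun b c d => x b * y c * z d * ker b c d)); auto|].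
now apply rsum3_ker.
Qed.

Lemma qsum_ker_2 : qsum l (fun a b c d => x a * y c * z d * ker a c d) <= 24 * (m1 * m2 * m3).
Proof.
eapply Rle_trans; [apply (qsum_free_2 l (fun b c d => x b * y c * z d * ker b c d)); auto|].
now apply rsum3_ker.
Qed.

Lemma qsum_ker_3 : qsum l (fun a b c d => x a * y b * z d * ker a b d) <= 24 * (m1 * m2 * m3).
Proof.
eapply Rle_trans; [apply (qsum_free_3 l (fun b c d => x b * y c * z d * ker b c d)); auto|].
now apply rsum3_ker.
Qed.

Lemma qsum_ker_4 : qsum l (fun a b c d => x a * y b * z c * ker a b c) <= 24 * (m1 * m2 * m3).
Proof.
eapply Rle_trans; [apply (qsum_free_4 l (fun b c d => x b * y c * z d * ker b c d)); auto|].
now apply rsum3_ker.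
Qed.
End Ker.

(** Size, up to the factor 3, of a quartic multiplier bounded by [1/|c| + 1/|d|] after division by
    the phase [3(a+b)(a+c)(b+c)]. *)
Definition wt a b c d := (inv c + inv d) * (inv (a + b) * inv (a + c) * inv (b + c)).

Lemma wt_pos a b c d : 0 <= wt a b c d.
Proof.
unfold wt; repeat apply Rmult_le_pos; try apply inv_nonneg.
generalize (inv_nonneg c) (inv_nonneg d); lra.
Qed.

Lemma inv_eq_opp x y : (x + y = 0)%Z -> inv x = inv y.
Proof. intros H; replace x with (- y)%Z by lia; apply inv_opp. Qed.

(** Since [|x| <= |y| + |x + y|], a derivative at frequency [x] cancels one of the two inverse
    factors. *)
Lemma inv_inv_sum x y : Rabs (IZR x) * (inv y * inv (x + y)) <= inv y + inv (x + y).
Proof.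
assert (H : Rabs (IZR x) <= Rabs (IZR (x + y)) + Rabs (IZR y)).
  replace (IZR x) with (IZR (x + y) + - IZR y) by (rewrite plus_IZR; ring).
  eapply Rle_trans; [apply Rabs_triang|]; rewrite Rabs_Ropp; lra.
generalize (inv_nonneg y) (inv_nonneg (x + y)) (Rabs_inv_le y) (Rabs_inv_le (x + y)).
intros H1 H2 H3 H4.
apply Rle_trans with ((Rabs (IZR (x + y)) + Rabs (IZR y)) * (inv y * inv (x + y))).
  apply Rmult_le_compat_r; auto; now apply Rmult_le_pos.
replace ((Rabs (IZR (x + y)) + Rabs (IZR y)) * (inv y * inv (x + y))) with
  (inv y * (Rabs (IZR (x + y)) * inv (x + y)) + inv (x + y) * (Rabs (IZR y) * inv y)) by ring.
apply Rplus_le_compat; rewrite <- Rmult_1_r; now apply Rmult_le_compat_l.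
Qed.

(** The factor [|a|] is the cost of a derivative falling on the sequence at [a]. It cancels [inv c]
    or [inv (a + c)] in one half of the weight, [inv d] or [inv (a + d) = inv (b + c)] in the other.
    Zero sum rewrites what remains in [b], [c], [d]. *)
Lemma wt_1 a b c d : (a + b + c + d = 0)%Z -> Rabs (IZR a) * wt a b c d <= 2 * ker b c d.
Proof.
intros H; unfold wt, ker, kerQ2, kerQ3, kerP.
rewrite (inv_eq_opp (a + b) (c + d)), (Z.add_comm c b), (Z.add_comm d b), (Z.add_comm d c) by lia.
assert (Hc := inv_inv_sum a c); assert (Hd := inv_inv_sum a d).
rewrite (inv_eq_opp (a + c) (b + d)) in * by lia.
rewrite (inv_eq_opp (a + d) (b + c)) in * by lia.
generalize (inv_nonneg (c + d)) (inv_nonneg (b + d)) (inv_nonneg (b + c)).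
generalize (inv_nonneg c) (inv_nonneg d).
revert Hc Hd; generalize (inv (c + d)) (inv (b + d)) (inv (b + c)) (inv c) (inv d) (Rabs (IZR a)).
intros u v w p q r Hc Hd Hp Hq Hu Hv Hw.
assert (H1 : u * w * (r * (p * v)) <= u * w * (p + v)) by (apply Rmult_le_compat_l; nra).
assert (H2 : u * v * (r * (q * w)) <= u * v * (q + w)) by (apply Rmult_le_compat_l; nra).
assert (0 <= p * u * w) by (repeat apply Rmult_le_pos; auto).
assert (0 <= q * u * v) by (repeat apply Rmult_le_pos; auto).
lra.
Qed.

Lemma wt_sym12 a b c d : wt b a c d = wt a b c d.
Proof. unfold wt; rewrite (Z.add_comm b a); ring. Qed.

Lemma wt_sym34 a b c d : (a + b + c + d = 0)%Z -> wt a b d c = wt a b c d.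
Proof.
intros H; unfold wt; rewrite (inv_eq_opp (a + d) (b + c)), (inv_eq_opp (b + d) (a + c)) by lia; ring.
Qed.

Lemma wt_2 a b c d : (a + b + c + d = 0)%Z -> Rabs (IZR b) * wt a b c d <= 2 * ker a c d.
Proof. intros H; rewrite wt_sym12; apply wt_1; lia. Qed.

(** In the half with [inv d] the derivative cancels that factor outright; in the half with [inv c]
    it is shared between [inv c] and [inv (c + d) = inv (a + b)]. *)
Lemma wt_4 a b c d : (a + b + c + d = 0)%Z -> Rabs (IZR d) * wt a b c d <= 2 * ker a b c.
Proof.
intros H; unfold wt, ker, kerQ2, kerQ3, kerP.
assert (Hd := inv_inv_sum d c); assert (Hd' := Rabs_inv_le d).
rewrite (Z.add_comm d c) in Hd; rewrite (inv_eq_opp (c + d) (a + b)) in Hd by lia.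
rewrite (Z.add_comm c a), (Z.add_comm c b).
generalize (inv_nonneg (a + b)) (inv_nonneg (a + c)) (inv_nonneg (b + c)).
generalize (inv_nonneg b) (inv_nonneg c) (inv_nonneg d) (inv_nonneg (b + a)).
revert Hd Hd'; generalize (inv (a + b)) (inv (a + c)) (inv (b + c)) (inv b) (inv c) (inv d)
  (inv (b + a)) (Rabs (IZR d)).
intros u v w o p q u' r Hd Hd' Ho Hp Hq Hu' Hu Hv Hw.
assert (H1 : v * w * (r * (p * u)) <= v * w * (p + u)) by (apply Rmult_le_compat_l; nra).
assert (H2 : u * v * w * (r * q) <= u * v * w * 1).
  apply Rmult_le_compat_l; auto; repeat apply Rmult_le_pos; auto.
assert (0 <= p * v * w) by (repeat apply Rmult_le_pos; auto).
assert (0 <= o * u' * w) by (repeat apply Rmult_le_pos; auto).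
lra.
Qed.

Lemma wt_3 a b c d : (a + b + c + d = 0)%Z -> Rabs (IZR c) * wt a b c d <= 2 * ker a b d.
Proof. intros H; rewrite <- wt_sym34 by auto; apply wt_4; lia. Qed.

Lemma inv_half (K k : Z) : (0 < K)%Z -> (K < 2 * Z.abs k)%Z -> inv k <= 2 / IZR K.
Proof.
intros HK H; unfold inv; destruct (Z.eqb_spec k 0); [subst; simpl in H; lia|].
assert (HK' : 0 < IZR K) by now apply IZR_lt.
replace (2 / IZR K) with (/ (IZR K / 2)) by (field; lra).
rewrite <- abs_IZR; apply Rinv_le_contravar; [lra|].
assert (IZR K < IZR (2 * Z.abs k)) by now apply IZR_lt.
rewrite mult_IZR in *; lra.
Qed.

(* One of the four factors of [inv c * inv (a+b) * inv (a+c) * inv (b+c)]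
   has argument larger than [K/2]; dropping it leaves one of the kernels. *)
Lemma wt_high (K : Z) a b c d : (0 < K)%Z -> (a + b + c + d = 0)%Z ->
  (K < Z.abs a \/ K < Z.abs b \/ K < Z.abs c \/ K < Z.abs d)%Z ->
  wt a b c d <= 2 / IZR K * (ker a b c + ker b c d + ker a c d + ker a b d).
Proof.
intros HK HS Hhi.
assert (Hhalf : forall c d, (a + b + c + d = 0)%Z ->
   (K < Z.abs a \/ K < Z.abs b \/ K < Z.abs c \/ K < Z.abs d)%Z ->
   inv c * (inv (a + b) * inv (a + c) * inv (b + c)) <=
   2 / IZR K * (kerP a b c + inv c * inv (a + c) * inv (b + c) + inv c * inv (c + d) * inv (b + c)
     + inv c * inv (c + d) * inv (a + c))).
  clear c d HS Hhi; intros c d HS Hhi.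
  unfold kerP; rewrite (Z.add_comm c a), (inv_eq_opp (c + d) (a + b)) by lia.
  (* If all four arguments had size at most [K/2], then [2a = (a+b) + (a+c) - (b+c)], the analogue
     for [b], and [d = -(a+b) - c] would keep every frequency within [K]. *)
  assert (Hm : (K < 2 * Z.abs c \/ K < 2 * Z.abs (a + b) \/ K < 2 * Z.abs (a + c)
               \/ K < 2 * Z.abs (b + c))%Z) by lia.
  generalize (inv_nonneg (a + b)) (inv_nonneg (a + c)) (inv_nonneg (b + c)) (inv_nonneg c).
  assert (Hk : inv c <= 2 / IZR K \/ inv (a + b) <= 2 / IZR K \/ inv (a + c) <= 2 / IZR K
               \/ inv (b + c) <= 2 / IZR K).
    destruct Hm as [Hm|[Hm|[Hm|Hm]]]; apply inv_half in Hm; tauto.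
  revert Hk; generalize (inv (a + b)) (inv (a + c)) (inv (b + c)) (inv c) (2 / IZR K).
  intros u v w p k Hk Hu Hv Hw Hp.
  assert (0 <= u * v * w) by (repeat apply Rmult_le_pos; auto).
  assert (0 <= p * v * w) by (repeat apply Rmult_le_pos; auto).
  assert (0 <= p * u * w) by (repeat apply Rmult_le_pos; auto).
  assert (0 <= p * u * v) by (repeat apply Rmult_le_pos; auto).
  assert (Hk0 : 0 <= k) by (destruct Hk as [|[|[|]]]; lra).
  replace (u * w * v) with (u * v * w) by ring.
  apply Rle_trans with (k * (u * v * w) + k * (p * v * w) + k * (p * u * w) + k * (p * u * v)); [|lra].
  assert (0 <= k * (u * v * w)) by (apply Rmult_le_pos; auto).
  assert (0 <= k * (p * v * w)) by (apply Rmult_le_pos; auto).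
  assert (0 <= k * (p * u * w)) by (apply Rmult_le_pos; auto).
  assert (0 <= k * (p * u * v)) by (apply Rmult_le_pos; auto).
  destruct Hk as [Hk|[Hk|[Hk|Hk]]].
  - replace (p * (u * v * w)) with (p * (u * v * w)) by ring.
    assert (p * (u * v * w) <= k * (u * v * w)) by (apply Rmult_le_compat_r; auto); lra.
  - assert (u * (p * v * w) <= k * (p * v * w)) by (apply Rmult_le_compat_r; auto); lra.
  - assert (v * (p * u * w) <= k * (p * u * w)) by (apply Rmult_le_compat_r; auto); lra.
  - assert (w * (p * u * v) <= k * (p * u * v)) by (apply Rmult_le_compat_r; auto); lra. 
assert (H1 := Hhalf c d HS Hhi).
assert (H2 := Hhalf d c ltac:(lia) ltac:(tauto)).
unfold wt.
rewrite (inv_eq_opp (a + d) (b + c)), (inv_eq_opp (b + d) (a + c)) in H2 by lia.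
apply Rle_trans with (1 := Req_le _ _ (Rmult_plus_distr_r _ _ _)).
replace (inv (a + b) * inv (b + c) * inv (a + c)) with (inv (a + b) * inv (a + c) * inv (b + c)) in H2 by ring.
apply Rle_trans with (1 := Rplus_le_compat _ _ _ _ H1 H2).
rewrite <- Rmult_plus_distr_l; apply Rmult_le_compat_l.
  left; apply Rdiv_lt_0_compat; [lra|now apply IZR_lt].
unfold ker, kerQ2, kerQ3.
generalize (kerP_pos a b c) (kerP_pos a b d) (kerP_pos b c d) (kerP_pos a c d).
intros.
rewrite (Z.add_comm c a), (Z.add_comm c b), (Z.add_comm d b), (Z.add_comm d a), (Z.add_comm d c).
rewrite (inv_eq_opp (a + d) (b + c)), (inv_eq_opp (b + d) (a + c)) by lia.
assert (Hq : forall x y z, 0 <= inv x * inv y * inv z).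
  intros; repeat apply Rmult_le_pos; apply inv_nonneg.
generalize (Hq b (b + a) (b + c))%Z (Hq b (b + a) (a + c))%Z; intros.
lra.
Qed.

(** * Quartic normal form *)

(** Componentwise, so that the real mean value theorem and Gronwall's lemma apply directly to real
    parts. *)
Definition Cder (f : R -> C) (t : R) (d : C) : Prop :=
  is_derive (fun s => fst (f s)) t (fst d) /\ is_derive (fun s => snd (f s)) t (snd d).

Lemma Cder_const c t : Cder (fun _ => c) t (RtoC 0).
Proof. split; simpl; apply @is_derive_const. Qed.

Lemma Cder_plus f g t d e : Cder f t d -> Cder g t e -> Cder (fun s => f s + g s)%C t (d + e)%C.
Proof. intros [H1 H2] [H3 H4]; split; simpl; now apply @is_derive_plus. Qed.

Lemma Cder_mult f g t d e :
  Cder f t d -> Cder g t e -> Cder (fun s => f s * g s)%C t (d * g t + f t * e)%C.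
Proof.
intros [H1 H2] [H3 H4]; split; simpl.
- replace (_ + _) with
   (minus (fst d * fst (g t) + fst (f t) * fst e) (snd d * snd (g t) + snd (f t) * snd e))
    by (unfold minus, plus, opp; simpl; ring).
  apply @is_derive_minus; apply @is_derive_mult; auto; intros; apply Rmult_comm.
- replace (_ + _) with
   (plus (fst d * snd (g t) + fst (f t) * snd e) (snd d * fst (g t) + snd (f t) * fst e))
    by (unfold plus; simpl; ring).
  apply @is_derive_plus; apply @is_derive_mult; auto; intros; apply Rmult_comm.
Qed.

Lemma Cder_eq f t d e : Cder f t d -> d = e -> Cder f t e.
Proof. now intros H <-. Qed.

Lemma Cder_ext f g t d : (forall s, f s = g s) -> Cder f t d -> Cder g t d.
Proof.
intros H [H1 H2]; split;
  [apply is_derive_ext with (2 := H1)|apply is_derive_ext with (2 := H2)]; intros; now rewrite H.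
Qed.

Lemma Cder_scal c f t d : Cder f t d -> Cder (fun s => c * f s)%C t (c * d)%C.
Proof.
intros H; eapply Cder_eq; [apply Cder_mult; [apply Cder_const|exact H]|cbv beta; ring].
Qed.

Lemma RtoC_m1 : RtoC (-1) = (- RtoC 1)%C.
Proof. rewrite <- RtoC_opp; f_equal; ring. Qed.

Lemma Cder_conj f t d : Cder f t d -> Cder (fun s => Cconj (f s)) t (Cconj d).
Proof. intros [H1 H2]; split; simpl; auto; now apply @is_derive_opp. Qed.

Lemma Cder_csum {A} (l : list A) (f : A -> R -> C) t d :
  (forall a, In a l -> Cder (f a) t (d a)) -> Cder (fun s => csum l (fun a => f a s)) t (csum l d).
Proof.
induction l as [|a l IH]; simpl; intros H; [apply Cder_const|].
apply Cder_plus; auto.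
Qed.

Lemma Cder_cexpi c t : Cder (fun s => cexpi (c * s)) t (Ci * RtoC c * cexpi (c * t))%C.
Proof. split; simpl; auto_derive; auto; ring. Qed.

Lemma Cmod_cexpi x : Cmod (cexpi x) = 1.
Proof.
unfold Cmod, cexpi; simpl.
replace (_ + _) with 1; [apply sqrt_1|].
generalize (sin2_cos2 x); unfold Rsqr; lra.
Qed.

Lemma cexpi_plus x y : cexpi (x + y) = (cexpi x * cexpi y)%C.
Proof.
unfold cexpi, Cmult; simpl; rewrite cos_plus, sin_plus; f_equal; ring.
Qed.

Lemma cexpi_opp x : cexpi (- x) = Cconj (cexpi x).
Proof. unfold cexpi, Cconj; simpl; now rewrite cos_neg, sin_neg. Qed.

Lemma rsum_count l (K : nat) y : NoDup l -> 0 <= y ->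
  rsum l (fun a => if (Z.abs a <=? Z.of_nat K)%Z then y else 0) <= (2 * INR K + 1) * y.
Proof.
intros Hn Hy.
apply Rle_trans with (rsum (0%Z :: box K) (fun _ => y)).
  rewrite <- (Rplus_0_r (rsum l _)).
  assert (H : forall L : list Z, rsum (filter (fun a => Z.abs a <=? Z.of_nat K)%Z L) (fun _ => y) =
     rsum L (fun a => if (Z.abs a <=? Z.of_nat K)%Z then y else 0)).
    induction L as [|a L IH]; simpl; auto.
    destruct (_ <=? _)%Z; simpl; rewrite IH; ring.
  rewrite <- H, Rplus_0_r; apply rsum_incl; auto.
    now apply NoDup_filter.
  intros k Hk; apply filter_In in Hk; destruct Hk as [_ Hk]; apply Z.leb_le in Hk.
  destruct (Z.eq_dec k 0) as [->|]; [now left|right; apply in_box; lia].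
rewrite rsum_const; cbn [length]; unfold box.
rewrite length_app, !length_map, length_seq, S_INR, plus_INR; apply Req_le; ring.
Qed.

(** On [a + b + c + d = 0] this is [-(a^3 + b^3 + c^3 + d^3)/3], the resonance function of the
    modified KdV equation. *)
Definition phi (a b c : Z) : Z := ((a + b) * (a + c) * (b + c))%Z.

(** A vanishing phase means that one of the three pairs cancels. The complementary pair then cancels
    too, and the sum is dominated by a product of two convolutions at frequency 0. *)
Lemma qsum_resonant l x1 x2 x3 x4 m1 m2 m3 m4 :
  NoDup l -> l2le l x1 m1 -> l2le l x2 m2 -> l2le l x3 m3 -> l2le l x4 m4 ->
  qsum l (fun a b c d => if (phi a b c =? 0)%Z then x1 a * x2 b * x3 c * x4 d else 0)
    <= 3 * (m1 * m2 * m3 * m4).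
Proof.
intros Hn H1 H2 H3 H4.
assert (Hab : forall x1 x2 x3 x4 m1 m2 m3 m4,
  l2le l x1 m1 -> l2le l x2 m2 -> l2le l x3 m3 -> l2le l x4 m4 ->
  qsum l (fun a b c d => if (a + b =? 0)%Z then x1 a * x2 b * x3 c * x4 d else 0)
    <= m1 * m2 * m3 * m4).
  clear -Hn; intros x1 x2 x3 x4 m1 m2 m3 m4 H1 H2 H3 H4.
  apply Rle_trans with
    (rsum l (fun a => rsum l (fun b => if (a + b =? 0)%Z then x1 a * x2 b else 0)) * (m3 * m4)).
    rewrite <- rsum_scal_r; apply rsum_le; intros a _.
    rewrite <- rsum_scal_r; apply rsum_le; intros b _.
    destruct (a + b =? 0)%Z eqn:E.
      assert (0 <= x1 a * x2 b) by (apply Rmult_le_pos; [apply H1|apply H2]).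
      apply Rle_trans with (x1 a * x2 b *
        rsum l (fun c => rsum l (fun d => if (c + d =? 0)%Z then x3 c * x4 d else 0))).
        rewrite <- rsum_scal; apply Req_le, rsum_ext; intros c _.
        rewrite <- rsum_scal; apply rsum_ext; intros d _.
        apply Z.eqb_eq in E; replace (a + b + c + d)%Z with (c + d)%Z by lia.
        destruct (_ =? _)%Z; ring.
      apply Rmult_le_compat_l; auto; now apply sum_conv.
    rewrite (rsum_ext l _ (fun _ => 0)), rsum_0; [lra|].
    intros c _; rewrite (rsum_ext l _ (fun _ => 0)), rsum_0; auto.
    intros d _; now destruct (a + b + c + d =? 0)%Z.
  replace (m1 * m2 * m3 * m4) with (m1 * m2 * (m3 * m4)) by ring.
  apply Rmult_le_compat_r; [destruct H3, H4; now apply Rmult_le_pos|now apply sum_conv].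
apply Rle_trans with
  (qsum l (fun a b c d => if (a + b =? 0)%Z then x1 a * x2 b * x3 c * x4 d else 0) +
   qsum l (fun a b c d => if (a + c =? 0)%Z then x1 a * x2 b * x3 c * x4 d else 0) +
   qsum l (fun a b c d => if (b + c =? 0)%Z then x1 a * x2 b * x3 c * x4 d else 0)).
  rewrite <- !qsum_plus; apply qsum_le; intros a b c d _ _ _ _ _.
  assert (0 <= x1 a * x2 b * x3 c * x4 d).
    destruct H1 as (_ & ? & _), H2 as (_ & ? & _), H3 as (_ & ? & _), H4 as (_ & ? & _).
    repeat apply Rmult_le_pos; auto.
  unfold phi.
  destruct (Z.eqb_spec (a + b) 0), (Z.eqb_spec (a + c) 0), (Z.eqb_spec (b + c) 0);
    destruct (Z.eqb_spec ((a + b) * (a + c) * (b + c)) 0) as [Ez|Ez]; try lra; exfalso;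
    rewrite !Z.mul_eq_0 in Ez; tauto.
assert (E1 := Hab x1 x2 x3 x4 m1 m2 m3 m4 H1 H2 H3 H4).
assert (E2 := Hab x1 x3 x2 x4 m1 m3 m2 m4 H1 H3 H2 H4).
assert (E3 := Hab x2 x3 x1 x4 m2 m3 m1 m4 H2 H3 H1 H4).
rewrite qsum_swap23 in E2; rewrite qsum_swap23, qsum_swap12 in E3.
assert (F2 : qsum l (fun a b c d => if (a + c =? 0)%Z then x1 a * x2 b * x3 c * x4 d else 0)
   <= m1 * m3 * m2 * m4).
  apply Rle_trans with (2 := E2); apply qsum_le; intros; destruct (_ =? _)%Z; lra.
assert (F3 : qsum l (fun a b c d => if (b + c =? 0)%Z then x1 a * x2 b * x3 c * x4 d else 0)
   <= m2 * m3 * m1 * m4).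
  apply Rle_trans with (2 := E3); apply qsum_le; intros; destruct (_ =? _)%Z; lra.
lra.
Qed.

Definition low (K : nat) (a b c d : Z) : bool :=
  ((Z.abs a <=? Z.of_nat K)%Z && (Z.abs b <=? Z.of_nat K)%Z && (Z.abs c <=? Z.of_nat K)%Z &&
   (Z.abs d <=? Z.of_nat K)%Z)%bool.

(** Three frequencies take at most [2K + 1] values each and the fourth is determined; all entries
    are bounded by their norms. *)
Lemma qsum_low l K x1 x2 x3 x4 m1 m2 m3 m4 :
  NoDup l -> l2le l x1 m1 -> l2le l x2 m2 -> l2le l x3 m3 -> l2le l x4 m4 ->
  qsum l (fun a b c d => if low K a b c d then x1 a * x2 b * x3 c * x4 d else 0)
    <= (2 * INR K + 1) ^ 3 * (m1 * m2 * m3 * m4).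
Proof.
intros Hn H1 H2 H3 H4.
set (M := m1 * m2 * m3 * m4).
assert (HM : 0 <= M).
  destruct H1, H2, H3, H4; unfold M; repeat apply Rmult_le_pos; auto.
set (F := fun a b c => if ((Z.abs a <=? Z.of_nat K)%Z && (Z.abs b <=? Z.of_nat K)%Z &&
   (Z.abs c <=? Z.of_nat K)%Z)%bool then M else 0).
apply Rle_trans with (qsum l (fun a b c d => F a b c)).
  apply qsum_le; intros a b c d Ha Hb Hc Hd _.
  unfold low, F.
  assert (Hx : x1 a * x2 b * x3 c * x4 d <= M).
    assert (x1 a <= m1) by (apply (l2le_term l); auto).
    assert (x2 b <= m2) by (apply (l2le_term l); auto).
    assert (x3 c <= m3) by (apply (l2le_term l); auto).
    assert (x4 d <= m4) by (apply (l2le_term l); auto).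
    destruct H1 as (_ & ? & _), H2 as (_ & ? & _), H3 as (_ & ? & _), H4 as (_ & ? & _).
    unfold M; repeat apply Rmult_le_compat; auto; repeat apply Rmult_le_pos; auto.
  do 3 (destruct (_ <=? _)%Z; simpl; [|lra]).
  destruct (_ <=? _)%Z; lra.
eapply Rle_trans; [apply qsum_free_4; auto|].
  intros a b c; unfold F; destruct (_ && _)%bool; lra.
assert (HK := pos_INR K).
unfold rsum3, F.
apply Rle_trans with (rsum l (fun a => if (Z.abs a <=? Z.of_nat K)%Z
   then (2 * INR K + 1) * ((2 * INR K + 1) * M) else 0)).
  apply rsum_le; intros a _; destruct (_ <=? _)%Z; simpl.
    apply Rle_trans with (rsum l (fun b => if (Z.abs b <=? Z.of_nat K)%Z
       then ((2 * INR K + 1) * M) else 0)).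
      apply rsum_le; intros b _; destruct (_ <=? _)%Z; simpl.
        now apply rsum_count.
      rewrite rsum_0; lra.
    apply rsum_count; auto; apply Rmult_le_pos; lra.
  rewrite (rsum_ext l _ (fun _ => 0)), rsum_0; [lra|intros b _; apply rsum_0].
eapply Rle_trans; [apply rsum_count; auto|].
  apply Rmult_le_pos; [lra|apply Rmult_le_pos; lra].
apply Req_le; ring.
Qed.

Definition Quart (l : list Z) (mu : Z -> Z -> Z -> Z -> C) (x1 x2 x3 x4 : Z -> C) : C :=
  csum l (fun a => csum l (fun b => csum l (fun c => csum l (fun d =>
    if (a + b + c + d =? 0)%Z then mu a b c d * (x1 a * x2 b * x3 c * x4 d) else RtoC 0)%C))).

Lemma Cmod_Quart l mu x1 x2 x3 x4 :
  Cmod (Quart l mu x1 x2 x3 x4) <=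
  qsum l (fun a b c d => Cmod (mu a b c d) *
            (Cmod (x1 a) * Cmod (x2 b) * Cmod (x3 c) * Cmod (x4 d))).
Proof.
unfold Quart, qsum.
do 4 (eapply Rle_trans; [apply Cmod_csum|apply rsum_le; intros]).
destruct (_ =? _)%Z; [rewrite !Cmod_mult; lra|rewrite Cmod_0; lra].
Qed.

Lemma Quart_ext l mu nu x1 x2 x3 x4 :
  (forall a b c d, In a l -> In b l -> In c l -> In d l -> (a + b + c + d = 0)%Z ->
     (mu a b c d * (x1 a * x2 b * x3 c * x4 d) = nu a b c d * (x1 a * x2 b * x3 c * x4 d))%C) ->
  Quart l mu x1 x2 x3 x4 = Quart l nu x1 x2 x3 x4.
Proof.
intros H; unfold Quart; do 4 (apply csum_ext; intros).
destruct (Z.eqb_spec (a + a0 + a1 + a2) 0); auto.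
Qed.

Lemma Quart_plus l mu nu x1 x2 x3 x4 :
  Quart l (fun a b c d => mu a b c d + nu a b c d)%C x1 x2 x3 x4 =
  (Quart l mu x1 x2 x3 x4 + Quart l nu x1 x2 x3 x4)%C.
Proof.
unfold Quart; do 4 (rewrite <- csum_plus; apply csum_ext; intros).
destruct (_ =? _)%Z; ring.
Qed.

Lemma Cder_Quart l mu x1 x2 x3 x4 x1' x2' x3' x4' t (dmu : Z -> Z -> Z -> Z -> C) :
  (forall a b c d, Cder (fun s => mu s a b c d) t (dmu a b c d)) ->
  (forall k, In k l -> Cder (fun s => x1 s k) t (x1' k)) ->
  (forall k, In k l -> Cder (fun s => x2 s k) t (x2' k)) ->
  (forall k, In k l -> Cder (fun s => x3 s k) t (x3' k)) ->
  (forall k, In k l -> Cder (fun s => x4 s k) t (x4' k)) ->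
  Cder (fun s => Quart l (mu s) (x1 s) (x2 s) (x3 s) (x4 s)) t
   (Quart l dmu (x1 t) (x2 t) (x3 t) (x4 t) +
    (Quart l (mu t) x1' (x2 t) (x3 t) (x4 t) + Quart l (mu t) (x1 t) x2' (x3 t) (x4 t) +
     Quart l (mu t) (x1 t) (x2 t) x3' (x4 t) + Quart l (mu t) (x1 t) (x2 t) (x3 t) x4'))%C.
Proof.
intros Hmu H1 H2 H3 H4.
unfold Quart.
do 4 (rewrite <- !csum_plus; apply Cder_csum; intros).
destruct (_ =? _)%Z.
  eapply Cder_eq.
    apply Cder_mult; [apply Hmu|].
    apply Cder_mult; [apply Cder_mult; [apply Cder_mult; [apply H1|apply H2]|apply H3]|apply H4]; auto.
  cbv beta; ring.
eapply Cder_eq; [apply Cder_const|ring].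
Qed.

(** The size [|k| B] of the derivative matches the equation: a factor [k] times a convolution, and
    convolutions are bounded by products of l2 norms. *)
Definition reg (l : list Z) (x : R -> Z -> C) (x' : Z -> C) (t m B : R) : Prop :=
  l2le l (fun k => Cmod (x t k)) m /\ 0 <= B /\
  forall k, In k l -> Cder (fun s => x s k) t (x' k) /\ Cmod (x' k) <= Rabs (IZR k) * B.

(** Differentiation by parts in time. [G] divides by the phase the terms that are neither resonant
    nor entirely of frequency at most [K]; its derivative reproduces them, plus four sums with one
    differentiated factor, which [wt_1] to [wt_4] control. The undivided terms satisfy [|mu| <= 2],
    whence [6 = 2 * 3] and [2 (2K+1)^3]; the others give [16 = (2/3) * 24] and
    [64/K = (1/3)(2/K) * 4 * 24]. *)
Lemma quartic_normal_form l K mu x1 x2 x3 x4 x1' x2' x3' x4' :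
  NoDup l -> (0 < K)%nat ->
  (forall a b c d, In c l -> In d l -> (a + b + c + d = 0)%Z ->
     Cmod (mu a b c d) <= inv c + inv d) ->
  exists G dG : R -> C, forall t m1 m2 m3 m4 B1 B2 B3 B4,
    reg l x1 (x1' t) t m1 B1 -> reg l x2 (x2' t) t m2 B2 ->
    reg l x3 (x3' t) t m3 B3 -> reg l x4 (x4' t) t m4 B4 ->
    Cder G t (dG t) /\
    Cmod (Quart l (fun a b c d => mu a b c d * cexpi (3 * IZR (phi a b c) * t))%C
            (x1 t) (x2 t) (x3 t) (x4 t) - dG t)%C <=
      (6 + 2 * (2 * INR K + 1) ^ 3) * (m1 * m2 * m3 * m4) +
      16 * (B1 * m2 * m3 * m4 + m1 * B2 * m3 * m4 + m1 * m2 * B3 * m4 + m1 * m2 * m3 * B4) /\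
    Cmod (G t) <= 64 / INR K * (m1 * m2 * m3 * m4).
Proof.
intros Hn HK Hmu.
set (hi := fun a b c d => (negb (phi a b c =? 0)%Z && negb (low K a b c d))%bool).
set (nu := fun a b c d => if hi a b c d then (mu a b c d * / (Ci * RtoC (3 * IZR (phi a b c))))%C
   else RtoC 0).
set (E := fun t a b c => cexpi (3 * IZR (phi a b c) * t)).
assert (Hnu : forall a b c d, In c l -> In d l -> (a + b + c + d = 0)%Z ->
   Cmod (nu a b c d) <= / 3 * (if hi a b c d then wt a b c d else 0)).
  intros a b c d Hc Hd HS; unfold nu; destruct (hi a b c d) eqn:Ehi; [|rewrite Cmod_0; lra].
  assert (Hp : phi a b c <> 0%Z).
    unfold hi in Ehi; apply andb_prop in Ehi; destruct Ehi as [Ehi _].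
    now apply Bool.negb_true_iff, Z.eqb_neq in Ehi.
  rewrite Cmod_mult, Cmod_inv.
  2:{ apply Cmod_gt_0; rewrite Cmod_mult, Cmod_Ci, Cmod_R, Rabs_mult.
      generalize (Rabs_IZR_ge1 _ Hp); rewrite (Rabs_pos_eq 3) by lra; lra. }
  rewrite Cmod_mult, Cmod_Ci, Cmod_R, Rabs_mult, (Rabs_pos_eq 3), Rmult_1_l by lra.
  unfold phi in Hp |- *; rewrite !mult_IZR, !Rabs_mult.
  assert (Hi : forall k, k <> 0%Z -> inv k = / Rabs (IZR k)).
    intros k Hk; unfold inv; destruct (Z.eqb_spec k 0); auto; tauto.
  unfold wt; rewrite (Hi (a + b)%Z), (Hi (a + c)%Z), (Hi (b + c)%Z) by (intros E0; apply Hp; rewrite E0; ring).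
  rewrite !Rinv_mult.
  replace (/ 3 * ((inv c + inv d) * _)) with
   ((inv c + inv d) * (/ 3 * (/ Rabs (IZR (a + b)) * / Rabs (IZR (a + c)) * / Rabs (IZR (b + c))))) by ring.
  apply Rmult_le_compat_r; auto.
  rewrite <- !Rinv_mult; left; apply Rinv_0_lt_compat.
  assert (forall k, k <> 0%Z -> 0 < Rabs (IZR k)).
    intros k Hk; generalize (Rabs_IZR_ge1 k Hk); lra.
  repeat apply Rmult_lt_0_compat; try lra; apply H; intros E0; apply Hp; rewrite E0; ring.
(* [D] is what the derivative of the exponential in [G] gives back; [P] below collects the
   derivatives of the four factors. *)
set (D := fun t => Quart l (fun a b c d => if hi a b c d then mu a b c d * E t a b c else RtoC 0)%C
   (x1 t) (x2 t) (x3 t) (x4 t)).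
set (N := fun t a b c d => (nu a b c d * E t a b c)%C).
set (P := fun t => (Quart l (N t) (x1' t) (x2 t) (x3 t) (x4 t) + Quart l (N t) (x1 t) (x2' t) (x3 t) (x4 t) +
     Quart l (N t) (x1 t) (x2 t) (x3' t) (x4 t) + Quart l (N t) (x1 t) (x2 t) (x3 t) (x4' t))%C).
exists (fun t => Quart l (N t) (x1 t) (x2 t) (x3 t) (x4 t)), (fun t => D t + P t)%C.
intros t m1 m2 m3 m4 B1 B2 B3 B4 (M1 & HB1 & R1) (M2 & HB2 & R2) (M3 & HB3 & R3) (M4 & HB4 & R4).
assert (HN : forall a b c d, Cmod (N t a b c d) = Cmod (nu a b c d)).
  intros; unfold N, E; now rewrite Cmod_mult, Cmod_cexpi, Rmult_1_r.
assert (HNw : forall a b c d, In c l -> In d l -> (a + b + c + d = 0)%Z ->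
   Cmod (N t a b c d) <= / 3 * wt a b c d).
  intros a b c d Hc Hd HS; rewrite HN; eapply Rle_trans; [now apply Hnu|].
  generalize (wt_pos a b c d); destruct (hi a b c d); lra.
split; [|split].
- apply Cder_Quart; try (intros k Hk; now apply R1); try (intros k Hk; now apply R2);
    try (intros k Hk; now apply R3); try (intros k Hk; now apply R4).
  intros a b c d; unfold N, E.
  eapply Cder_eq; [apply Cder_scal, Cder_cexpi|].
  unfold nu; destruct (hi a b c d) eqn:Ehi; [|ring].
  assert (Hp : phi a b c <> 0%Z).
    unfold hi in Ehi; apply andb_prop in Ehi; destruct Ehi as [Ehi _].
    now apply Bool.negb_true_iff, Z.eqb_neq in Ehi.
  field; split.
    apply Cmod_gt_0; rewrite Cmod_R, Rabs_mult, (Rabs_pos_eq 3) by lra.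
    generalize (Rabs_IZR_ge1 _ Hp); lra.
  apply Cmod_gt_0; rewrite Cmod_Ci; lra.
(* [L] holds the resonant and the low terms, which were left undivided. *)
- set (L := Quart l (fun a b c d => if hi a b c d then RtoC 0 else mu a b c d * E t a b c)%C
     (x1 t) (x2 t) (x3 t) (x4 t)).
  replace (_ - _)%C with (L + - P t)%C.
  2:{ replace (Quart l (fun a b c d => (mu a b c d * cexpi (3 * IZR (phi a b c) * t))%C)
         (x1 t) (x2 t) (x3 t) (x4 t)) with (L + D t)%C; [ring|].
      unfold L, D; rewrite <- Quart_plus; apply Quart_ext; intros; unfold E.
      destruct (hi a b c d); ring. }
  eapply Rle_trans; [apply Cmod_triangle|]; rewrite Cmod_opp; apply Rplus_le_compat.
    unfold L; eapply Rle_trans; [apply Cmod_Quart|].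
    apply Rle_trans with (2 *
     (qsum l (fun a b c d => if (phi a b c =? 0)%Z then
        Cmod (x1 t a) * Cmod (x2 t b) * Cmod (x3 t c) * Cmod (x4 t d) else 0) +
      qsum l (fun a b c d => if low K a b c d then
        Cmod (x1 t a) * Cmod (x2 t b) * Cmod (x3 t c) * Cmod (x4 t d) else 0))).
      rewrite <- qsum_plus, <- qsum_scal; apply qsum_le; intros a b c d _ _ Hc Hd HS.
      assert (HX : 0 <= Cmod (x1 t a) * Cmod (x2 t b) * Cmod (x3 t c) * Cmod (x4 t d)).
        repeat apply Rmult_le_pos; apply Cmod_ge_0.
      revert HX; generalize (Cmod (x1 t a) * Cmod (x2 t b) * Cmod (x3 t c) * Cmod (x4 t d)); intros X HX.
      unfold hi; destruct (_ =? _)%Z, (low K a b c d); simpl; rewrite ?Cmod_0; try lra;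
      (rewrite Cmod_mult; unfold E; rewrite Cmod_cexpi;
       specialize (Hmu a b c d Hc Hd HS);
       assert (Cmod (mu a b c d) <= 2) by (generalize (inv_le_1 c) (inv_le_1 d); lra); nra).
    assert (Q1 := qsum_resonant l _ _ _ _ _ _ _ _ Hn M1 M2 M3 M4).
    assert (Q2 := qsum_low l K _ _ _ _ _ _ _ _ Hn M1 M2 M3 M4).
    cbv beta in Q1, Q2.
    lra.
  unfold P.
  (* One estimate for all four positions: [j] selects the differentiated frequency, and [kr] is the
     kernel in the other three. *)
  assert (HT : forall y1 y2 y3 y4 (j : Z -> Z -> Z -> Z -> Z) X kr B m, 0 <= B ->
    (forall a b c d, 0 <= X a b c d) ->
    (forall a b c d, In a l -> In b l -> In c l -> In d l ->
       Cmod (y1 a) * Cmod (y2 b) * Cmod (y3 c) * Cmod (y4 d) <= Rabs (IZR (j a b c d)) * B * X a b c d) ->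
    (forall a b c d, (a + b + c + d = 0)%Z -> Rabs (IZR (j a b c d)) * wt a b c d <= 2 * kr a b c d) ->
    qsum l (fun a b c d => X a b c d * kr a b c d) <= 24 * m ->
    Cmod (Quart l (N t) y1 y2 y3 y4) <= 16 * (B * m)).
    intros y1 y2 y3 y4 j X kr B m HB HX Hy Hj Hq; eapply Rle_trans; [apply Cmod_Quart|].
    apply Rle_trans with (/ 3 * 2 * B * qsum l (fun a b c d => X a b c d * kr a b c d)).
      rewrite <- qsum_scal; apply qsum_le; intros a b c d Ha Hb Hc Hd HS.
      apply Rle_trans with (/ 3 * wt a b c d * (Rabs (IZR (j a b c d)) * B * X a b c d)).
        apply Rmult_le_compat; auto using Cmod_ge_0.
        repeat apply Rmult_le_pos; apply Cmod_ge_0.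
      specialize (HX a b c d); specialize (Hj a b c d HS).
      replace (/ 3 * wt a b c d * (Rabs (IZR (j a b c d)) * B * X a b c d)) with
        (/ 3 * B * X a b c d * (Rabs (IZR (j a b c d)) * wt a b c d)) by ring.
      replace (/ 3 * 2 * B * (X a b c d * kr a b c d)) with (/ 3 * B * X a b c d * (2 * kr a b c d)) by ring.
      apply Rmult_le_compat_l; auto; repeat apply Rmult_le_pos; auto; lra.
    replace (16 * (B * m)) with (/ 3 * 2 * B * (24 * m)) by field.
    apply Rmult_le_compat_l; lra.
  assert (HX : forall (f g h : Z -> C) a b c, 0 <= Cmod (f a) * Cmod (g b) * Cmod (h c)).
    intros; repeat apply Rmult_le_pos; apply Cmod_ge_0.
  assert (HB : forall u v X B p, 0 <= X -> Cmod u <= Rabs (IZR v) * B -> p = Cmod u * X ->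
     p <= Rabs (IZR v) * B * X).
    intros u v X B p HX0 Hu ->; now apply Rmult_le_compat_r.
  assert (T1 : Cmod (Quart l (N t) (x1' t) (x2 t) (x3 t) (x4 t)) <= 16 * (B1 * (m2 * m3 * m4))).
    apply (HT _ _ _ _ (fun a b c d => a) (fun a b c d => Cmod (x2 t b) * Cmod (x3 t c) * Cmod (x4 t d))
      (fun a b c d => ker b c d)); auto using wt_1.
      intros a b c d Ha _ _ _; eapply HB; [apply HX|apply R1, Ha|ring].
    exact (qsum_ker_1 l _ _ _ _ _ _ Hn M2 M3 M4).
  assert (T2 : Cmod (Quart l (N t) (x1 t) (x2' t) (x3 t) (x4 t)) <= 16 * (B2 * (m1 * m3 * m4))).
    apply (HT _ _ _ _ (fun a b c d => b) (fun a b c d => Cmod (x1 t a) * Cmod (x3 t c) * Cmod (x4 t d))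
      (fun a b c d => ker a c d)); auto using wt_2.
      intros a b c d _ Hb _ _; eapply HB; [apply HX|apply R2, Hb|ring].
    exact (qsum_ker_2 l _ _ _ _ _ _ Hn M1 M3 M4).
  assert (T3 : Cmod (Quart l (N t) (x1 t) (x2 t) (x3' t) (x4 t)) <= 16 * (B3 * (m1 * m2 * m4))).
    apply (HT _ _ _ _ (fun a b c d => c) (fun a b c d => Cmod (x1 t a) * Cmod (x2 t b) * Cmod (x4 t d))
      (fun a b c d => ker a b d)); auto using wt_3.
      intros a b c d _ _ Hc _; eapply HB; [apply HX|apply R3, Hc|ring].
    exact (qsum_ker_3 l _ _ _ _ _ _ Hn M1 M2 M4).
  assert (T4 : Cmod (Quart l (N t) (x1 t) (x2 t) (x3 t) (x4' t)) <= 16 * (B4 * (m1 * m2 * m3))).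
    apply (HT _ _ _ _ (fun a b c d => d) (fun a b c d => Cmod (x1 t a) * Cmod (x2 t b) * Cmod (x3 t c))
      (fun a b c d => ker a b c)); auto using wt_4.
      intros a b c d _ _ _ Hd; eapply HB; [apply HX|apply R4, Hd|ring].
    exact (qsum_ker_4 l _ _ _ _ _ _ Hn M1 M2 M3).
  eapply Rle_trans; [apply Cmod_triangle|].
  eapply Rle_trans; [apply Rplus_le_compat_r, Cmod_triangle|].
  eapply Rle_trans; [apply Rplus_le_compat_r, Rplus_le_compat_r, Cmod_triangle|].
  lra.
- eapply Rle_trans; [apply Cmod_Quart|].
  assert (HK' : 0 < INR K) by now apply lt_0_INR.
  assert (P1 : 0 <= m1) by apply M1. assert (P2 : 0 <= m2) by apply M2.
  assert (P3 : 0 <= m3) by apply M3. assert (P4 : 0 <= m4) by apply M4.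
  (* Each kernel supplied by [wt_high] omits one frequency; the sequence at that frequency is
     bounded pointwise by its norm. *)
  apply Rle_trans with (/ 3 * (2 / INR K) *
    (m4 * qsum l (fun a b c d => Cmod (x1 t a) * Cmod (x2 t b) * Cmod (x3 t c) * ker a b c) +
     m1 * qsum l (fun a b c d => Cmod (x2 t b) * Cmod (x3 t c) * Cmod (x4 t d) * ker b c d) +
     m2 * qsum l (fun a b c d => Cmod (x1 t a) * Cmod (x3 t c) * Cmod (x4 t d) * ker a c d) +
     m3 * qsum l (fun a b c d => Cmod (x1 t a) * Cmod (x2 t b) * Cmod (x4 t d) * ker a b d))).
    rewrite <- !qsum_scal, <- !qsum_plus, <- qsum_scal.
    apply qsum_le; intros a b c d Ha Hb Hc Hd HS; rewrite HN.
    assert (G1 := l2le_term _ _ _ _ M1 Ha). assert (G2 := l2le_term _ _ _ _ M2 Hb).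
    assert (G3 := l2le_term _ _ _ _ M3 Hc). assert (G4 := l2le_term _ _ _ _ M4 Hd).
    cbv beta in G1, G2, G3, G4.
    assert (C1 := Cmod_ge_0 (x1 t a)). assert (C2 := Cmod_ge_0 (x2 t b)).
    assert (C3 := Cmod_ge_0 (x3 t c)). assert (C4 := Cmod_ge_0 (x4 t d)).
    revert G1 G2 G3 G4 C1 C2 C3 C4.
    generalize (Cmod (x1 t a)) (Cmod (x2 t b)) (Cmod (x3 t c)) (Cmod (x4 t d)).
    intros y1 y2 y3 y4 G1 G2 G3 G4 C1 C2 C3 C4.
    generalize (ker_pos a b c) (ker_pos b c d) (ker_pos a c d) (ker_pos a b d).
    intros K1 K2 K3 K4.
    assert (HX : 0 <= y1 * y2 * y3 * y4) by (repeat apply Rmult_le_pos; auto).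
    apply Rle_trans with (/ 3 * (2 / INR K * (ker a b c + ker b c d + ker a c d + ker a b d)) * (y1 * y2 * y3 * y4)).
      apply Rmult_le_compat_r; auto.
      eapply Rle_trans; [apply (Hnu a b c d); auto|].
      apply Rmult_le_compat_l; [lra|].
      destruct (hi a b c d) eqn:Ehi.
        rewrite INR_IZR_INZ; apply wt_high; auto; [lia|].
        unfold hi, low in Ehi; apply andb_prop in Ehi; destruct Ehi as [_ Ehi].
        apply Bool.negb_true_iff in Ehi.
        destruct (Z.leb_spec (Z.abs a) (Z.of_nat K)); [|tauto].
        destruct (Z.leb_spec (Z.abs b) (Z.of_nat K)); [|tauto].
        destruct (Z.leb_spec (Z.abs c) (Z.of_nat K)); [|tauto].
        destruct (Z.leb_spec (Z.abs d) (Z.of_nat K)); [|tauto]; discriminate.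
      apply Rmult_le_pos; [|lra].
      left; apply Rdiv_lt_0_compat; lra.
    rewrite <- (Rmult_assoc (/ 3)), !(Rmult_assoc (/ 3 * (2 / INR K))).
    apply Rmult_le_compat_l.
      left; apply Rmult_lt_0_compat; [lra|apply Rdiv_lt_0_compat; lra].
    assert (F : forall u v w y m k, 0 <= u -> 0 <= v -> 0 <= w -> 0 <= k -> 0 <= y <= m ->
       u * v * w * y * k <= m * (u * v * w * k)).
      intros u v w y m k Hu Hv Hw Hk Hy.
      replace (u * v * w * y * k) with (y * (u * v * w * k)) by ring.
      apply Rmult_le_compat_r; [repeat apply Rmult_le_pos; auto|lra].
    assert (F1 := F y1 y2 y3 y4 m4 (ker a b c) C1 C2 C3 K1 (conj C4 G4)).
    assert (F2 := F y2 y3 y4 y1 m1 (ker b c d) C2 C3 C4 K2 (conj C1 G1)).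
    assert (F3 := F y1 y3 y4 y2 m2 (ker a c d) C1 C3 C4 K3 (conj C2 G2)).
    assert (F4 := F y1 y2 y4 y3 m3 (ker a b d) C1 C2 C4 K4 (conj C3 G3)).
    lra.
  assert (Q1 := Rmult_le_compat_l _ _ _ P4 (qsum_ker_4 l _ _ _ _ _ _ Hn M1 M2 M3)).
  assert (Q2 := Rmult_le_compat_l _ _ _ P1 (qsum_ker_1 l _ _ _ _ _ _ Hn M2 M3 M4)).
  assert (Q3 := Rmult_le_compat_l _ _ _ P2 (qsum_ker_2 l _ _ _ _ _ _ Hn M1 M3 M4)).
  assert (Q4 := Rmult_le_compat_l _ _ _ P3 (qsum_ker_3 l _ _ _ _ _ _ Hn M1 M2 M4)).
  cbv beta in Q1, Q2, Q3, Q4.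
  replace (64 / INR K * (m1 * m2 * m3 * m4)) with (/ 3 * (2 / INR K) * (96 * (m1 * m2 * m3 * m4)))
    by (field; lra).
  apply Rmult_le_compat_l; [|lra].
  left; apply Rmult_lt_0_compat; [lra|apply Rdiv_lt_0_compat; lra].
Qed.

(** * Trilinear sums *)

Definition conv (l : list Z) (p q : Z -> C) (k : Z) (t : R) : C :=
  csum l (fun a => csum l (fun b =>
    if (a + b =? k)%Z then cexpi (3 * IZR k * IZR a * IZR b * t) * (p a * q b) else RtoC 0)%C).

Definition tri (l : list Z) (w : Z -> Z -> Z -> C) (x y z : Z -> C) : C :=
  csum l (fun a => csum l (fun b => csum l (fun c =>
    if (a + b + c =? 0)%Z then w a b c * (x a * y b * z c) else RtoC 0)%C)).

(** With output frequency [k = -c], the phase [3kab] of the equation becomes the symmetric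
    expression [-3abc]. *)
Definition osc (w : Z -> Z -> Z -> C) (t : R) (a b c : Z) : C :=
  (w a b c * cexpi (- (3 * IZR a * IZR b * IZR c) * t))%C.

Definition tsum (l : list Z) (F : Z -> Z -> Z -> R) : R :=
  rsum3 l (fun a b c => if (a + b + c =? 0)%Z then F a b c else 0).

Lemma Cmod_osc w t a b c : Cmod (osc w t a b c) = Cmod (w a b c).
Proof. unfold osc; rewrite Cmod_mult, Cmod_cexpi; ring. Qed.

Lemma tri_ext l w w' x x' y y' z z' :
  (forall a b c, In a l -> In b l -> In c l -> (a + b + c = 0)%Z ->
     (w a b c * (x a * y b * z c) = w' a b c * (x' a * y' b * z' c))%C) ->
  tri l w x y z = tri l w' x' y' z'.
Proof.
intros H; unfold tri; do 3 (apply csum_ext; intros).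
destruct (Z.eqb_spec (a + a0 + a1) 0); auto.
Qed.

Lemma tri_swap12 l w x y z : tri l w x y z = tri l (fun a b c => w b a c) y x z.
Proof.
unfold tri; rewrite csum_exchange; do 3 (apply csum_ext; intros).
rewrite (Z.add_comm a0 a); destruct (_ =? _)%Z; ring.
Qed.

Lemma tri_swap23 l w x y z : tri l w x y z = tri l (fun a b c => w a c b) x z y.
Proof.
unfold tri; apply csum_ext; intros; rewrite csum_exchange; do 2 (apply csum_ext; intros).
replace (a + a1 + a0)%Z with (a + a0 + a1)%Z by ring; destruct (_ =? _)%Z; ring.
Qed.

Lemma tri_plus_w l w w' x y z :
  tri l (fun a b c => w a b c + w' a b c)%C x y z = (tri l w x y z + tri l w' x y z)%C.
Proof.
unfold tri; do 3 (rewrite <- csum_plus; apply csum_ext; intros); destruct (_ =? _)%Z; ring.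
Qed.

Lemma tri_plus_1 l w x x' y z :
  tri l w (fun k => x k + x' k)%C y z = (tri l w x y z + tri l w x' y z)%C.
Proof.
unfold tri; do 3 (rewrite <- csum_plus; apply csum_ext; intros); destruct (_ =? _)%Z; ring.
Qed.

Lemma tri_scal l k w x y z :
  tri l (fun a b c => k * w a b c)%C x y z = (k * tri l w x y z)%C.
Proof.
unfold tri; do 3 (rewrite <- csum_scal; apply csum_ext; intros); destruct (_ =? _)%Z; ring.
Qed.

Lemma Cmod_tri l w x y z :
  Cmod (tri l w x y z) <=
  tsum l (fun a b c => Cmod (w a b c) * (Cmod (x a) * Cmod (y b) * Cmod (z c))).
Proof.
unfold tri, tsum, rsum3.
do 3 (eapply Rle_trans; [apply Cmod_csum|apply rsum_le; intros]).
destruct (_ =? _)%Z; [rewrite !Cmod_mult; lra|rewrite Cmod_0; lra].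
Qed.

Lemma tsum_le l F G :
  (forall a b c, In a l -> In b l -> In c l -> (a + b + c = 0)%Z -> F a b c <= G a b c) ->
  tsum l F <= tsum l G.
Proof.
intros H; apply rsum3_le; intros a b c Ha Hb Hc.
destruct (Z.eqb_spec (a + b + c) 0); [auto|lra].
Qed.

Lemma tsum_plus l F G : tsum l (fun a b c => F a b c + G a b c) = tsum l F + tsum l G.
Proof.
unfold tsum, rsum3; do 3 (rewrite <- rsum_plus; apply rsum_ext; intros).
destruct (_ =? _)%Z; ring.
Qed.

Lemma tsum_scal l k F : tsum l (fun a b c => k * F a b c) = k * tsum l F.
Proof.
unfold tsum, rsum3; do 3 (rewrite <- rsum_scal; apply rsum_ext; intros).
destruct (_ =? _)%Z; ring.
Qed.

Lemma tsum_swap12 l F : tsum l F = tsum l (fun a b c => F b a c).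
Proof.
unfold tsum, rsum3; rewrite rsum_exchange; do 3 (apply rsum_ext; intros).
now rewrite (Z.add_comm a0 a).
Qed.

Lemma tsum_swap23 l F : tsum l F = tsum l (fun a b c => F a c b).
Proof.
unfold tsum, rsum3; apply rsum_ext; intros; rewrite rsum_exchange; do 2 (apply rsum_ext; intros).
now replace (a + a1 + a0)%Z with (a + a0 + a1)%Z by ring.
Qed.

(** Zero sum determines [a], so the sum over [a] costs nothing and the other two separate; the
    factor at [a] is meant to be bounded pointwise by [m]. *)
Lemma tsum_free_1 l f g m m1 m2 :
  NoDup l -> 0 <= m -> 0 <= m1 -> (forall b, In b l -> 0 <= f b) -> (forall c, In c l -> 0 <= g c) ->
  rsum l f <= m1 -> rsum l g <= m2 ->
  tsum l (fun a b c => m * (f b * g c)) <= m * (m1 * m2).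
Proof.
intros Hn Hm Hm1 Hf Hg H1 H2; rewrite tsum_scal; apply Rmult_le_compat_l; auto.
apply Rle_trans with (rsum l f * rsum l g).
  unfold tsum, rsum3; rewrite <- rsum_scal_r, rsum_exchange.
  apply rsum_le; intros b Hb; rewrite <- rsum_scal, rsum_exchange.
  apply rsum_le; intros c Hc; apply rsum_le_1; auto.
    apply Rmult_le_pos; auto.
  intros a a' E E'; apply Z.eqb_eq in E; apply Z.eqb_eq in E'; lia.
apply Rmult_le_compat; auto; now apply rsum_nonneg.
Qed.

Lemma tsum_inv_23 l x y z m1 m2 m3 :
  NoDup l -> l2le l x m1 -> l2le l y m2 -> l2le l z m3 ->
  tsum l (fun a b c => inv b * inv c * (x a * y b * z c)) <= 4 * (m1 * m2 * m3).
Proof.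
intros Hn H1 H2 H3.
apply Rle_trans with (tsum l (fun a b c => m1 * ((y b * inv b) * (z c * inv c)))).
  apply tsum_le; intros a b c Ha Hb Hc _.
  assert (Hx := l2le_term _ _ _ _ H1 Ha).
  destruct H1 as (_ & H1 & _), H2 as (_ & H2 & _), H3 as (_ & H3 & _).
  replace (inv b * inv c * (x a * y b * z c)) with (x a * ((y b * inv b) * (z c * inv c))) by ring.
  apply Rmult_le_compat_r; auto.
  repeat apply Rmult_le_pos; auto; apply inv_nonneg.
replace (4 * (m1 * m2 * m3)) with (m1 * ((2 * m2) * (2 * m3))) by ring.
assert (P1 := proj1 H1); assert (P2 := proj1 H2).
assert (S2 := sum_inv _ _ _ Hn H2); assert (S3 := sum_inv _ _ _ Hn H3).
destruct H2 as (_ & H2 & _), H3 as (_ & H3 & _).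
apply (tsum_free_1 l (fun b => y b * inv b) (fun c => z c * inv c)); auto; try lra;
  intros; apply Rmult_le_pos; auto; apply inv_nonneg.
Qed.

Lemma tsum_inv_all l x y z m1 m2 m3 :
  NoDup l -> l2le l x m1 -> l2le l y m2 -> l2le l z m3 ->
  tsum l (fun a b c => (inv a * inv b + inv b * inv c + inv a * inv c) * (x a * y b * z c))
    <= 12 * (m1 * m2 * m3).
Proof.
intros Hn H1 H2 H3.
assert (E1 := tsum_inv_23 l x y z _ _ _ Hn H1 H2 H3).
assert (E2 := tsum_inv_23 l y x z _ _ _ Hn H2 H1 H3).
assert (E3 := tsum_inv_23 l z x y _ _ _ Hn H3 H1 H2).
rewrite tsum_swap12 in E2; rewrite tsum_swap12, tsum_swap23 in E3.
assert (E := Rplus_le_compat _ _ _ _ (Rplus_le_compat _ _ _ _ E1 E2) E3).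
rewrite <- !tsum_plus in E; eapply Rle_trans; [|eapply Rle_trans; [exact E|lra]].
apply tsum_le; intros; apply Req_le; ring.
Qed.

Lemma Cder_tri l w x y z x' y' z' t :
  (forall k, In k l -> Cder (fun s => x s k) t (x' k)) ->
  (forall k, In k l -> Cder (fun s => y s k) t (y' k)) ->
  (forall k, In k l -> Cder (fun s => z s k) t (z' k)) ->
  Cder (fun s => tri l (osc w s) (x s) (y s) (z s)) t
   (tri l (osc (fun a b c => RtoC (-3) * Ci * RtoC (IZR (a * b * c)) * w a b c)%C t) (x t) (y t) (z t) +
    (tri l (osc w t) x' (y t) (z t) + tri l (osc w t) (x t) y' (z t) +
     tri l (osc w t) (x t) (y t) z'))%C.
Proof.
intros H1 H2 H3; unfold tri.
do 3 (rewrite <- !csum_plus; apply Cder_csum; intros).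
destruct (_ =? _)%Z.
  eapply Cder_eq.
    apply Cder_mult; [apply Cder_scal, Cder_cexpi|].
    apply Cder_mult; [apply Cder_mult; [apply H1|apply H2]|apply H3]; auto.
  unfold osc; cbv beta; rewrite !mult_IZR, RtoC_opp, !RtoC_mult.
  replace (RtoC (-3)) with (- RtoC 3)%C by (rewrite <- RtoC_opp; f_equal; ring); ring.
eapply Cder_eq; [apply Cder_const|ring].
Qed.

(** Renaming [k] as [-c] gives the three frequencies equal standing; the box is symmetric. *)
Lemma tri_pair n g p q y t :
  csum (box n) (fun k => g k * conv (box n) p q k t * y (- k)%Z)%C =
  tri (box n) (osc (fun a b c => g (- c)%Z) t) p q y.
Proof.
rewrite <- csum_box_opp.
unfold conv, tri.
rewrite (csum_ext _ _ (fun c => csum (box n) (fun a => csum (box n) (fun b =>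
  if (a + b + c =? 0)%Z then osc (fun a b c => g (- c)%Z) t a b c * (p a * q b * y c) else RtoC 0)%C))).
2:{ intros c _; rewrite <- csum_scal, <- csum_scal_r; apply csum_ext; intros a _.
    rewrite <- csum_scal, <- csum_scal_r; apply csum_ext; intros b _.
    rewrite Z.opp_involutive.
    destruct (Z.eqb_spec (a + b) (- c)), (Z.eqb_spec (a + b + c) 0); try lia; try ring.
    unfold osc; rewrite opp_IZR.
    replace (3 * - IZR c * IZR a * IZR b * t) with (- (3 * IZR a * IZR b * IZR c) * t) by ring.
    ring. }
rewrite csum_exchange; apply csum_ext; intros a _; apply csum_exchange.
Qed.

Lemma Cmod_conv l p q k t m m' :
  NoDup l -> l2le l (fun k => Cmod (p k)) m -> l2le l (fun k => Cmod (q k)) m' ->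
  Cmod (conv l p q k t) <= m * m'.
Proof.
intros Hn Hp Hq; unfold conv.
eapply Rle_trans; [apply Cmod_csum|].
eapply Rle_trans; [apply rsum_le; intros; apply Cmod_csum|].
eapply Rle_trans; [|exact (sum_conv l _ _ m m' k Hn Hp Hq)].
apply Req_le, rsum_ext; intros a _; apply rsum_ext; intros b _.
destruct (_ =? _)%Z; [rewrite !Cmod_mult, Cmod_cexpi; ring|apply Cmod_0].
Qed.

Definition mem (l : list Z) (k : Z) : bool := existsb (Z.eqb k) l.

Lemma memP l k : mem l k = true <-> In k l.
Proof.
unfold mem; rewrite existsb_exists; split.
  now intros (x & Hx & E); apply Z.eqb_eq in E; subst.
intros H; exists k; split; auto; apply Z.eqb_refl.
Qed.

(* The phase of the quartic term factors: with [a+b+c+d = 0],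
   [(a+b)ab - (a+b)cd = (a+b)(a+c)(b+c)]. *)
Lemma tri_hit l w g p q y z t :
  NoDup l ->
  tri l (osc w t) (fun k => g k * conv l p q k t)%C y z =
  Quart l (fun a b c d => (if mem l (a + b) then w (a + b)%Z c d * g (a + b)%Z else RtoC 0) *
     cexpi (3 * IZR (phi a b c) * t))%C p q y z.
Proof.
intros Hn; unfold tri, Quart, conv.
transitivity (csum l (fun k => csum l (fun c => csum l (fun d => csum l (fun a => csum l (fun b =>
  if (a + b =? k)%Z then if (a + b + c + d =? 0)%Z then
    w k c d * g k * cexpi (3 * IZR (phi a b c) * t) * (p a * q b * y c * z d) else RtoC 0 else RtoC 0)%C))))).
  apply csum_ext; intros k _; apply csum_ext; intros c _; apply csum_ext; intros d _.
  destruct (Z.eqb_spec (k + c + d) 0) as [E|E].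
    rewrite <- csum_scal, <- !csum_scal_r, <- csum_scal.
    apply csum_ext; intros a _.
    rewrite <- csum_scal, <- !csum_scal_r, <- csum_scal.
    apply csum_ext; intros b _.
    destruct (Z.eqb_spec (a + b) k) as [E'|E']; [|ring].
    destruct (Z.eqb_spec (a + b + c + d) 0); [|lia].
    unfold osc.
    replace (3 * IZR (phi a b c) * t) with
      (- (3 * IZR k * IZR c * IZR d) * t + 3 * IZR k * IZR a * IZR b * t).
      rewrite cexpi_plus; ring.
    rewrite <- E'; replace d with (- a - b - c)%Z by lia; unfold phi.
    rewrite !mult_IZR, !minus_IZR, !plus_IZR, opp_IZR; ring.
  rewrite (csum_ext _ _ (fun _ => RtoC 0)), csum_0; auto.
  intros a _; rewrite (csum_ext _ _ (fun _ => RtoC 0)), csum_0; auto.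
  intros b _; destruct (Z.eqb_spec (a + b) k), (Z.eqb_spec (a + b + c + d) 0); auto; lia.
rewrite csum_exchange.
rewrite (csum_ext _ _ (fun c => csum l (fun d => csum l (fun k => csum l (fun a => csum l (fun b =>
  if (a + b =? k)%Z then if (a + b + c + d =? 0)%Z then
    w k c d * g k * cexpi (3 * IZR (phi a b c) * t) * (p a * q b * y c * z d) else RtoC 0 else RtoC 0)%C)))))
 by (intros; apply csum_exchange).
(* For fixed [a] and [b] the sum over [k] has the single candidate [k = a + b], which counts only if
   the list contains it: hence the test [mem]. *)
transitivity (csum l (fun c => csum l (fun d => csum l (fun a => csum l (fun b =>
  if (a + b + c + d =? 0)%Z then
    (if mem l (a + b) then w (a + b)%Z c d * g (a + b)%Z else RtoC 0) *
      cexpi (3 * IZR (phi a b c) * t) * (p a * q b * y c * z d) else RtoC 0)%C)))).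
  apply csum_ext; intros c _; apply csum_ext; intros d _.
  rewrite csum_exchange; apply csum_ext; intros a _.
  rewrite csum_exchange; apply csum_ext; intros b _.
  destruct (mem l (a + b)) eqn:Em.
    apply memP in Em.
    rewrite (csum_single l _ (a + b)%Z Hn Em); [now rewrite Z.eqb_refl|].
    intros k _ Hk; destruct (Z.eqb_spec (a + b) k); auto; congruence.
  rewrite (csum_ext _ _ (fun _ => RtoC 0)), csum_0.
    destruct (_ =? _)%Z; ring.
  intros k Hk; destruct (Z.eqb_spec (a + b) k); auto.
  exfalso; subst k; apply memP in Hk; congruence.
rewrite (csum_ext _ _ (fun c => csum l (fun a => csum l (fun d => csum l (fun b =>
  if (a + b + c + d =? 0)%Z then
    (if mem l (a + b) then w (a + b)%Z c d * g (a + b)%Z else RtoC 0) *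
      cexpi (3 * IZR (phi a b c) * t) * (p a * q b * y c * z d) else RtoC 0)%C))))
 by (intros; apply csum_exchange).
rewrite csum_exchange; apply csum_ext; intros a _.
rewrite (csum_ext _ _ (fun c => csum l (fun b => csum l (fun d =>
  if (a + b + c + d =? 0)%Z then
    (if mem l (a + b) then w (a + b)%Z c d * g (a + b)%Z else RtoC 0) *
      cexpi (3 * IZR (phi a b c) * t) * (p a * q b * y c * z d) else RtoC 0)%C)))
 by (intros; apply csum_exchange).
apply csum_exchange.
Qed.

(** * Solutions and their truncations *)

Definition cut (n : nat) (x : Z -> C) (k : Z) : C :=
  if (Z.abs k <=? Z.of_nat n)%Z then x k else RtoC 0.
Definition tailZ (n : nat) (x : Z -> C) (k : Z) : C :=
  if (Z.abs k <=? Z.of_nat n)%Z then RtoC 0 else x k.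

Definition l2 (x : Z -> C) (m : R) : Prop :=
  forall l, NoDup l -> l2le l (fun k => Cmod (x k)) m.

Lemma cut_tail n x k : (cut n x k + tailZ n x k)%C = x k.
Proof. unfold cut, tailZ; destruct (_ <=? _)%Z; ring. Qed.

Lemma l2le_mod l x y m :
  l2le l (fun k => Cmod (y k)) m -> (forall k, Cmod (x k) <= Cmod (y k)) ->
  l2le l (fun k => Cmod (x k)) m.
Proof.
intros H Hxy; apply (l2le_mono l _ _ _ m H); [|lra].
intros k; split; [apply Cmod_ge_0|apply Hxy].
Qed.

Lemma Cmod_cut n x k : Cmod (cut n x k) <= Cmod (x k).
Proof. unfold cut; destruct (_ <=? _)%Z; [lra|rewrite Cmod_0; apply Cmod_ge_0]. Qed.

Lemma Cmod_tail n x k : Cmod (tailZ n x k) <= Cmod (x k).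
Proof. unfold tailZ; destruct (_ <=? _)%Z; [rewrite Cmod_0; apply Cmod_ge_0|lra]. Qed.

Lemma Cmod_tail_mono n m x k : (n <= m)%nat -> Cmod (tailZ m x k) <= Cmod (tailZ n x k).
Proof.
intros H; unfold tailZ.
destruct (Z.leb_spec (Z.abs k) (Z.of_nat m)), (Z.leb_spec (Z.abs k) (Z.of_nat n)); rewrite ?Cmod_0;
  try apply Cmod_ge_0; try lra; lia.
Qed.

Lemma l2_cut n x m : l2 x m -> l2 (cut n x) m.
Proof. intros H l Hl; apply (l2le_mod l _ x); auto using Cmod_cut. Qed.

Lemma l2_tail_mono n n' x m : (n <= n')%nat -> l2 (tailZ n x) m -> l2 (tailZ n' x) m.
Proof. intros Hn H l Hl; apply (l2le_mod l _ (tailZ n x)); auto using Cmod_tail_mono. Qed.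

Lemma reg_cut n l x x' t m B : reg l x x' t m B -> reg l (fun s => cut n (x s)) (cut n x') t m B.
Proof.
intros (H1 & H2 & H3); split; [|split; auto].
  apply (l2le_mod l _ (x t)); auto using Cmod_cut.
intros k Hk; destruct (H3 k Hk); unfold cut; destruct (_ <=? _)%Z; auto.
split; [apply Cder_const|rewrite Cmod_0; apply Rmult_le_pos; auto; apply Rabs_pos].
Qed.

Lemma reg_tail n l x x' t m B :
  l2le l (fun k => Cmod (tailZ n (x t) k)) m -> 0 <= B ->
  (forall k, In k l -> Cder (fun s => x s k) t (x' k)) ->
  (forall k, In k l -> (Z.of_nat n < Z.abs k)%Z -> Cmod (x' k) <= Rabs (IZR k) * B) ->
  reg l (fun s => tailZ n (x s)) (tailZ n x') t m B.
Proof.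
intros H1 H2 H3 H4; split; [|split]; auto.
intros k Hk; unfold tailZ; destruct (Z.leb_spec (Z.abs k) (Z.of_nat n)).
  split; [apply Cder_const|rewrite Cmod_0; apply Rmult_le_pos; auto; apply Rabs_pos].
split; auto.
Qed.

Lemma conv_plus_l l p p' q k t :
  conv l (fun k => p k + p' k)%C q k t = (conv l p q k t + conv l p' q k t)%C.
Proof.
unfold conv; do 2 (rewrite <- csum_plus; apply csum_ext; intros); destruct (_ =? _)%Z; ring.
Qed.

Lemma conv_ext l p p' q q' k t :
  (forall a, In a l -> p a = p' a) -> (forall a, In a l -> q a = q' a) ->
  conv l p q k t = conv l p' q' k t.
Proof.
intros H H'; unfold conv; do 2 (apply csum_ext; intros).
destruct (_ =? _)%Z; auto; now rewrite H, H'.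
Qed.

Lemma conv_sym l p q k t : conv l p q k t = conv l q p k t.
Proof.
unfold conv; rewrite csum_exchange; do 2 (apply csum_ext; intros).
rewrite (Z.add_comm a0 a); destruct (_ =? _)%Z; auto.
replace (3 * IZR k * IZR a0 * IZR a * t) with (3 * IZR k * IZR a * IZR a0 * t) by ring; ring.
Qed.

Lemma csum_sub l l' (f : Z -> C) :
  NoDup l -> NoDup l' -> incl l l' -> (forall k, In k l' -> ~ In k l -> f k = RtoC 0) ->
  csum l' f = csum l f.
Proof.
intros Hl Hl' Hi Hf.
assert (HP : Permutation l' (l ++ filter (fun k => negb (mem l k)) l')).
  apply NoDup_Permutation; auto.
    apply NoDup_app; auto using NoDup_filter.
    intros k Hk Hk'; apply filter_In in Hk'; destruct Hk' as [_ Hk'].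
    apply memP in Hk; rewrite Hk in Hk'; discriminate.
  intros k; rewrite in_app_iff, filter_In; split.
    intros Hk; destruct (mem l k) eqn:E; [left; now apply memP|right; auto].
  intros [Hk|[Hk _]]; auto.
rewrite (csum_Permutation _ _ _ HP), csum_app, (csum_ext (filter _ _) _ (fun _ => RtoC 0)), csum_0.
  ring.
intros k Hk; apply filter_In in Hk; destruct Hk as [Hk Hm]; apply Hf; auto.
intros Hk'; apply memP in Hk'; rewrite Hk' in Hm; discriminate.
Qed.

Lemma incl_box n m : (n <= m)%nat -> incl (box n) (box m).
Proof. intros H k Hk; apply in_box in Hk; apply in_box; lia. Qed.

Lemma cut_out n x k : ~ In k (box n) -> k <> 0%Z -> cut n x k = RtoC 0.
Proof.
rewrite in_box; intros H H'; unfold cut; destruct (Z.leb_spec (Z.abs k) (Z.of_nat n)); auto.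
exfalso; lia.
Qed.

Lemma in_box_0 n k : In k (box n) -> k <> 0%Z.
Proof. rewrite in_box; lia. Qed.

Lemma conv_box_cut m n p q k t : (n <= m)%nat ->
  conv (box m) (cut n p) (cut n q) k t = conv (box n) p q k t.
Proof.
intros H; unfold conv.
assert (E : forall a, csum (box m) (fun b => if (a + b =? k)%Z then
   cexpi (3 * IZR k * IZR a * IZR b * t) * (cut n p a * cut n q b) else RtoC 0)%C =
   csum (box n) (fun b => if (a + b =? k)%Z then
   cexpi (3 * IZR k * IZR a * IZR b * t) * (cut n p a * q b) else RtoC 0)%C).
  intros a; rewrite (csum_sub (box n) (box m)); auto using NoDup_box, incl_box.
    apply csum_ext; intros b Hb; apply in_box in Hb; unfold cut at 2.
    destruct (Z.leb_spec (Z.abs b) (Z.of_nat n)); [auto|lia].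
  intros b Hb Hb'; rewrite (cut_out n q b) by eauto using in_box_0.
  destruct (_ =? _)%Z; ring.
rewrite (csum_ext _ _ _ (fun a _ => E a)).
rewrite (csum_sub (box n) (box m)); auto using NoDup_box, incl_box.
  apply csum_ext; intros a Ha; apply csum_ext; intros b _; apply in_box in Ha.
  unfold cut; destruct (Z.leb_spec (Z.abs a) (Z.of_nat n)); [auto|lia].
intros a Ha Ha'; rewrite (csum_ext _ _ (fun _ => RtoC 0)), csum_0; auto.
intros b _; rewrite (cut_out n p a) by eauto using in_box_0.
destruct (_ =? _)%Z; ring.
Qed.

(** On a larger box the two convolutions differ by terms with a factor beyond [m], in the first or
    in the second slot; each costs [r * eps]. The larger box then tends to infinity. *)
Lemma conv_limit_approx (x : Z -> C) (N : C) r k t m eps : l2 x r -> l2 (tailZ m x) eps ->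
  (forall rho, 0 < rho -> exists m0, forall m, (m0 <= m)%nat ->
     Cmod (conv (box m) x x k t - N)%C <= rho) ->
  Cmod (N - conv (box m) x x k t)%C <= 2 * r * eps.
Proof.
intros Hr Hm Hlim; apply le_epsilon; intros e He.
destruct (Hlim e He) as [m0 Hm0].
specialize (Hm0 (m0 + m)%nat (Nat.le_add_r _ _)).
set (M := (m0 + m)%nat) in *.
assert (E : conv (box M) x x k t = (conv (box m) x x k t +
  (conv (box M) (tailZ m x) x k t + conv (box M) (cut m x) (tailZ m x) k t))%C).
  rewrite <- (conv_box_cut M m) by (unfold M; lia).
  unfold conv; do 2 (rewrite <- !csum_plus; apply csum_ext; intros).
  destruct (Z.eqb_spec (a + a0) k); [|ring].
  unfold tailZ, cut; destruct (Z.leb_spec (Z.abs a) (Z.of_nat m)), (Z.leb_spec (Z.abs a0) (Z.of_nat m)); ring.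
replace (N - conv (box m) x x k t)%C with
  (- (conv (box M) x x k t - N) +
   (conv (box M) (tailZ m x) x k t + conv (box M) (cut m x) (tailZ m x) k t))%C
  by (rewrite E; ring).
eapply Rle_trans; [apply Cmod_triangle|]; rewrite Cmod_opp.
eapply Rle_trans; [apply Rplus_le_compat_l, Cmod_triangle|].
assert (Cmod (conv (box M) (tailZ m x) x k t) <= eps * r).
  apply Cmod_conv; [apply NoDup_box|apply Hm; apply NoDup_box|apply Hr; apply NoDup_box].
assert (Cmod (conv (box M) (cut m x) (tailZ m x) k t) <= r * eps).
  apply Cmod_conv; [apply NoDup_box|apply l2_cut; [apply Hr|apply NoDup_box]|apply Hm; apply NoDup_box].
lra.
Qed.

(** What the estimates use of a solution. [sol_tail] is uniform in time and expresses compactness of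
    the trajectory in l2; functions of time live on the whole line, but the equation holds only
    inside [(0,T)]. *)
Record sol (T : R) (V NL : R -> Z -> C) : Prop := {
  sol_zero : forall t, V t 0%Z = RtoC 0;
  sol_conj : forall t k, V t (- k)%Z = Cconj (V t k);
  sol_cont : forall k t, continuous (fun s => fst (V s k)) t /\ continuous (fun s => snd (V s k)) t;
  sol_tail : forall eps, 0 < eps -> exists n, forall t, l2 (tailZ n (V t)) eps;
  sol_der : forall t k, 0 < t < T -> Cder (fun s => V s k) t (Ci * RtoC (IZR k / 2) * NL t k)%C;
  sol_lim : forall t k rho, 0 < t < T -> 0 < rho -> exists m0, forall m, (m0 <= m)%nat ->
    Cmod (conv (box m) (V t) (V t) k t - NL t k)%C <= rho }.

Section Sol.
Variables (T : R) (V NL : R -> Z -> C) (r : R).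
Hypotheses (HV : sol T V NL) (Hr : forall t, l2 (V t) r).

Lemma r_nonneg : 0 <= r.
Proof. exact (proj1 (Hr 0 nil (NoDup_nil _))). Qed.

Lemma NL_bound_lim t k c : 0 < t < T ->
  (forall m, Cmod (conv (box m) (V t) (V t) k t) <= c) -> Cmod (NL t k) <= c.
Proof.
intros Ht Hc; apply le_epsilon; intros eps Heps.
destruct (sol_lim _ _ _ HV t k eps Ht Heps) as [m Hm]; specialize (Hm m (le_n _)).
replace (NL t k) with (conv (box m) (V t) (V t) k t + - (conv (box m) (V t) (V t) k t - NL t k))%C by ring.
eapply Rle_trans; [apply Cmod_triangle|]; rewrite Cmod_opp; specialize (Hc m); lra.
Qed.

Lemma NL_bound t k : 0 < t < T -> Cmod (NL t k) <= r ^ 2.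
Proof.
intros Ht; apply NL_bound_lim; auto; intros m.
replace (r ^ 2) with (r * r) by ring; apply Cmod_conv; try apply Hr; apply NoDup_box.
Qed.

Lemma NL_bound_tail t k n eps : 0 < t < T -> l2 (tailZ n (V t)) eps ->
  (2 * Z.of_nat n < Z.abs k)%Z -> Cmod (NL t k) <= 2 * r * eps.
Proof.
intros Ht Hn Hk; apply NL_bound_lim; auto; intros m.
assert (E : conv (box m) (V t) (V t) k t =
  (conv (box m) (tailZ n (V t)) (V t) k t + conv (box m) (cut n (V t)) (tailZ n (V t)) k t)%C).
  unfold conv; do 2 (rewrite <- csum_plus; apply csum_ext; intros).
  destruct (Z.eqb_spec (a + a0) k); [|ring].
  unfold tailZ, cut; destruct (Z.leb_spec (Z.abs a) (Z.of_nat n)), (Z.leb_spec (Z.abs a0) (Z.of_nat n));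
    try ring; exfalso; lia.
rewrite E; eapply Rle_trans; [apply Cmod_triangle|].
replace (2 * r * eps) with (eps * r + r * eps) by ring.
apply Rplus_le_compat; apply Cmod_conv; auto using NoDup_box, l2_cut.
all: try apply Hr; try apply Hn; try apply l2_cut; try apply Hr; apply NoDup_box.
Qed.

Lemma NL_approx t k m eps : 0 < t < T -> l2 (tailZ m (V t)) eps ->
  Cmod (NL t k - conv (box m) (V t) (V t) k t)%C <= 2 * r * eps.
Proof. intros Ht Hm; apply conv_limit_approx; auto; intros; now apply (sol_lim _ _ _ HV). Qed.

Definition dV t k := (Ci * RtoC (IZR k / 2) * NL t k)%C.

Lemma Cmod_dV t k : Cmod (dV t k) = Rabs (IZR k) * (Cmod (NL t k) / 2).
Proof.
unfold dV; rewrite !Cmod_mult, Cmod_Ci, Cmod_R; unfold Rdiv.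
rewrite Rabs_mult, (Rabs_pos_eq (/ 2)) by lra; ring.
Qed.

Lemma reg_sol l t : NoDup l -> 0 < t < T -> reg l V (dV t) t r (r ^ 2 / 2).
Proof.
intros Hn Ht; split; [now apply Hr|split; [generalize r_nonneg; nra|]].
intros k Hk; split; [now apply (sol_der _ _ _ HV)|].
rewrite Cmod_dV; apply Rmult_le_compat_l; [apply Rabs_pos|].
generalize (NL_bound t k Ht); lra.
Qed.

(** The cutoff doubles because an output frequency above [2n] needs an input above [n]; only then is
    the derivative small as well. *)
Lemma reg_sol_tail l t n n' eps : NoDup l -> 0 < t < T -> l2 (tailZ n (V t)) eps -> (2 * n <= n')%nat ->
  reg l (fun s => tailZ n' (V s)) (tailZ n' (dV t)) t eps (r * eps).
Proof.
intros Hl Ht Hn Hn'.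
assert (Heps : 0 <= eps) by exact (proj1 (Hn nil (NoDup_nil _))).
apply reg_tail.
- apply (l2_tail_mono n n'); auto; lia.
- generalize r_nonneg; nra.
- intros k _; now apply (sol_der _ _ _ HV).
- intros k _ Hk; rewrite Cmod_dV; apply Rmult_le_compat_l; [apply Rabs_pos|].
  assert (Cmod (NL t k) <= 2 * r * eps) by (apply (NL_bound_tail t k n); auto; lia); lra.
Qed.
End Sol.

Lemma Lipschitz_interval T (F dF : R -> C) c s t :
  (forall u, 0 < u < T -> Cder F u (dF u) /\ Cmod (dF u) <= c) ->
  0 < s < T -> 0 < t < T -> Rabs (fst (F t) - fst (F s)) <= c * Rabs (t - s).
Proof.
intros HF Hs Ht.
destruct (MVT_gen (fun u => fst (F u)) s t (fun u => fst (dF u))) as (u & Hu & E).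
- intros u Hu; apply HF.
  revert Hu; unfold Rmin, Rmax; destruct (Rle_dec s t); lra.
- intros u Hu.
  assert (Hu' : 0 < u < T) by (revert Hu; unfold Rmin, Rmax; destruct (Rle_dec s t); lra).
  apply derivable_continuous_pt; exists (fst (dF u)); apply is_derive_Reals, HF, Hu'.
- rewrite E, Rabs_mult; apply Rmult_le_compat_r; [apply Rabs_pos|].
  assert (Hu' : 0 < u < T) by (revert Hu; unfold Rmin, Rmax; destruct (Rle_dec s t); lra).
  eapply Rle_trans; [apply re_le_Cmod|apply HF, Hu'].
Qed.

(** Telescoping over the four slots; the term with four cut factors is the one that the hypothesis
    removes. *)
Lemma Quart_split l mu x1 x2 x3 x4 n :
  (forall a b c d, In a l -> In b l -> In c l -> In d l -> (a + b + c + d = 0)%Z ->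
     (Z.abs a <= Z.of_nat n)%Z -> (Z.abs b <= Z.of_nat n)%Z -> (Z.abs c <= Z.of_nat n)%Z ->
     (Z.abs d <= Z.of_nat n)%Z -> mu a b c d = RtoC 0) ->
  Quart l mu x1 x2 x3 x4 =
  (Quart l mu (tailZ n x1) x2 x3 x4 + Quart l mu (cut n x1) (tailZ n x2) x3 x4 +
   Quart l mu (cut n x1) (cut n x2) (tailZ n x3) x4 +
   Quart l mu (cut n x1) (cut n x2) (cut n x3) (tailZ n x4))%C.
Proof.
intros H; unfold Quart.
rewrite <- !csum_plus; apply csum_ext; intros a Ha.
rewrite <- !csum_plus; apply csum_ext; intros b Hb.
rewrite <- !csum_plus; apply csum_ext; intros c Hc.
rewrite <- !csum_plus; apply csum_ext; intros d Hd.
destruct (Z.eqb_spec (a + b + c + d) 0); [|ring].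
unfold tailZ, cut.
destruct (Z.leb_spec (Z.abs a) (Z.of_nat n)); [|ring].
destruct (Z.leb_spec (Z.abs b) (Z.of_nat n)); [|ring].
destruct (Z.leb_spec (Z.abs c) (Z.of_nat n)); [|ring].
destruct (Z.leb_spec (Z.abs d) (Z.of_nat n)); [|ring].
rewrite H; auto; ring.
Qed.

Definition chi (n : nat) (k : Z) : R := if (Z.abs k <=? Z.of_nat n)%Z then 1 else 0.

Lemma cut_chi n x k : cut n x k = (RtoC (chi n k) * x k)%C.
Proof. unfold cut, chi; destruct (_ <=? _)%Z; ring. Qed.

Lemma chi_opp n k : chi n (- k) = chi n k.
Proof. unfold chi; now rewrite Z.abs_opp. Qed.

Lemma chi_bounds n k : 0 <= chi n k <= 1.
Proof. unfold chi; destruct (_ <=? _)%Z; lra. Qed.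

Lemma reg_tail_cut n m l x x' t M B :
  reg l (fun s => tailZ n (x s)) (tailZ n x') t M B ->
  reg l (fun s => tailZ n (cut m (x s))) (tailZ n (cut m x')) t M B.
Proof.
intros (H1 & H2 & H3); split; [|split; auto].
  apply (l2le_mod l _ (tailZ n (x t))); auto.
  intros k; unfold tailZ; destruct (_ <=? _)%Z; [lra|apply Cmod_cut].
intros k Hk; destruct (H3 k Hk) as [H4 H5]; revert H4 H5; unfold tailZ, cut.
destruct (_ <=? _)%Z; auto; destruct (_ <=? _)%Z; auto; intros _ _.
split; [apply Cder_const|rewrite Cmod_0; apply Rmult_le_pos; auto; apply Rabs_pos].
Qed.

Lemma Cmod_plus4 a b c d : Cmod (a + b + c + d)%C <= Cmod a + Cmod b + Cmod c + Cmod d.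
Proof.
eapply Rle_trans; [apply Cmod_triangle|apply Rplus_le_compat_r].
eapply Rle_trans; [apply Cmod_triangle|apply Rplus_le_compat_r, Cmod_triangle].
Qed.

(** [Quart_split] puts a tail of norm [eps] into each of four pieces, and the normal form with
    [K = 1] is applied to each. Hence [240 = 4 (6 + 2 * 3^3)] and [256 = 4 * 64]. In each piece a
    differentiated tail costs [r * eps] and the three other derivatives [r^2/2] each, so
    [160 = 4 * 16 * 5/2]. *)
Lemma quartic_small l mu T V NL r m n eps :
  NoDup l -> sol T V NL -> (forall t, l2 (V t) r) ->
  (forall t, l2 (tailZ n (V t)) eps) ->
  (forall a b c d, In c l -> In d l -> (a + b + c + d = 0)%Z -> Cmod (mu a b c d) <= inv c + inv d) ->
  (forall a b c d, In a l -> In b l -> In c l -> In d l -> (a + b + c + d = 0)%Z ->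
     (Z.abs a <= Z.of_nat (2 * n))%Z -> (Z.abs b <= Z.of_nat (2 * n))%Z ->
     (Z.abs c <= Z.of_nat (2 * n))%Z -> (Z.abs d <= Z.of_nat (2 * n))%Z -> mu a b c d = RtoC 0) ->
  exists G dG : R -> C, forall t, 0 < t < T ->
    Cder G t (dG t) /\
    Cmod (Quart l (fun a b c d => mu a b c d * cexpi (3 * IZR (phi a b c) * t))%C
            (V t) (V t) (cut m (V t)) (cut m (V t)) - dG t)%C <= (240 * r ^ 3 + 160 * r ^ 4) * eps /\
    Cmod (G t) <= 256 * r ^ 3 * eps.
Proof.
intros Hn HV Hr He Hmu Hsupp.
set (N := (2 * n)%nat) in *.
pose (X := V). pose (X' := dV NL).
pose (Xt := fun s => tailZ N (V s)). pose (Xt' := fun s => tailZ N (dV NL s)).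
pose (Xl := fun s => cut N (V s)). pose (Xl' := fun s => cut N (dV NL s)).
pose (Y := fun s => cut m (V s)). pose (Y' := fun s => cut m (dV NL s)).
pose (Yt := fun s => tailZ N (cut m (V s))). pose (Yt' := fun s => tailZ N (cut m (dV NL s))).
pose (Yl := fun s => cut N (cut m (V s))). pose (Yl' := fun s => cut N (cut m (dV NL s))).
assert (H1 : (0 < 1)%nat) by lia.
destruct (quartic_normal_form l 1 mu Xt X Y Y Xt' X' Y' Y' Hn H1 Hmu) as (G1 & dG1 & HG1).
destruct (quartic_normal_form l 1 mu Xl Xt Y Y Xl' Xt' Y' Y' Hn H1 Hmu) as (G2 & dG2 & HG2).
destruct (quartic_normal_form l 1 mu Xl Xl Yt Y Xl' Xl' Yt' Y' Hn H1 Hmu) as (G3 & dG3 & HG3).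
destruct (quartic_normal_form l 1 mu Xl Xl Yl Yt Xl' Xl' Yl' Yt' Hn H1 Hmu) as (G4 & dG4 & HG4).
exists (fun t => G1 t + G2 t + G3 t + G4 t)%C, (fun t => dG1 t + dG2 t + dG3 t + dG4 t)%C.
intros t Ht.
assert (RX : reg l X (X' t) t r (r ^ 2 / 2)) by now apply (reg_sol T V NL r HV Hr).
assert (RY : reg l Y (Y' t) t r (r ^ 2 / 2)) by now apply reg_cut.
assert (RXl : reg l Xl (Xl' t) t r (r ^ 2 / 2)) by now apply reg_cut.
assert (RYl : reg l Yl (Yl' t) t r (r ^ 2 / 2)) by now apply (reg_cut N l Y).
assert (RXt : reg l Xt (Xt' t) t eps (r * eps)).
  now apply (reg_sol_tail T V NL r HV Hr l t n N).
assert (RYt : reg l Yt (Yt' t) t eps (r * eps)) by now apply reg_tail_cut.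
destruct (HG1 t _ _ _ _ _ _ _ _ RXt RX RY RY) as (D1 & E1 & F1).
destruct (HG2 t _ _ _ _ _ _ _ _ RXl RXt RY RY) as (D2 & E2 & F2).
destruct (HG3 t _ _ _ _ _ _ _ _ RXl RXl RYt RY) as (D3 & E3 & F3).
destruct (HG4 t _ _ _ _ _ _ _ _ RXl RXl RYl RYt) as (D4 & E4 & F4).
split; [|split].
- repeat apply Cder_plus; auto.
- rewrite (Quart_split l _ _ _ _ _ N).
  2:{ intros a b c d Ha Hb Hc Hd HS Ka Kb Kc Kd; rewrite Hsupp; auto; ring. }
  replace (_ - _)%C with
    ((Quart l (fun a b c d => mu a b c d * cexpi (3 * IZR (phi a b c) * t))%C (Xt t) (X t) (Y t) (Y t) - dG1 t) +
     (Quart l (fun a b c d => mu a b c d * cexpi (3 * IZR (phi a b c) * t))%C (Xl t) (Xt t) (Y t) (Y t) - dG2 t) +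
     (Quart l (fun a b c d => mu a b c d * cexpi (3 * IZR (phi a b c) * t))%C (Xl t) (Xl t) (Yt t) (Y t) - dG3 t) +
     (Quart l (fun a b c d => mu a b c d * cexpi (3 * IZR (phi a b c) * t))%C (Xl t) (Xl t) (Yl t) (Yt t) - dG4 t))%C
    by (unfold X, Xt, Xl, Y, Yt, Yl; ring).
  eapply Rle_trans; [apply Cmod_plus4|]; simpl INR in *; lra.
- eapply Rle_trans; [apply Cmod_plus4|]; simpl INR in *; lra.
Qed.

(* Chosen so that [-3 i a b c * w_mass] is the symmetrized multiplier in the derivative of [mass n]. *)
Definition w_mass (n : nat) (a b c : Z) : C :=
  RtoC (/ 9 * (IZR a * chi n a + IZR b * chi n b + IZR c * chi n c) * / IZR (a * b * c)).

Lemma Rinv_abs_inv k : k <> 0%Z -> Rabs (/ IZR k) = inv k.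
Proof.
intros H; unfold inv; destruct (Z.eqb_spec k 0); [tauto|].
apply Rabs_inv.
Qed.

Lemma Cmod_w_mass n a b c : a <> 0%Z -> b <> 0%Z -> c <> 0%Z ->
  Cmod (w_mass n a b c) = / 9 * Rabs (IZR a * chi n a + IZR b * chi n b + IZR c * chi n c) *
    (inv a * inv b * inv c).
Proof.
intros Ha Hb Hc; unfold w_mass; rewrite Cmod_R, !Rabs_mult, !mult_IZR, !Rinv_mult, !Rabs_mult.
rewrite (Rabs_pos_eq (/ 9)) by lra; rewrite !Rinv_abs_inv by auto; ring.
Qed.

Lemma Rabs_chi n k : Rabs (IZR k * chi n k) <= Rabs (IZR k).
Proof.
rewrite Rabs_mult, (Rabs_pos_eq (chi n k)) by apply chi_bounds.
generalize (Rabs_pos (IZR k)) (chi_bounds n k); nra.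
Qed.

Lemma Rabs_sum_chi n a b c :
  Rabs (IZR a * chi n a + IZR b * chi n b + IZR c * chi n c) <=
  Rabs (IZR a) + Rabs (IZR b) + Rabs (IZR c).
Proof.
eapply Rle_trans; [apply Rabs_triang|]; apply Rplus_le_compat; [|apply Rabs_chi].
eapply Rle_trans; [apply Rabs_triang|]; apply Rplus_le_compat; apply Rabs_chi.
Qed.

Lemma w_mass_bound n a b c : a <> 0%Z -> b <> 0%Z -> c <> 0%Z ->
  Cmod (w_mass n a b c) <= / 9 * (inv a * inv b + inv b * inv c + inv a * inv c).
Proof.
intros Ha Hb Hc; rewrite Cmod_w_mass; auto.
assert (H := Rabs_sum_chi n a b c).
generalize (Rabs_inv_l a Ha) (Rabs_inv_l b Hb) (Rabs_inv_l c Hc); intros Ea Eb Ec.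
generalize (inv_nonneg a) (inv_nonneg b) (inv_nonneg c); intros Ia Ib Ic.
apply Rle_trans with (/ 9 * (Rabs (IZR a) + Rabs (IZR b) + Rabs (IZR c)) * (inv a * inv b * inv c)).
  apply Rmult_le_compat_r; [repeat apply Rmult_le_pos; auto|lra].
apply Req_le.
replace (/ 9 * (Rabs (IZR a) + Rabs (IZR b) + Rabs (IZR c)) * (inv a * inv b * inv c)) with
  (/ 9 * ((Rabs (IZR a) * inv a) * (inv b * inv c) + (Rabs (IZR b) * inv b) * (inv a * inv c) +
     (Rabs (IZR c) * inv c) * (inv a * inv b))) by ring.
rewrite Ea, Eb, Ec; ring.
Qed.

(** Within the cutoff all [chi] equal 1 and the numerator is [a + b + c]: interactions among low
    modes do not change the mass. *)
Lemma w_mass_supp n a b c : (a + b + c = 0)%Z ->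
  (Z.abs a <= Z.of_nat n)%Z -> (Z.abs b <= Z.of_nat n)%Z -> (Z.abs c <= Z.of_nat n)%Z ->
  w_mass n a b c = RtoC 0.
Proof.
intros HS Ha Hb Hc; unfold w_mass, chi.
destruct (Z.leb_spec (Z.abs a) (Z.of_nat n)); [|lia].
destruct (Z.leb_spec (Z.abs b) (Z.of_nat n)); [|lia].
destruct (Z.leb_spec (Z.abs c) (Z.of_nat n)); [|lia].
rewrite !Rmult_1_r, <- !plus_IZR, HS; f_equal; ring.
Qed.

(* [|a| <= |b| + |c|], so after multiplication by [a] one of the two remaining inverses survives. *)
Lemma w_mass_hit n a b c : a <> 0%Z -> b <> 0%Z -> c <> 0%Z -> (a + b + c = 0)%Z ->
  Cmod (w_mass n a b c) * (Rabs (IZR a) / 2) <= / 9 * (inv b + inv c).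
Proof.
intros Ha Hb Hc HS; rewrite Cmod_w_mass; auto.
assert (H := Rabs_sum_chi n a b c).
assert (H' : Rabs (IZR a) <= Rabs (IZR b) + Rabs (IZR c)).
  replace (IZR a) with (- (IZR b + IZR c)) by (rewrite <- plus_IZR, <- opp_IZR; f_equal; lia).
  rewrite Rabs_Ropp; apply Rabs_triang.
generalize (Rabs_inv_l a Ha) (Rabs_inv_l b Hb) (Rabs_inv_l c Hc); intros Ea Eb Ec.
generalize (inv_nonneg a) (inv_nonneg b) (inv_nonneg c); intros Ia Ib Ic.
set (S := Rabs (_ + _ + _)) in *.
replace (/ 9 * S * (inv a * inv b * inv c) * (Rabs (IZR a) / 2)) with
  (/ 18 * S * (inv b * inv c) * (Rabs (IZR a) * inv a)) by field.
rewrite Ea, Rmult_1_r.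
apply Rle_trans with (/ 18 * (2 * (Rabs (IZR b) + Rabs (IZR c))) * (inv b * inv c)).
  apply Rmult_le_compat_r; [apply Rmult_le_pos; auto|lra].
replace (/ 18 * (2 * (Rabs (IZR b) + Rabs (IZR c))) * (inv b * inv c)) with
  (/ 9 * ((Rabs (IZR b) * inv b) * inv c + (Rabs (IZR c) * inv c) * inv b)) by field.
rewrite Eb, Ec; lra.
Qed.

Lemma w_mass_sym12 n a b c : w_mass n b a c = w_mass n a b c.
Proof. unfold w_mass; rewrite (Z.mul_comm b a); do 2 f_equal; ring. Qed.

Lemma w_mass_sym23 n a b c : w_mass n a c b = w_mass n a b c.
Proof.
unfold w_mass; replace (a * c * b)%Z with (a * b * c)%Z by ring; do 2 f_equal; ring.
Qed.

Lemma osc_sym12 w t a b c : (forall a b c, w b a c = w a b c) -> osc w t b a c = osc w t a b c.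
Proof. intros H; unfold osc; rewrite H; do 3 f_equal; ring. Qed.

Lemma osc_sym23 w t a b c : (forall a b c, w a c b = w a b c) -> osc w t a c b = osc w t a b c.
Proof. intros H; unfold osc; rewrite H; do 3 f_equal; ring. Qed.

Lemma tri_split l w x y z n :
  (forall a b c, In a l -> In b l -> In c l -> (a + b + c = 0)%Z ->
     (Z.abs a <= Z.of_nat n)%Z -> (Z.abs b <= Z.of_nat n)%Z -> (Z.abs c <= Z.of_nat n)%Z ->
     w a b c = RtoC 0) ->
  tri l w x y z =
  (tri l w (tailZ n x) y z + tri l w (cut n x) (tailZ n y) z + tri l w (cut n x) (cut n y) (tailZ n z))%C.
Proof.
intros H; unfold tri.
rewrite <- !csum_plus; apply csum_ext; intros a Ha.
rewrite <- !csum_plus; apply csum_ext; intros b Hb.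
rewrite <- !csum_plus; apply csum_ext; intros c Hc.
destruct (Z.eqb_spec (a + b + c) 0); [|ring].
unfold tailZ, cut.
destruct (Z.leb_spec (Z.abs a) (Z.of_nat n)); [|ring].
destruct (Z.leb_spec (Z.abs b) (Z.of_nat n)); [|ring].
destruct (Z.leb_spec (Z.abs c) (Z.of_nat n)); [|ring].
rewrite H; auto; ring.
Qed.

Lemma tri_bound l w x y z m1 m2 m3 k :
  NoDup l -> 0 <= k -> l2le l (fun k => Cmod (x k)) m1 -> l2le l (fun k => Cmod (y k)) m2 ->
  l2le l (fun k => Cmod (z k)) m3 ->
  (forall a b c, In a l -> In b l -> In c l -> (a + b + c = 0)%Z ->
     Cmod (w a b c) <= k * (inv a * inv b + inv b * inv c + inv a * inv c)) ->
  Cmod (tri l w x y z) <= 12 * k * (m1 * m2 * m3).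
Proof.
intros Hn Hk H1 H2 H3 Hw; eapply Rle_trans; [apply Cmod_tri|].
replace (12 * k * (m1 * m2 * m3)) with (k * (12 * (m1 * m2 * m3))) by ring.
eapply Rle_trans; [|apply Rmult_le_compat_l, (tsum_inv_all l _ _ _ _ _ _ Hn H1 H2 H3); auto].
rewrite <- tsum_scal; apply tsum_le; intros a b c Ha Hb Hc HS.
rewrite <- (Rmult_assoc k); apply Rmult_le_compat_r; auto.
repeat apply Rmult_le_pos; apply Cmod_ge_0.
Qed.

Lemma Cmod_plus3 a b c : Cmod (a + b + c)%C <= Cmod a + Cmod b + Cmod c.
Proof.
eapply Rle_trans; [apply Cmod_triangle|apply Rplus_le_compat_r, Cmod_triangle].
Qed.

(** Three pieces, each with one tail factor: [4 = 3 * 12 * (1/9)]. *)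
Lemma tri_small l w x n r eps :
  NoDup l -> l2 x r -> l2 (tailZ n x) eps ->
  (forall a b c, In a l -> In b l -> In c l -> (a + b + c = 0)%Z ->
     Cmod (w a b c) <= / 9 * (inv a * inv b + inv b * inv c + inv a * inv c)) ->
  (forall a b c, In a l -> In b l -> In c l -> (a + b + c = 0)%Z ->
     (Z.abs a <= Z.of_nat n)%Z -> (Z.abs b <= Z.of_nat n)%Z -> (Z.abs c <= Z.of_nat n)%Z ->
     w a b c = RtoC 0) ->
  Cmod (tri l w x x x) <= 4 * r ^ 2 * eps.
Proof.
intros Hn Hr He Hw Hs; rewrite (tri_split l w x x x n Hs).
assert (Hc := l2_cut n x r Hr).
eapply Rle_trans; [apply Cmod_plus3|].
assert (H9 : 0 <= / 9) by lra.
assert (E1 := tri_bound l w _ _ _ _ _ _ _ Hn H9 (He l Hn) (Hr l Hn) (Hr l Hn) Hw).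
assert (E2 := tri_bound l w _ _ _ _ _ _ _ Hn H9 (Hc l Hn) (He l Hn) (Hr l Hn) Hw).
assert (E3 := tri_bound l w _ _ _ _ _ _ _ Hn H9 (Hc l Hn) (Hc l Hn) (He l Hn) Hw).
nra.
Qed.

(** * Conservation of the mean square *)

Definition mass (n : nat) (x : Z -> C) : R := rsum (box n) (fun k => Cmod (x k) ^ 2).

Lemma csum_RtoC {A} (l : list A) f : csum l (fun a => RtoC (f a)) = RtoC (rsum l f).
Proof. induction l as [|a l IH]; simpl; auto; now rewrite IH, RtoC_plus. Qed.

Lemma csum_chi n m f : (n <= m)%nat ->
  csum (box m) (fun k => RtoC (chi n k) * f k)%C = csum (box n) f.
Proof.
intros H; rewrite (csum_sub (box n) (box m)); auto using NoDup_box, incl_box.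
  apply csum_ext; intros k Hk; apply in_box in Hk; unfold chi.
  destruct (Z.leb_spec (Z.abs k) (Z.of_nat n)); [ring|lia].
intros k Hk Hk'; rewrite in_box in *; unfold chi.
destruct (Z.leb_spec (Z.abs k) (Z.of_nat n)); [|ring].
exfalso; lia.
Qed.

Lemma chi_mult_cut n m k x : (n <= m)%nat ->
  (RtoC (chi n k) * cut m x k)%C = (RtoC (chi n k) * x k)%C.
Proof.
intros H; unfold chi, cut; destruct (Z.leb_spec (Z.abs k) (Z.of_nat n)); [|ring].
destruct (Z.leb_spec (Z.abs k) (Z.of_nat m)); [ring|lia].
Qed.

(** All three slots carry the same sequence, so the multiplier may be averaged over them. The [1/9]
    of [w_mass] is [1/3] from this average and [1/3] from the phase. *)
Lemma mass_flux l n m t x :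
  l = box m ->
  tri l (osc (fun a b c => RtoC (-3) * Ci * RtoC (IZR (a * b * c)) * w_mass n a b c)%C t) x x x =
  csum l (fun k => (RtoC (chi n k) * (Ci * RtoC (IZR k))) * conv l x x k t * x (- k)%Z)%C.
Proof.
intros ->.
rewrite (tri_pair m (fun k => RtoC (chi n k) * (Ci * RtoC (IZR k)))%C).
set (f := fun k => (- (RtoC (chi n k) * (Ci * RtoC (IZR k))))%C).
set (A3 := tri (box m) (osc (fun a b c => f c) t) x x x).
assert (E3 : tri (box m) (osc (fun a b c => RtoC (chi n (- c)) * (Ci * RtoC (IZR (- c)))) t)%C x x x = A3).
  apply tri_ext; intros; unfold osc, f; rewrite chi_opp, opp_IZR, RtoC_opp; ring.
rewrite E3.
assert (E2 : tri (box m) (osc (fun a b c => f b) t) x x x = A3).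
  rewrite tri_swap23; apply tri_ext; intros; unfold osc.
  replace (- (3 * IZR a * IZR c * IZR b) * t) with (- (3 * IZR a * IZR b * IZR c) * t) by ring; ring.
assert (E1 : tri (box m) (osc (fun a b c => f a) t) x x x = A3).
  rewrite <- E2, tri_swap12; apply tri_ext; intros; unfold osc.
  replace (- (3 * IZR b * IZR a * IZR c) * t) with (- (3 * IZR a * IZR b * IZR c) * t) by ring; ring.
transitivity (RtoC (/ 3) * (A3 + A3 + A3))%C.
2:{ transitivity (RtoC (/ 3 * 3) * A3)%C; [rewrite RtoC_mult; ring|].
    replace (/ 3 * 3) with 1 by field; ring. }
rewrite <- E1 at 1; rewrite <- E2 at 1; unfold A3.
rewrite <- !tri_plus_w, <- tri_scal.
apply tri_ext; intros a b c Ha Hb Hc _; f_equal.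
unfold osc, f, w_mass.
assert (Hn : IZR (a * b * c) <> 0).
  apply not_0_IZR; apply in_box_0 in Ha; apply in_box_0 in Hb; apply in_box_0 in Hc; nia.
set (e := cexpi _).
replace (RtoC (-3) * Ci * RtoC (IZR (a * b * c)) *
  RtoC (/ 9 * (IZR a * chi n a + IZR b * chi n b + IZR c * chi n c) * / IZR (a * b * c)) * e)%C with
  (Ci * e * RtoC (-3 * IZR (a * b * c) *
    (/ 9 * (IZR a * chi n a + IZR b * chi n b + IZR c * chi n c) * / IZR (a * b * c))))%C
  by (rewrite (RtoC_mult (-3 * IZR (a * b * c))), (RtoC_mult (-3)); ring).
replace (-3 * IZR (a * b * c) * _) with
  (/ 3 * - (chi n a * IZR a + chi n b * IZR b + chi n c * IZR c)) by (field; auto).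
rewrite RtoC_mult, RtoC_opp, !RtoC_plus, !RtoC_mult; ring.
Qed.

(** [D - W + 3 G] has a derivative of order [eps]: the flux [F] through the cutoff is the phase
    derivative of the cubic sum [W], and the quartic terms that [W] releases are handled by
    [quartic_small]. Each of these sums needs a high frequency, hence carries a tail. [N] allows the
    cutoff to be taken as large as desired. *)
Lemma mass_conservation T V NL r :
  0 < T -> sol T V NL -> (forall t, l2 (V t) r) ->
  forall eta N, 0 < eta -> exists n, (N <= n)%nat /\ forall s t, 0 < s < T -> 0 < t < T ->
    Rabs (mass n (V t) - mass n (V s)) <= eta.
Proof.
intros HT HV Hr eta N Heta.
assert (r0 : 0 <= r) by exact (r_nonneg V r Hr).
(* The drift of the corrected mass over time [T], plus the corrections at the two end times; 720,
   480 and 768 are three times the constants of [quartic_small]. *)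
set (bigc := T * (2 + 720 * r ^ 3 + 480 * r ^ 4) + 2 * (4 * r ^ 2 + 768 * r ^ 3) + 1).
assert (R2 : 0 <= r ^ 2) by now apply pow_le.
assert (R3 : 0 <= r ^ 3) by now apply pow_le.
assert (R4 : 0 <= r ^ 4) by now apply pow_le.
assert (Hbig : 1 <= bigc).
  unfold bigc; assert (0 <= T * (2 + 720 * r ^ 3 + 480 * r ^ 4)) by (apply Rmult_le_pos; lra); lra.
set (eps := eta / bigc).
assert (He : 0 < eps) by (apply Rdiv_lt_0_compat; lra).
destruct (sol_tail _ _ _ HV eps He) as [n0 Hn0].
(* [quartic_small] works with the threshold [2q]; if all four frequencies are within it, then
   [a + b] is within [n = 4q] and [w_mass_supp] applies. *)
set (q := (n0 + N)%nat); set (n := (2 * (2 * q))%nat).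
assert (Hq : forall t, l2 (tailZ q (V t)) eps).
  intros t; apply (l2_tail_mono n0); auto; unfold q; lia.
(* Each box is chosen after the previous one: [c1] pays for a factor [|k| <= n] over at most
   [2n + 1] modes in [rem1], and [c2] for two plain sums over frequencies up to [m] in [Rem2]. *)
set (c1 := (2 * INR n + 1) * (INR n * (2 * r + 1) * (r + 1))).
assert (Hnn := pos_INR n).
assert (Hc1 : 0 <= c1) by (unfold c1; repeat apply Rmult_le_pos; lra).
assert (He2 : 0 < eps / (c1 + 1)) by (apply Rdiv_lt_0_compat; lra).
destruct (sol_tail _ _ _ HV _ He2) as [m0 Hm0].
set (m := (m0 + n)%nat).
assert (Hm : forall t, l2 (tailZ m (V t)) (eps / (c1 + 1))).
  intros t; apply (l2_tail_mono m0); auto; unfold m; lia.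
set (c2 := 3 * (2 * r + 1) * ((2 * INR m + 1) * (r + 1)) ^ 2).
assert (Hmm := pos_INR m).
assert (Hc2 : 0 <= c2) by (unfold c2; repeat apply Rmult_le_pos; try apply pow2_ge_0; lra).
assert (He3 : 0 < eps / (c2 + 1)) by (apply Rdiv_lt_0_compat; lra).
destruct (sol_tail _ _ _ HV _ He3) as [p0 Hp0].
set (p := (p0 + m)%nat).
assert (Hp : forall t, l2 (tailZ p (V t)) (eps / (c2 + 1))).
  intros t; apply (l2_tail_mono p0); auto; unfold p; lia.
assert (Hnm : (n <= m)%nat) by (unfold m; lia).
assert (Hmp : (m <= p)%nat) by (unfold p; lia).
exists n; split; [unfold n, q; lia|].
set (l := box p).
assert (Hl : NoDup l) by apply NoDup_box.
set (g := fun k => (RtoC (chi m k) * (Ci * RtoC (IZR k / 2)))%C).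
set (mu := fun a b c d : Z => if mem l (a + b) then (w_mass n (a + b) c d * g (a + b)%Z)%C else RtoC 0).
assert (Hg : forall k, Cmod (g k) <= Rabs (IZR k) / 2).
  intros k; unfold g; rewrite !Cmod_mult, Cmod_Ci, !Cmod_R, (Rabs_pos_eq (chi m k)) by apply chi_bounds.
  unfold Rdiv; rewrite Rabs_mult, (Rabs_pos_eq (/ 2)) by lra.
  generalize (chi_bounds m k) (Rabs_pos (IZR k)); nra.
assert (Hwg : forall a b c, In a l -> In b l -> In c l -> (a + b + c = 0)%Z ->
   Cmod (w_mass n a b c) * Cmod (g a) <= / 9 * (inv b + inv c)).
  intros a b c Ha Hb Hc HS; apply in_box_0 in Ha; apply in_box_0 in Hb; apply in_box_0 in Hc.
  eapply Rle_trans; [|apply (w_mass_hit n a b c); auto].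
  apply Rmult_le_compat_l; [apply Cmod_ge_0|apply Hg].
destruct (quartic_small l mu T V NL r m q eps Hl HV Hr Hq) as (G & dG & HG).
  intros a b c d Hc Hd HS; unfold mu; destruct (mem l (a + b)) eqn:Em.
    apply memP in Em; rewrite Cmod_mult; eapply Rle_trans; [apply Hwg; auto|].
    generalize (inv_nonneg c) (inv_nonneg d); lra.
  rewrite Cmod_0; generalize (inv_nonneg c) (inv_nonneg d); lra.
  intros a b c d _ _ _ _ HS Ka Kb Kc Kd; unfold mu; destruct (mem l (a + b)); auto.
  rewrite w_mass_supp; [ring|lia|unfold n; lia|unfold n; lia|unfold n; lia].
set (W := fun t => tri l (osc (w_mass n) t) (cut m (V t)) (cut m (V t)) (cut m (V t))).
set (D := fun t => csum l (fun k => RtoC (chi n k) * (V t k * V t (- k)%Z))%C).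
set (rho := fun t k => (NL t k - conv l (cut m (V t)) (cut m (V t)) k t)%C).
set (rho' := fun t k => (NL t k - conv l (V t) (V t) k t)%C).
set (rem1 := fun t => csum l (fun k => RtoC (chi n k) * (Ci * RtoC (IZR k)) * rho t k * V t (- k)%Z)%C).
set (Rem2 := fun t => tri l (osc (w_mass n) t) (fun k => g k * rho' t k)%C (cut m (V t)) (cut m (V t))).
set (Q := fun t => Quart l (fun a b c d => mu a b c d * cexpi (3 * IZR (phi a b c) * t))%C
            (V t) (V t) (cut m (V t)) (cut m (V t))).
set (F := fun t => tri l (osc (fun a b c => RtoC (-3) * Ci * RtoC (IZR (a * b * c)) * w_mass n a b c)%C t)
   (cut m (V t)) (cut m (V t)) (cut m (V t))).
assert (HD : forall t, 0 < t < T -> Cder D t (F t + rem1 t)%C).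
  intros t Ht.
  eapply Cder_eq.
    apply Cder_csum; intros k Hk; apply Cder_scal, Cder_mult; apply (sol_der _ _ _ HV); auto.
  cbv beta.
  transitivity (csum l (fun k => RtoC (chi n k) * (dV NL t k * V t (- k)%Z))%C +
                csum l (fun k => RtoC (chi n k) * (V t k * dV NL t (- k)%Z))%C)%C.
    rewrite <- csum_plus; apply csum_ext; intros; unfold dV; ring.
  assert (Eo := csum_box_opp p (fun k => RtoC (chi n k) * (V t k * dV NL t (- k)%Z))%C).
  fold l in Eo; rewrite <- Eo; clear Eo.
  unfold F; rewrite (mass_flux l n p t _ eq_refl); unfold rem1.
  rewrite <- !csum_plus; apply csum_ext; intros k Hk.
  rewrite Z.opp_involutive, chi_opp; unfold dV, rho.
  set (cv := conv _ _ _ _ _).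
  transitivity (RtoC (chi n k) * (Ci * RtoC (IZR k)) * NL t k * V t (- k)%Z)%C.
    replace (RtoC (IZR k)) with (RtoC (IZR k / 2) + RtoC (IZR k / 2))%C
      by (rewrite <- RtoC_plus; f_equal; field); ring.
  assert (E : (RtoC (chi n k) * cut m (V t) (- k)%Z)%C = (RtoC (chi n k) * V t (- k)%Z)%C).
    rewrite <- (chi_opp n k); now apply chi_mult_cut.
  transitivity (RtoC (chi n k) * V t (- k)%Z * (Ci * RtoC (IZR k) * cv) +
    RtoC (chi n k) * V t (- k)%Z * (Ci * RtoC (IZR k) * (NL t k - cv)))%C; [ring|].
  rewrite <- E at 1; ring.
(* [w_mass] is symmetric, so the derivative contributes equally in the three slots: hence the 3. *)
assert (HW : forall t, 0 < t < T -> Cder W t (F t + RtoC 3 * (Q t + Rem2 t))%C).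
  intros t Ht.
  set (V' := cut m (dV NL t)).
  assert (HV' : forall k, In k l -> Cder (fun s => cut m (V s) k) t (V' k)).
    intros k Hk; unfold V', cut; destruct (_ <=? _)%Z; [now apply (sol_der _ _ _ HV)|apply Cder_const].
  set (X := fun s => cut m (V s)).
  eapply Cder_eq; [apply (Cder_tri l (w_mass n) X X X _ _ _ t HV' HV' HV')|].
  unfold X; cbv beta; fold (F t); f_equal.
  assert (E2 : tri l (osc (w_mass n) t) (cut m (V t)) V' (cut m (V t)) =
     tri l (osc (w_mass n) t) V' (cut m (V t)) (cut m (V t))).
    rewrite tri_swap12; apply tri_ext; intros; rewrite osc_sym12; auto using w_mass_sym12.
  assert (E3 : tri l (osc (w_mass n) t) (cut m (V t)) (cut m (V t)) V' =
     tri l (osc (w_mass n) t) (cut m (V t)) V' (cut m (V t))).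
    rewrite tri_swap23; apply tri_ext; intros; rewrite osc_sym23; auto using w_mass_sym23.
  rewrite E3, E2.
  assert (E1 : tri l (osc (w_mass n) t) V' (cut m (V t)) (cut m (V t)) = (Q t + Rem2 t)%C).
    unfold Q, mu; rewrite <- (tri_hit l (w_mass n) g (V t) (V t)); auto.
    unfold Rem2; rewrite <- tri_plus_1; apply tri_ext; intros a b c _ _ _ _; f_equal.
    unfold V'; rewrite cut_chi; unfold dV, g, rho'; ring.
  rewrite E1; ring.
set (H := fun t => (D t + RtoC (-1) * W t + RtoC 3 * G t)%C).
assert (HH : forall t, 0 < t < T ->
   Cder H t (rem1 t + (- (RtoC 3 * (Q t - dG t)) + - (RtoC 3 * Rem2 t)))%C).
  intros t Ht; eapply Cder_eq.
    apply Cder_plus; [apply Cder_plus; [now apply HD|apply Cder_scal; now apply HW]|].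
    apply Cder_scal; now apply HG.
  rewrite RtoC_m1; ring.
assert (Hrem1 : forall t, 0 < t < T -> Cmod (rem1 t) <= eps).
  intros t Ht; unfold rem1; eapply Rle_trans; [apply Cmod_csum|].
  apply Rle_trans with (rsum l (fun k => if (Z.abs k <=? Z.of_nat n)%Z then
      INR n * (2 * r * (eps / (c1 + 1))) * r else 0)).
    apply rsum_le; intros k Hk; unfold chi.
    destruct (Z.leb_spec (Z.abs k) (Z.of_nat n)) as [Hkn|Hkn].
      rewrite !Cmod_mult, Cmod_R, Rabs_R1, Rmult_1_l, Cmod_Ci, Rmult_1_l, Cmod_R, <- abs_IZR.
      apply Rmult_le_compat; try apply Cmod_ge_0.
        apply Rmult_le_pos; [apply IZR_le; lia|apply Cmod_ge_0].
        apply Rmult_le_compat; try apply Cmod_ge_0.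
          apply IZR_le; lia.
          rewrite INR_IZR_INZ; now apply IZR_le.
        unfold rho, l; rewrite conv_box_cut by auto; now apply (NL_approx T V NL r).
      apply (l2le_term l (fun k => Cmod (V t k)) r); [now apply Hr|].
      unfold l in *; rewrite in_box in *; lia.
    rewrite !Cmod_mult, Cmod_0; lra.
  eapply Rle_trans; [apply rsum_count; auto|].
    clear -He2 r0 Hnn; revert He2; generalize (eps / (c1 + 1)); intros; repeat apply Rmult_le_pos; lra.
  apply Rle_trans with (c1 * (eps / (c1 + 1))).
    unfold c1 at 2; clear -He2 r0 Hnn; revert He2; generalize (eps / (c1 + 1)); intros x He2.
    assert (0 <= (2 * INR n + 1) * INR n * x) by (repeat apply Rmult_le_pos; lra).
    replace ((2 * INR n + 1) * (INR n * (2 * r * x) * r)) with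
      (((2 * INR n + 1) * INR n * x) * (2 * r * r)) by ring.
    replace ((2 * INR n + 1) * (INR n * (2 * r + 1) * (r + 1)) * x) with
      (((2 * INR n + 1) * INR n * x) * ((2 * r + 1) * (r + 1))) by ring.
    apply Rmult_le_compat_l; auto; nra.
  apply Rmult_le_reg_r with (c1 + 1); [lra|].
  replace (c1 * (eps / (c1 + 1)) * (c1 + 1)) with (c1 * eps) by (field; lra); nra.
assert (HRem2 : forall t, 0 < t < T -> 3 * Cmod (Rem2 t) <= eps).
  intros t Ht.
  assert (Hx : exists x, x = eps / (c2 + 1)) by eauto; destruct Hx as [x Ex].
  rewrite <- Ex in *.
  assert (HS1 : rsum l (fun b => Cmod (cut m (V t) b)) <= (2 * INR m + 1) * r).
    eapply Rle_trans; [|apply (rsum_count l m r Hl r0)].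
    apply rsum_le; intros k Hk; unfold cut; destruct (_ <=? _)%Z; [|rewrite Cmod_0; lra].
    apply (l2le_term l (fun k => Cmod (V t k)) r); auto; now apply Hr.
  assert (HR : Cmod (Rem2 t) <= (2 * r * x) * (((2 * INR m + 1) * r) * ((2 * INR m + 1) * r))).
    unfold Rem2; eapply Rle_trans; [apply Cmod_tri|].
    eapply Rle_trans; [|apply (tsum_free_1 l (fun b => Cmod (cut m (V t) b)) (fun b => Cmod (cut m (V t) b)));
       auto; intros; try apply Cmod_ge_0].
    - apply tsum_le; intros a b c Ha Hb Hc HS.
      rewrite Cmod_osc, Cmod_mult.
      set (y := Cmod (cut m (V t) b)); set (z := Cmod (cut m (V t) c)).
      assert (Hy : 0 <= y) by apply Cmod_ge_0. assert (Hz : 0 <= z) by apply Cmod_ge_0.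
      replace (Cmod (w_mass n a b c) * (Cmod (g a) * Cmod (rho' t a) * y * z)) with
        (Cmod (w_mass n a b c) * Cmod (g a) * Cmod (rho' t a) * (y * z)) by ring.
      apply Rmult_le_compat_r; [now apply Rmult_le_pos|].
      assert (Hrho : Cmod (rho' t a) <= 2 * r * x) by now apply (NL_approx T V NL r).
      assert (Hone : Cmod (w_mass n a b c) * Cmod (g a) <= 1).
        eapply Rle_trans; [now apply Hwg|].
        generalize (inv_le_1 b) (inv_le_1 c); lra.
      rewrite <- (Rmult_1_l (2 * r * x)).
      apply Rmult_le_compat; auto; try apply Cmod_ge_0.
      apply Rmult_le_pos; apply Cmod_ge_0.
    - repeat apply Rmult_le_pos; lra.
    - repeat apply Rmult_le_pos; lra.
  apply Rle_trans with (c2 * x).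
    unfold c2; clear -HR r0 Hmm He3.
    assert (0 <= (2 * INR m + 1) ^ 2 * x) by (apply Rmult_le_pos; [apply pow2_ge_0|lra]).
    apply Rle_trans with (((2 * INR m + 1) ^ 2 * x) * (6 * r * r * r)); [lra|].
    replace (3 * (2 * r + 1) * ((2 * INR m + 1) * (r + 1)) ^ 2 * x) with
     (((2 * INR m + 1) ^ 2 * x) * (3 * (2 * r + 1) * (r + 1) ^ 2)) by ring.
    apply Rmult_le_compat_l; auto; nra.
  rewrite Ex; apply Rmult_le_reg_r with (c2 + 1); [lra|].
  replace (c2 * (eps / (c2 + 1)) * (c2 + 1)) with (c2 * eps) by (field; lra); nra.
assert (HWb : forall t, Cmod (W t) <= 4 * r ^ 2 * eps).
  intros t; unfold W; apply (tri_small l _ _ n); auto.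
  - now apply l2_cut.
  - intros L HL; apply (l2le_mod L _ (tailZ n (V t))).
      apply (l2_tail_mono q n); auto; unfold n; lia.
    intros k; unfold tailZ; destruct (_ <=? _)%Z; [lra|apply Cmod_cut].
  - intros a b c Ha Hb Hc _; rewrite Cmod_osc; apply w_mass_bound; eapply in_box_0; eauto.
  - intros a b c _ _ _ HS Ka Kb Kc; unfold osc; rewrite w_mass_supp; auto; ring.
assert (Hmass : forall t, fst (D t) = mass n (V t)).
  intros t; unfold D, l; rewrite csum_chi by lia.
  rewrite (csum_ext _ _ (fun k => RtoC (Cmod (V t k) ^ 2))), csum_RtoC; auto.
  intros k _; now rewrite (sol_conj _ _ _ HV), Cmod2_conj.
intros s t Hs Ht.
assert (HLL : Rabs (fst (H t) - fst (H s)) <= (2 + 720 * r ^ 3 + 480 * r ^ 4) * eps * Rabs (t - s)).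
  apply (Lipschitz_interval T H (fun u => (rem1 u + (- (RtoC 3 * (Q u - dG u)) + - (RtoC 3 * Rem2 u)))%C));
    auto; intros u Hu; split; [now apply HH|].
  eapply Rle_trans; [apply Cmod_triangle|].
  eapply Rle_trans; [apply Rplus_le_compat_l, Cmod_triangle|].
  rewrite !Cmod_opp, !Cmod_mult, Cmod_R, (Rabs_pos_eq 3) by lra.
  destruct (HG u Hu) as (_ & HG2 & _); fold (Q u) in HG2.
  specialize (Hrem1 u Hu); specialize (HRem2 u Hu); lra.
assert (Hfst : forall u, 0 < u < T -> Rabs (fst (H u) - mass n (V u)) <= (4 * r ^ 2 + 768 * r ^ 3) * eps).
  intros u Hu; rewrite <- Hmass.
  replace (fst (H u) - fst (D u)) with (fst (RtoC (-1) * W u + RtoC 3 * G u)%C)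
    by (unfold H; simpl; ring).
  eapply Rle_trans; [apply re_le_Cmod|]; eapply Rle_trans; [apply Cmod_triangle|].
  rewrite !Cmod_mult, !Cmod_R, (Rabs_pos_eq 3), (Rabs_left (-1)) by lra.
  destruct (HG u Hu) as (_ & _ & HG3); specialize (HWb u); lra.
assert (Hst : Rabs (t - s) <= T) by (apply Rabs_le; lra).
assert (F1 := Hfst s Hs); assert (F2 := Hfst t Ht).
apply Rle_trans with ((2 + 720 * r ^ 3 + 480 * r ^ 4) * eps * T + 2 * ((4 * r ^ 2 + 768 * r ^ 3) * eps)).
  replace (mass n (V t) - mass n (V s)) with ((fst (H t) - fst (H s)) +
    ((fst (H s) - mass n (V s)) - (fst (H t) - mass n (V t)))) by ring.
  eapply Rle_trans; [apply Rabs_triang|]; apply Rplus_le_compat.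
    apply Rle_trans with (1 := HLL), Rmult_le_compat_l; auto; apply Rmult_le_pos; lra.
  eapply Rle_trans; [apply Rabs_triang|]; rewrite Rabs_Ropp; lra.
replace (_ + _) with ((bigc - 1) * eps) by (unfold bigc; ring).
unfold eps; apply Rmult_le_reg_r with bigc; [lra|].
replace ((bigc - 1) * (eta / bigc) * bigc) with ((bigc - 1) * eta) by (field; lra); nra.
Qed.

(** * Energy estimate for the truncated linear flow *)

(** As [sum_inv], with only the tail of the inverse squares in Cauchy-Schwarz; [delta] bounds its
    square root. *)
Lemma sum_inv_tail l x m N delta :
  NoDup l -> l2le l x m -> 0 <= delta -> 4 / INR (S N) <= delta ^ 2 ->
  rsum l (fun b => if (Z.abs b <=? Z.of_nat N)%Z then 0 else x b * inv b) <= m * delta.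
Proof.
intros Hn (Hm & Hx & H) Hd HN.
rewrite (rsum_ext l _ (fun b => x b * (if (Z.abs b <=? Z.of_nat N)%Z then 0 else inv b))).
2:{ intros b _; destruct (_ <=? _)%Z; ring. }
apply rsum_CS; auto; apply Rle_trans with (2 := HN).
assert (E : forall L, rsum (filter (fun b => negb (Z.abs b <=? Z.of_nat N)%Z) L) (fun k => inv k ^ 2) =
  rsum L (fun b => (if (Z.abs b <=? Z.of_nat N)%Z then 0 else inv b) ^ 2)).
  induction L as [|b L IH]; auto.
  cbn [rsum filter]; destruct (_ <=? _)%Z; cbn [negb rsum]; rewrite IH; ring.
rewrite <- E; apply rsum_NoDup_inv2; [now apply NoDup_filter|].
intros k Hk; apply filter_In in Hk; destruct Hk as [_ Hk]; right.
destruct (Z.leb_spec (Z.abs k) (Z.of_nat N)); [discriminate|auto].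
Qed.

Lemma exp_monotone x y : x <= y -> exp x <= exp y.
Proof. intros [H| ->]; [left; now apply exp_increasing|lra]. Qed.

(** The times are not ordered: [exp (-C u) h u] is nonincreasing and [exp (C u) h u] nondecreasing,
    and each serves one order. *)
Lemma gronwall T (h dh : R -> R) C s t :
  (forall u, 0 < u < T -> is_derive h u (dh u) /\ Rabs (dh u) <= C * h u) -> 0 <= C ->
  0 < s < T -> 0 < t < T -> h t <= exp (C * T) * h s.
Proof.
intros H HC Hs Ht.
(* For [C > 0] the derivative bound forces [h >= 0]. For [C = 0] it makes [h] constant, and its sign
   is immaterial. *)
assert (Hpos : C = 0 \/ forall u, 0 < u < T -> 0 <= h u).
  destruct (Req_dec C 0) as [|HC0]; auto; right; intros u Hu.
  destruct (H u Hu) as [_ Hb]; generalize (Rabs_pos (dh u)); intros; nra.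
assert (Hmon : forall sg, (sg = 1 \/ sg = -1) -> forall u v, 0 < u < T -> 0 < v < T -> u <= v ->
   sg * (exp (sg * C * u) * h u) <= sg * (exp (sg * C * v) * h v)).
  intros sg Hsg u v Hu Hv Huv.
  destruct (MVT_gen (fun x => sg * (exp (sg * C * x) * h x)) u v
    (fun x => sg * (sg * C * exp (sg * C * x) * h x + exp (sg * C * x) * dh x))) as (c & Hc & E).
  - intros x Hx; rewrite Rmin_left, Rmax_right in Hx by auto.
    destruct (H x) as [Hx' _]; [lra|].
    assert (Ex : ex_derive h x) by (eexists; eauto).
    auto_derive; [exact Ex|].
    replace (Derive (fun x0 : R => h x0) x) with (dh x) by (symmetry; now apply is_derive_unique); ring.
  - intros x Hx; rewrite Rmin_left, Rmax_right in Hx by auto.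
    destruct (H x) as [Hx' _]; [lra|].
    assert (Ex : ex_derive h x) by (eexists; eauto).
    apply derivable_continuous_pt; eexists; apply is_derive_Reals; auto_derive; eauto.
  - rewrite Rmin_left, Rmax_right in Hc by auto.
    destruct (H c) as [_ Hb]; [lra|].
    assert (0 <= sg * (sg * C * exp (sg * C * c) * h c + exp (sg * C * c) * dh c)).
      assert (He := exp_pos (sg * C * c)); apply Rabs_le_between in Hb.
      replace (sg * (sg * C * exp (sg * C * c) * h c + exp (sg * C * c) * dh c)) with
        (exp (sg * C * c) * (sg * sg * C * h c + sg * dh c)) by ring.
      apply Rmult_le_pos; [lra|]; destruct Hsg; subst sg; lra.
    nra.
assert (Hc0 : C * h s >= 0 /\ C * h t >= 0).
  destruct Hpos as [->|Hp]; [lra|generalize (Hp s Hs) (Hp t Ht); nra].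
destruct (Rle_dec s t) as [Hst|Hst].
  assert (E := Hmon (-1) (or_intror eq_refl) s t Hs Ht Hst).
  assert (E' : exp (-1 * C * t) * h t <= exp (-1 * C * s) * h s) by lra.
  apply (Rmult_le_compat_l (exp (C * t))) in E'; [|left; apply exp_pos].
  rewrite <- !Rmult_assoc, <- !exp_plus in E'.
  replace (C * t + -1 * C * t) with 0 in E' by ring; rewrite exp_0, Rmult_1_l in E'.
  apply Rle_trans with (1 := E').
  destruct Hpos as [->|Hp]; [rewrite !Rmult_0_r, !Rmult_0_l, Rplus_0_l; lra|].
  apply Rmult_le_compat_r; auto; apply exp_monotone; nra.
assert (Hts : t <= s) by lra.
assert (E := Hmon 1 (or_introl eq_refl) t s Ht Hs Hts).
assert (E' : exp (1 * C * t) * h t <= exp (1 * C * s) * h s) by lra.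
apply (Rmult_le_compat_l (exp (- C * t))) in E'; [|left; apply exp_pos].
rewrite <- !Rmult_assoc, <- !exp_plus in E'.
replace (- C * t + 1 * C * t) with 0 in E' by ring; rewrite exp_0, Rmult_1_l in E'.
apply Rle_trans with (1 := E').
destruct Hpos as [->|Hp].
  replace (-0 * t + 1 * 0 * s) with (0 * T) by ring; lra.
apply Rmult_le_compat_r; auto; apply exp_monotone; nra.
Qed.

Definition some_above2 (N : nat) (b c : Z) : bool :=
  negb ((Z.abs b <=? Z.of_nat N)%Z && (Z.abs c <=? Z.of_nat N)%Z).

(* Chosen so that [-3 i a b c * w_energy] is [i a / 2], the multiplier of the energy, on high frequencies. *)
Definition w_energy (N : nat) (a b c : Z) : C :=
  if some_above2 N b c then RtoC (- / 6 * / IZR (b * c)) else RtoC 0.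

Lemma Cmod_w_energy N a b c : b <> 0%Z -> c <> 0%Z ->
  Cmod (w_energy N a b c) = if some_above2 N b c then / 6 * (inv b * inv c) else 0.
Proof.
intros Hb Hc; unfold w_energy; destruct (some_above2 N b c); [|apply Cmod_0].
rewrite Cmod_R, Rabs_mult, Rabs_Ropp, (Rabs_pos_eq (/ 6)), mult_IZR, Rinv_mult, Rabs_mult by lra.
now rewrite !Rinv_abs_inv.
Qed.

Lemma w_energy_le N a b c : b <> 0%Z -> c <> 0%Z -> Cmod (w_energy N a b c) <= / 6 * (inv b * inv c).
Proof.
intros Hb Hc; rewrite Cmod_w_energy; auto; destruct (some_above2 N b c); [lra|].
generalize (inv_nonneg b) (inv_nonneg c); intros; apply Rmult_le_pos; [lra|now apply Rmult_le_pos].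
Qed.

Definition half_ik (n : nat) (k : Z) : C := (RtoC (chi n k) * (Ci * RtoC (IZR k / 2)))%C.

Lemma Cmod_half_ik n k : Cmod (half_ik n k) <= Rabs (IZR k) / 2.
Proof.
unfold half_ik; rewrite !Cmod_mult, Cmod_Ci, !Cmod_R, (Rabs_pos_eq (chi n k)) by apply chi_bounds.
unfold Rdiv; rewrite Rabs_mult, (Rabs_pos_eq (/ 2)) by lra.
generalize (chi_bounds n k) (Rabs_pos (IZR k)); nra.
Qed.

Lemma inv_mult_hit a b c : b <> 0%Z -> c <> 0%Z -> (a + b + c = 0)%Z ->
  inv b * inv c * Rabs (IZR a) <= inv b + inv c.
Proof.
intros Hb Hc HS.
assert (H' : Rabs (IZR a) <= Rabs (IZR b) + Rabs (IZR c)).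
  replace (IZR a) with (- (IZR b + IZR c)) by (rewrite <- plus_IZR, <- opp_IZR; f_equal; lia).
  rewrite Rabs_Ropp; apply Rabs_triang.
generalize (Rabs_inv_l b Hb) (Rabs_inv_l c Hc) (inv_nonneg b) (inv_nonneg c); intros Eb Ec Ib Ic.
apply Rle_trans with (inv b * inv c * (Rabs (IZR b) + Rabs (IZR c))).
  apply Rmult_le_compat_l; auto; now apply Rmult_le_pos.
replace (inv b * inv c * (Rabs (IZR b) + Rabs (IZR c))) with
  ((Rabs (IZR b) * inv b) * inv c + (Rabs (IZR c) * inv c) * inv b) by ring.
rewrite Eb, Ec; lra.
Qed.

Section Piece.
Variables (T r delta rho : R) (n m N K : nat) (V NL S S' y z : R -> Z -> C) (e : R -> R).
Let l := box m.
Let y' t k := (half_ik n k * conv l (S t) (y t) k t)%C.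
Let z' t k := (half_ik n k * conv l (S t) (z t) k t)%C.
Hypotheses (r0 : 0 <= r) (HK : (0 < K)%nat) (HV : sol T V NL) (Hr : forall t, l2 (V t) r).
Hypothesis HS : forall t, 0 < t < T -> reg l S (S' t) t (2 * r) (r ^ 2).
Hypothesis Hy : forall t, 0 < t < T -> reg l y (y' t) t (e t) (r * e t).
Hypothesis Hz : forall t, 0 < t < T -> reg l z (z' t) t (e t) (r * e t).
Hypothesis Hd : 0 <= delta.
Hypothesis HN : 4 / INR (Datatypes.S N) <= delta ^ 2.
Hypothesis Hrho0 : 0 <= rho.
Hypothesis Hrho : INR n * rho <= 1.
Hypothesis Hrem : forall t k, 0 < t < T -> Cmod (NL t k - conv l (V t) (V t) k t)%C <= rho.

(** In the application [y] and [z] are supported in [|k| <= n], so the third frequency [a = -b - c]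
    never exceeds [2n]. *)
Let X t := cut (2 * n) (V t).
Let X' t := cut (2 * n) (dV NL t).
Let Hl : NoDup l := NoDup_box m.
Let CK := 6 + 2 * (2 * INR K + 1) ^ 3.

Let mu1 a b c d := if mem l (a + b) then (w_energy N (a + b) c d * half_ik (2 * n) (a + b))%C else RtoC 0.
Let mu2 a b c d := if mem l (a + b) then (w_energy N c (a + b) d * half_ik n (a + b))%C else RtoC 0.

Lemma mu1_bound a b c d : In c l -> In d l -> (a + b + c + d = 0)%Z -> Cmod (mu1 a b c d) <= inv c + inv d.
Proof.
intros Hc Hd' HSm; unfold mu1; generalize (inv_nonneg c) (inv_nonneg d); intros Ic Id.
destruct (mem l (a + b)); [|rewrite Cmod_0; lra].
apply in_box_0 in Hc; apply in_box_0 in Hd'.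
rewrite Cmod_mult.
apply Rle_trans with (/ 6 * (inv c * inv d) * (Rabs (IZR (a + b)) / 2)).
  apply Rmult_le_compat; try apply Cmod_ge_0; [now apply w_energy_le|apply Cmod_half_ik].
generalize (inv_mult_hit (a + b) c d Hc Hd' HSm); lra.
Qed.

(** The differentiated frequency [a + b] is one of the two that [w_energy] divides by, so it cancels
    exactly; in [mu1] it is the third frequency and is bounded by [|c| + |d|]. *)
Lemma mu2_bound a b c d : In c l -> In d l -> (a + b + c + d = 0)%Z -> Cmod (mu2 a b c d) <= inv c + inv d.
Proof.
intros Hc Hd' HSm; unfold mu2; generalize (inv_nonneg c) (inv_nonneg d); intros Ic Id.
destruct (mem l (a + b)) eqn:Em; [|rewrite Cmod_0; lra].
apply memP in Em; apply in_box_0 in Em.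
apply in_box_0 in Hc; apply in_box_0 in Hd'.
rewrite Cmod_mult.
apply Rle_trans with (/ 6 * (inv (a + b) * inv d) * (Rabs (IZR (a + b)) / 2)).
  apply Rmult_le_compat; try apply Cmod_ge_0; [now apply w_energy_le|apply Cmod_half_ik].
generalize (Rabs_inv_l _ Em); intros E.
replace (/ 6 * (inv (a + b) * inv d) * (Rabs (IZR (a + b)) / 2)) with
  (/ 12 * inv d * (Rabs (IZR (a + b)) * inv (a + b))) by field.
rewrite E; lra.
Qed.

Lemma w_energy_sym23 a b c : w_energy N a c b = w_energy N a b c.
Proof. unfold w_energy, some_above2; now rewrite Bool.andb_comm, Z.mul_comm. Qed.

(** Only one summand [V] of [S = V + U] sits in the first slot, because its derivative is quadratic
    in itself; [S] still drives [y] and [z]. [W] is the cubic correction, and [G1], [G2], [G3]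
    correct the quartic sums released by its three slots. Their norms [r r e e], [2r e r e],
    [2r e r e] add up to 5; the derivative terms give [240 = 16 (3 + 6 + 6)]; the final 1 bounds
    [Rem]. *)
Lemma energy_piece :
  exists H dH : R -> C, forall t, 0 < t < T ->
    Cder H t (dH t) /\
    Cmod (tri l (osc (fun a b c => RtoC (-3) * Ci * RtoC (IZR (a * b * c)) * w_energy N a b c)%C t)
       (X t) (y t) (z t) - dH t)%C <= (5 * CK * r ^ 2 + 240 * r ^ 3 + 1) * e t ^ 2 /\
    Cmod (H t) <= (2 / 3 * r * delta + 320 / INR K * r ^ 2) * e t ^ 2.
Proof.
destruct (quartic_normal_form l K mu1 V V y z (dV NL) (dV NL) y' z' Hl HK mu1_bound) as (G1 & dG1 & HG1).
destruct (quartic_normal_form l K mu2 S y X z S' y' X' z' Hl HK mu2_bound) as (G2 & dG2 & HG2).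
destruct (quartic_normal_form l K mu2 S z X y S' z' X' y' Hl HK mu2_bound) as (G3 & dG3 & HG3).
set (W := fun t => tri l (osc (w_energy N) t) (X t) (y t) (z t)).
set (F := fun t => tri l (osc (fun a b c => RtoC (-3) * Ci * RtoC (IZR (a * b * c)) * w_energy N a b c)%C t)
       (X t) (y t) (z t)).
set (Rem := fun t => tri l (osc (w_energy N) t)
   (fun k => half_ik (2 * n) k * (NL t k - conv l (V t) (V t) k t))%C (y t) (z t)).
set (Q1 := fun t => Quart l (fun a b c d => mu1 a b c d * cexpi (3 * IZR (phi a b c) * t))%C
   (V t) (V t) (y t) (z t)).
set (Q2 := fun t => Quart l (fun a b c d => mu2 a b c d * cexpi (3 * IZR (phi a b c) * t))%C
   (S t) (y t) (X t) (z t)).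
set (Q3 := fun t => Quart l (fun a b c d => mu2 a b c d * cexpi (3 * IZR (phi a b c) * t))%C
   (S t) (z t) (X t) (y t)).
assert (RV : forall t, 0 < t < T -> reg l V (dV NL t) t r (r ^ 2 / 2)).
  intros t Ht; now apply (reg_sol T V NL r HV Hr).
assert (RX : forall t, 0 < t < T -> reg l X (X' t) t r (r ^ 2 / 2)).
  intros t Ht; apply reg_cut; auto.
exists (fun t => W t + (- G1 t + (- G2 t + - G3 t)))%C.
exists (fun t => F t + (Q1 t + Rem t + Q2 t + Q3 t) + (- dG1 t + (- dG2 t + - dG3 t)))%C.
intros t Ht.
specialize (RV t Ht); specialize (RX t Ht); specialize (HS t Ht); specialize (Hy t Ht); specialize (Hz t Ht).
destruct (HG1 t _ _ _ _ _ _ _ _ RV RV Hy Hz) as (D1 & E1 & F1); fold (Q1 t) in E1.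
destruct (HG2 t _ _ _ _ _ _ _ _ HS Hy RX Hz) as (D2 & E2 & F2); fold (Q2 t) in E2.
destruct (HG3 t _ _ _ _ _ _ _ _ HS Hz RX Hy) as (D3 & E3 & F3); fold (Q3 t) in E3.
assert (e0 : 0 <= e t) by apply Hy.
assert (HWd : Cder W t (F t + (Q1 t + Rem t + Q2 t + Q3 t))%C).
  eapply Cder_eq.
    apply (Cder_tri l (w_energy N) X y z (X' t) (y' t) (z' t) t);
      intros k Hk; [now apply RX|now apply Hy|now apply Hz].
  fold (F t); f_equal; f_equal; [f_equal|].
  - unfold Q1, mu1; rewrite <- (tri_hit l (w_energy N) (half_ik (2 * n)) (V t) (V t)); auto.
    unfold Rem; rewrite <- tri_plus_1; apply tri_ext; intros a b c _ _ _ _; f_equal.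
    unfold X'; rewrite cut_chi; unfold dV, half_ik; ring.
  - rewrite tri_swap12; unfold Q2, mu2.
    rewrite <- (tri_hit l (fun a b c => w_energy N b a c) (half_ik n) (S t) (y t)); auto.
    apply tri_ext; intros a b c _ _ _ _; f_equal.
    unfold osc; do 3 f_equal; ring.
  - rewrite tri_swap23, tri_swap12; unfold Q3, mu2.
    rewrite <- (tri_hit l (fun a b c => w_energy N b a c) (half_ik n) (S t) (z t)); auto.
    apply tri_ext; intros a b c _ _ _ _; f_equal.
    unfold osc; rewrite (w_energy_sym23 b a c); do 3 f_equal; ring.
assert (Copp : forall f d, Cder f t d -> Cder (fun s => - f s)%C t (- d)%C).
  intros f d Hf; apply (Cder_scal (RtoC (-1))) in Hf.
  rewrite RtoC_m1 in Hf.
  eapply Cder_eq; [eapply Cder_ext; [|exact Hf]|ring]; intros; cbv beta; ring.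
split; [|split].
- apply Cder_plus; auto; apply Cder_plus; [|apply Cder_plus]; auto.
- fold (F t).
  replace (F t - _)%C with
    (- (Q1 t - dG1 t) + - (Q2 t - dG2 t) + - (Q3 t - dG3 t) + - Rem t)%C by ring.
  (* [half_ik (2 * n)] costs at most [n], which [Hrho] compensates; the two inverses of [w_energy]
     make the sums over [b] and [c] converge. *)
  assert (HRem : Cmod (Rem t) <= 1 * e t ^ 2).
    unfold Rem; eapply Rle_trans; [apply Cmod_tri|].
    apply Rle_trans with (tsum l (fun a b c => (/ 6) * ((Cmod (y t b) * inv b) * (Cmod (z t c) * inv c)))).
      apply tsum_le; intros a b c Ha Hb Hc HSm.
      rewrite Cmod_osc, Cmod_mult.
      assert (Hw := w_energy_le N a b c (in_box_0 _ _ Hb) (in_box_0 _ _ Hc)).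
      assert (Hg : Cmod (half_ik (2 * n) a) <= INR n).
        unfold half_ik; rewrite !Cmod_mult, Cmod_Ci, !Cmod_R, (Rabs_pos_eq (chi _ a)) by apply chi_bounds.
        unfold chi; destruct (Z.leb_spec (Z.abs a) (Z.of_nat (2 * n))) as [Han|Han].
          unfold Rdiv; rewrite Rabs_mult, (Rabs_pos_eq (/ 2)), <- abs_IZR by lra.
          apply IZR_le in Han; rewrite <- INR_IZR_INZ, mult_INR in Han; simpl INR in Han; lra.
        rewrite Rmult_0_l; apply pos_INR.
      specialize (Hrem t a Ht).
      generalize (inv_nonneg b) (inv_nonneg c) (Cmod_ge_0 (y t b)) (Cmod_ge_0 (z t c)); intros Ib Ic Yb Zc.
      set (P := Cmod (NL t a - conv l (V t) (V t) a t)) in *.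
      assert (HP : Cmod (half_ik (2 * n) a) * P <= 1).
        apply Rle_trans with (2 := Hrho); apply Rmult_le_compat; auto; try apply Cmod_ge_0.
      replace (Cmod (w_energy N a b c) * (Cmod (half_ik (2 * n) a) * P * Cmod (y t b) * Cmod (z t c))) with
        (Cmod (w_energy N a b c) * (Cmod (y t b) * Cmod (z t c)) * (Cmod (half_ik (2 * n) a) * P)) by ring.
      replace (/ 6 * (Cmod (y t b) * inv b * (Cmod (z t c) * inv c))) with
        (/ 6 * (inv b * inv c) * (Cmod (y t b) * Cmod (z t c)) * 1) by ring.
      assert (Hyz : 0 <= Cmod (y t b) * Cmod (z t c)) by now apply Rmult_le_pos.
      apply Rmult_le_compat; auto.
        apply Rmult_le_pos; auto; apply Cmod_ge_0.
        apply Rmult_le_pos; apply Cmod_ge_0.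
      now apply Rmult_le_compat_r.
    eapply Rle_trans; [apply (tsum_free_1 l (fun b => Cmod (y t b) * inv b) (fun b => Cmod (z t b) * inv b)
        (/ 6) (2 * e t) (2 * e t)); auto; try lra|].
      intros; apply Rmult_le_pos; [apply Cmod_ge_0|apply inv_nonneg].
      intros; apply Rmult_le_pos; [apply Cmod_ge_0|apply inv_nonneg].
      apply (sum_inv l (fun b => Cmod (y t b))); auto; apply Hy.
      apply (sum_inv l (fun b => Cmod (z t b))); auto; apply Hz.
    nra.
  eapply Rle_trans; [apply Cmod_plus4|]; rewrite !Cmod_opp.
  fold CK in E1, E2, E3; lra.
(* One of [b], [c] exceeds [N], so one of the two inverse sums is a tail and brings [delta]. *)
- assert (HWb : Cmod (W t) <= 2 / 3 * r * delta * e t ^ 2).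
    unfold W; eapply Rle_trans; [apply Cmod_tri|].
    set (f := fun x : Z -> C => fun b => Cmod (x b) * inv b).
    set (ft := fun x : Z -> C => fun b => if (Z.abs b <=? Z.of_nat N)%Z then 0 else Cmod (x b) * inv b).
    assert (f0 : forall x b, 0 <= f x b).
      intros; unfold f; apply Rmult_le_pos; [apply Cmod_ge_0|apply inv_nonneg].
    assert (ft0 : forall x b, 0 <= ft x b).
      intros; unfold ft; destruct (_ <=? _)%Z; [lra|apply f0].
    apply Rle_trans with (tsum l (fun a b c => (/ 6 * r) * (ft (y t) b * f (z t) c)) +
        tsum l (fun a b c => (/ 6 * r) * (f (y t) b * ft (z t) c))).
      rewrite <- tsum_plus; apply tsum_le; intros a b c Ha Hb Hc HSm.
      rewrite Cmod_osc, Cmod_w_energy by (eapply in_box_0; eauto).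
      assert (Hx : Cmod (X t a) <= r).
        apply (l2le_term l (fun k => Cmod (X t k))); auto; apply RX.
      assert (P1 : forall u v, 0 <= u -> 0 <= v -> 0 <= / 6 * r * (u * v)).
        intros; repeat apply Rmult_le_pos; auto; lra.
      assert (P2 := P1 _ _ (ft0 (y t) b) (f0 (z t) c)).
      assert (P3 := P1 _ _ (f0 (y t) b) (ft0 (z t) c)).
      destruct (some_above2 N b c) eqn:Eh; [|lra].
      apply Rle_trans with (/ 6 * r * (f (y t) b * f (z t) c)).
        replace (/ 6 * (inv b * inv c) * (Cmod (X t a) * Cmod (y t b) * Cmod (z t c))) with
          (/ 6 * Cmod (X t a) * (f (y t) b * f (z t) c)) by (unfold f; ring).
        apply Rmult_le_compat_r; [now apply Rmult_le_pos|lra].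
      revert Eh P2 P3; unfold some_above2, ft; fold (f (y t) b) (f (z t) c).
      destruct (_ <=? _)%Z; [destruct (_ <=? _)%Z|]; simpl; intros Eh P2 P3; try lra; discriminate.
    assert (Sy : rsum l (f (y t)) <= 2 * e t) by (apply (sum_inv l (fun b => Cmod (y t b))); auto; apply Hy).
    assert (Sz : rsum l (f (z t)) <= 2 * e t) by (apply (sum_inv l (fun b => Cmod (z t b))); auto; apply Hz).
    assert (Ty : rsum l (ft (y t)) <= e t * delta).
      apply (sum_inv_tail l (fun b => Cmod (y t b))); auto; apply Hy.
    assert (Tz : rsum l (ft (z t)) <= e t * delta).
      apply (sum_inv_tail l (fun b => Cmod (z t b))); auto; apply Hz.
    assert (I1 : tsum l (fun a b c => (/ 6 * r) * (ft (y t) b * f (z t) c)) <=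
       (/ 6 * r) * ((e t * delta) * (2 * e t))).
      apply tsum_free_1; auto; [lra|now apply Rmult_le_pos].
    assert (I2 : tsum l (fun a b c => (/ 6 * r) * (f (y t) b * ft (z t) c)) <=
       (/ 6 * r) * ((2 * e t) * (e t * delta))).
      apply tsum_free_1; auto; lra.
    lra.
  eapply Rle_trans; [apply Cmod_triangle|].
  eapply Rle_trans; [apply Rplus_le_compat_l, Cmod_triangle|].
  eapply Rle_trans; [apply Rplus_le_compat_l, Rplus_le_compat_l, Cmod_triangle|].
  rewrite !Cmod_opp.
  assert (HK' : 0 < INR K) by now apply lt_0_INR.
  replace (320 / INR K * r ^ 2) with (5 * (64 / INR K * r ^ 2)) by (field; lra).
  lra.
Qed.
End Piece.

(** * The truncated linear flow and its energy *)

Record flow (T : R) (n : nat) (S y : R -> Z -> C) : Prop := {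
  fl_supp : forall t k, ~ In k (box n) -> y t k = RtoC 0;
  fl_cont : forall k t, continuous (fun s => fst (y s k)) t /\ continuous (fun s => snd (y s k)) t;
  fl_der : forall t k, 0 < t < T -> In k (box n) ->
    Cder (fun s => y s k) t (Ci * RtoC (IZR k / 2) * conv (box (2 * n)) (S t) (y t) k t)%C }.

(** An output and an input within [n] leave at most [2n] for the frequency of [S], so larger boxes
    add nothing. *)
Lemma conv_box_supp m n S y k t : (2 * n <= m)%nat -> In k (box n) ->
  (forall b, ~ In b (box n) -> y b = RtoC 0) ->
  conv (box m) S y k t = conv (box (2 * n)) S y k t.
Proof.
intros Hm Hk Hy; unfold conv.
rewrite (csum_sub (box (2 * n)) (box m)); auto using NoDup_box, incl_box.
  apply csum_ext; intros a _.
  rewrite (csum_sub (box (2 * n)) (box m)); auto using NoDup_box, incl_box.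
  intros b Hb Hb'; rewrite Hy; [destruct (_ =? _)%Z; ring|].
  rewrite in_box in *; lia.
intros a Ha Ha'; rewrite (csum_ext _ _ (fun _ => RtoC 0)), csum_0; auto.
intros b Hb; destruct (Z.eqb_spec (a + b) k); auto.
rewrite Hy; [ring|]; rewrite in_box in *; lia.
Qed.

Lemma Cconj_mult x y : Cconj (x * y)%C = (Cconj x * Cconj y)%C.
Proof. unfold Cconj, Cmult; simpl; f_equal; ring. Qed.

Lemma Cconj_csum {A} (l : list A) f : Cconj (csum l f) = csum l (fun a => Cconj (f a)).
Proof.
induction l as [|a l IH]; simpl.
  unfold Cconj; simpl; now rewrite Ropp_0.
rewrite <- IH; unfold Cconj, Cplus; simpl; f_equal; ring.
Qed.

Lemma Cconj_0 : Cconj (RtoC 0) = RtoC 0.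
Proof. unfold Cconj; simpl; now rewrite Ropp_0. Qed.

Lemma conv_conj m p q k t :
  Cconj (conv (box m) p q (- k) t) =
  conv (box m) (fun a => Cconj (p (- a)%Z)) (fun a => Cconj (q (- a)%Z)) k t.
Proof.
unfold conv; rewrite Cconj_csum, <- csum_box_opp; apply csum_ext; intros a _.
rewrite Cconj_csum, <- csum_box_opp; apply csum_ext; intros b _.
destruct (Z.eqb_spec (- a + - b) (- k)), (Z.eqb_spec (a + b) k); try lia.
  rewrite !Cconj_mult, <- cexpi_opp, !opp_IZR; do 2 f_equal; ring.
apply Cconj_0.
Qed.

Lemma rsum_sub l l' (f : Z -> R) :
  NoDup l -> NoDup l' -> incl l l' -> (forall k, In k l' -> ~ In k l -> f k = 0) ->
  rsum l' f = rsum l f.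
Proof.
intros Hl Hl' Hi Hf; apply RtoC_inj; rewrite <- !csum_RtoC.
apply csum_sub; auto; intros; now rewrite Hf.
Qed.

Lemma mass_nonneg n x : 0 <= mass n x.
Proof. apply rsum_nonneg; intros; apply pow2_ge_0. Qed.

Lemma l2_plus x y m m' : l2 x m -> l2 y m' -> l2 (fun k => x k + y k)%C (m + m').
Proof.
intros Hx Hy l Hl; destruct (Hx l Hl) as (Hm & _ & H1), (Hy l Hl) as (Hm' & _ & H2).
split; [lra|split; [intros; apply Cmod_ge_0|]].
apply Rle_trans with (rsum l (fun k => Cmod (x k) ^ 2 + Cmod (y k) ^ 2 + 2 * (Cmod (x k) * Cmod (y k)))).
  apply rsum_le; intros k _.
  generalize (Cmod_triangle (x k) (y k)) (Cmod_ge_0 (x k)) (Cmod_ge_0 (y k)) (Cmod_ge_0 (x k + y k)).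
  intros; nra.
rewrite !rsum_plus, rsum_scal.
assert (H3 := rsum_CS l (fun k => Cmod (x k)) (fun k => Cmod (y k)) m m' Hm Hm' H1 H2).
cbv beta in *; nra.
Qed.

Lemma INR_above x : exists n, (0 < n)%nat /\ x < INR n.
Proof.
destruct (INR_unbounded (Rmax x 0)) as [n Hn]; exists n.
generalize (Rmax_l x 0) (Rmax_r x 0); intros; split; [|lra].
destruct n; [simpl in Hn; lra|lia].
Qed.

Lemma inverse_below delta : 0 < delta -> exists N, 4 / INR (S N) <= delta ^ 2.
Proof.
intros Hdelta; destruct (INR_above (4 / delta ^ 2)) as (N & _ & HN); exists N.
assert (Hd2 : 0 < delta ^ 2) by now apply pow_lt.
assert (HSN : 4 / delta ^ 2 < INR (S N)) by (rewrite S_INR; lra).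
assert (0 < 4 / delta ^ 2) by (apply Rdiv_lt_0_compat; lra).
apply Rmult_le_reg_r with (INR (S N)); [lra|].
replace (4 / INR (S N) * INR (S N)) with (delta ^ 2 * (4 / delta ^ 2)) by (field; lra).
apply Rmult_le_compat_l; lra.
Qed.

(** The cutoff inside [half_ik] extends the equation to the modes between [n] and [m], where both
    sides vanish. *)
Lemma flow_der_box T n m S y t k : flow T n S y -> (2 * n <= m)%nat -> 0 < t < T -> In k (box m) ->
  Cder (fun s => y s k) t (half_ik n k * conv (box m) (S t) (y t) k t)%C.
Proof.
intros Hy Hnm Ht Hk; destruct (in_dec Z.eq_dec k (box n)) as [Hkn|Hkn].
  eapply Cder_eq; [now apply (fl_der _ _ _ _ Hy)|].
  rewrite (conv_box_supp m n); auto; [|apply (fl_supp _ _ _ _ Hy)].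
  unfold half_ik, chi; apply in_box in Hkn; destruct (Z.leb_spec (Z.abs k) (Z.of_nat n)); [ring|lia].
eapply Cder_eq; [eapply Cder_ext; [|apply (Cder_const (RtoC 0))]|].
  intros v; cbv beta; now rewrite (fl_supp _ _ _ _ Hy).
unfold half_ik, chi; rewrite in_box in Hk, Hkn.
destruct (Z.leb_spec (Z.abs k) (Z.of_nat n)); [lia|ring].
Qed.

(** The corrected energy [h] stays between [e^2/2] and [3 e^2/2] and satisfies [|h'| <= 2 c0 h]; the
    ratio of the two bounds is the factor 3. The rate is fixed before [T], the solutions and [n]. *)
Lemma energy_estimate r : 0 <= r -> exists c, 0 <= c /\
  forall T V NLV U NLU n y, sol T V NLV -> sol T U NLU ->
  (forall t, l2 (V t) r) -> (forall t, l2 (U t) r) ->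
  flow T n (fun t k => V t k + U t k)%C y ->
  forall s t, 0 < s < T -> 0 < t < T -> mass n (y t) <= 3 * exp (c * T) * mass n (y s).
Proof.
intros r0.
(* [delta] and [K] hold the correction of each piece to a quarter of the energy:
   [(2/3) r delta <= 1/8], and [320 r^2 / K <= 1/8] because [2560 = 8 * 320]. *)
set (delta := 3 / (16 * (r + 1))).
assert (Hdelta : 0 < delta) by (apply Rdiv_lt_0_compat; lra).
destruct (inverse_below delta Hdelta) as [N HN'].
destruct (INR_above (2560 * r ^ 2)) as (K & HK & HK').
(* The first term bounds the low-frequency flux [Low], the second the errors of [energy_piece] for
   [V] and for [U]. *)
set (c0 := 2 * r * INR N * (2 * INR N + 1) ^ 2 +
   2 * (5 * (6 + 2 * (2 * INR K + 1) ^ 3) * r ^ 2 + 240 * r ^ 3 + 1)).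
assert (Nn := pos_INR N). assert (Kn := pos_INR K).
assert (P1 : 0 <= r ^ 2) by now apply pow_le. assert (P2 : 0 <= r ^ 3) by now apply pow_le.
assert (Hc0 : 0 <= c0).
  unfold c0.
  assert (0 <= 2 * r * INR N * (2 * INR N + 1) ^ 2).
    repeat apply Rmult_le_pos; try lra; apply pow2_ge_0.
  assert (0 <= (6 + 2 * (2 * INR K + 1) ^ 3) * r ^ 2).
    apply Rmult_le_pos; auto; assert (0 <= (2 * INR K + 1) ^ 3) by (apply pow_le; lra); lra.
  lra.
exists (2 * c0); split; [lra|].
intros T V NLV U NLU n y HV HU Hr Hr' Hy s t Hs Ht.
assert (HT : 0 < T) by lra.
(* Chosen so that [rho = 2 r eps] satisfies [n * rho <= 1]. *)
set (eps := / (2 * (r + 1) * (INR n + 1))).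
assert (Hn0 := pos_INR n).
assert (Heps : 0 < eps) by (apply Rinv_0_lt_compat, Rmult_lt_0_compat; lra).
destruct (sol_tail _ _ _ HV eps Heps) as [m1 Hm1].
destruct (sol_tail _ _ _ HU eps Heps) as [m2 Hm2].
set (m := (m1 + m2 + 2 * n)%nat).
assert (HVt : forall t, l2 (tailZ m (V t)) eps).
  intros u; apply (l2_tail_mono m1); auto; unfold m; lia.
assert (HUt : forall t, l2 (tailZ m (U t)) eps).
  intros u; apply (l2_tail_mono m2); auto; unfold m; lia.
assert (Hmn : (2 * n <= m)%nat) by (unfold m; lia).
set (rho := 2 * r * eps).
assert (Hrho0 : 0 <= rho) by (unfold rho; apply Rmult_le_pos; lra).
assert (Hrho : INR n * rho <= 1).
  unfold rho, eps; apply Rmult_le_reg_r with ((r + 1) * (INR n + 1)); [apply Rmult_lt_0_compat; lra|].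
  replace (INR n * (2 * r * / (2 * (r + 1) * (INR n + 1))) * ((r + 1) * (INR n + 1))) with (INR n * r)
    by (field; lra); nra.
set (l := box m). assert (Hl : NoDup l) by apply NoDup_box.
set (Sm := fun t k => (V t k + U t k)%C) in *.
set (Sm' := fun t k => (dV NLV t k + dV NLU t k)%C).
(* [y] need not satisfy the reality condition. Its reflected conjugate solves the same equation
   because [S] does satisfy it, and [y_k z_{-k} = |y_k|^2]. *)
set (z := fun t k => Cconj (y t (- k)%Z)).
set (e := fun t => sqrt (mass n (y t))).
assert (Hee : forall t, e t ^ 2 = mass n (y t)).
  intros u; unfold e; rewrite pow2_sqrt; auto; apply mass_nonneg.
assert (e0 : forall t, 0 <= e t) by (intros; apply sqrt_pos).
assert (Sy := fl_supp _ _ _ _ Hy).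
assert (Sz : forall t k, ~ In k (box n) -> z t k = RtoC 0).
  intros u k Hk; unfold z; rewrite Sy; [apply Cconj_0|].
  intros Hk'; apply Hk; rewrite in_box in *; lia.
assert (My : forall u, l2le l (fun k => Cmod (y u k)) (e u)).
  intros u; split; [apply e0|split; [intros; apply Cmod_ge_0|]].
  rewrite Hee; unfold mass; rewrite <- (rsum_sub (box n) l); auto using NoDup_box; [lra|..].
    unfold l; apply incl_box; lia.
  intros k _ Hk; rewrite Sy, Cmod_0; auto; ring.
assert (Mz : forall u, l2le l (fun k => Cmod (z u k)) (e u)).
  intros u; split; [apply e0|split; [intros; apply Cmod_ge_0|]].
  destruct (My u) as (_ & _ & H); eapply Rle_trans; [|exact H].
  assert (Eo := rsum_box_opp m (fun k => Cmod (y u k) ^ 2)); fold l in Eo; rewrite <- Eo.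
  apply Req_le, rsum_ext; intros k _.
  unfold z; now rewrite Cmod_conj.
assert (HSl : forall u, l2 (Sm u) (2 * r)).
  intros u; replace (2 * r) with (r + r) by ring; now apply l2_plus.
set (y' := fun t k => (half_ik n k * conv l (Sm t) (y t) k t)%C).
set (z' := fun t k => (half_ik n k * conv l (Sm t) (z t) k t)%C).
assert (Dy : forall u k, 0 < u < T -> In k l -> Cder (fun v => y v k) u (y' u k)).
  intros u k Hu Hk; now apply (flow_der_box T n m Sm y).
assert (Dz : forall u k, 0 < u < T -> In k l -> Cder (fun v => z v k) u (z' u k)).
  intros u k Hu Hk; unfold z.
  eapply Cder_eq; [apply Cder_conj, Dy; auto; unfold l in *; rewrite in_box in *; lia|].
  unfold y', z', half_ik; rewrite !Cconj_mult; unfold l; rewrite conv_conj.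
  rewrite chi_opp, opp_IZR; f_equal.
    unfold Cconj, Cmult, RtoC, Ci; simpl; f_equal; field.
  apply conv_ext; intros a _; auto.
  unfold Sm; rewrite (sol_conj _ _ _ HV), (sol_conj _ _ _ HU).
  unfold Cconj, Cplus; simpl; destruct (V u a), (U u a); simpl; f_equal; ring.
assert (Bg : forall x u k, 0 < u < T -> l2le l (fun k => Cmod (x k)) (e u) ->
   Cmod (half_ik n k * conv l (Sm u) x k u) <= Rabs (IZR k) * (r * e u)).
  intros x u k Hu Hx; rewrite Cmod_mult.
  replace (Rabs (IZR k) * (r * e u)) with (Rabs (IZR k) / 2 * (2 * r * e u)) by field.
  apply Rmult_le_compat; try apply Cmod_ge_0; [apply Cmod_half_ik|].
  apply Cmod_conv; auto; now apply HSl.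
assert (Ry : forall u, 0 < u < T -> reg l y (y' u) u (e u) (r * e u)).
  intros u Hu; split; [apply My|split; [apply Rmult_le_pos; auto|]].
  intros k Hk; split; [now apply Dy|now apply Bg].
assert (Rz : forall u, 0 < u < T -> reg l z (z' u) u (e u) (r * e u)).
  intros u Hu; split; [apply Mz|split; [apply Rmult_le_pos; auto|]].
  intros k Hk; split; [now apply Dz|now apply Bg].
assert (RS : forall u, 0 < u < T -> reg l Sm (Sm' u) u (2 * r) (r ^ 2)).
  intros u Hu; split; [now apply HSl|split; auto].
  intros k Hk.
  destruct (proj2 (proj2 (reg_sol T V NLV r HV Hr l u Hl Hu)) k Hk) as [A1 A2].
  destruct (proj2 (proj2 (reg_sol T U NLU r HU Hr' l u Hl Hu)) k Hk) as [A3 A4].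
  split; [now apply Cder_plus|].
  unfold Sm'; eapply Rle_trans; [apply Cmod_triangle|]; lra.
assert (AV : forall u k, 0 < u < T -> Cmod (NLV u k - conv l (V u) (V u) k u)%C <= rho).
  intros u k Hu; now apply (NL_approx T V NLV r HV Hr).
assert (AU : forall u k, 0 < u < T -> Cmod (NLU u k - conv l (U u) (U u) k u)%C <= rho).
  intros u k Hu; now apply (NL_approx T U NLU r HU Hr').
destruct (energy_piece T r delta rho n m N K V NLV Sm Sm' y z e r0 HK HV Hr RS Ry Rz (Rlt_le _ _ Hdelta) HN'
   Hrho AV) as (HA & dHA & EA).
destruct (energy_piece T r delta rho n m N K U NLU Sm Sm' y z e r0 HK HU Hr' RS Ry Rz (Rlt_le _ _ Hdelta) HN'
   Hrho AU) as (HB & dHB & EB).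
set (F := fun X u => tri l (osc (fun a b c => RtoC (-3) * Ci * RtoC (IZR (a * b * c)) * w_energy N a b c)%C u)
       (cut (2 * n) X) (y u) (z u)).
set (Low := fun u => tri l (osc (fun a b c => if some_above2 N b c then RtoC 0 else Ci * RtoC (IZR a / 2))%C u)
   (Sm u) (y u) (z u)).
set (E := fun u => csum l (fun k => y u k * z u (- k)%Z)%C).
assert (HE : forall u, fst (E u) = e u ^ 2).
  intros u; rewrite Hee; unfold E, mass.
  rewrite (csum_ext _ _ (fun k => RtoC (Cmod (y u k) ^ 2))), csum_RtoC.
    simpl; apply rsum_sub; auto using NoDup_box; [unfold l; apply incl_box; lia|].
    intros k _ Hk; rewrite Sy, Cmod_0; auto; ring.
  intros k _; unfold z; now rewrite Z.opp_involutive, Cmod2_conj.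
(* The two slots contribute [-c/2] and [-b/2], which add up to [a/2]: the derivative moves from the
   flow onto the coefficient [S]. *)
assert (DE : forall u, 0 < u < T -> Cder E u (Low u + (F (V u) u + F (U u) u))%C).
  intros u Hu; eapply Cder_eq.
    apply Cder_csum; intros k Hk; apply Cder_mult; [now apply Dy|apply Dz; auto].
    unfold l in *; rewrite in_box in *; lia.
  cbv beta; rewrite csum_plus.
  assert (Eo := csum_box_opp m (fun k => (y u k * z' u (- k)%Z)%C)).
  fold l in Eo; rewrite <- Eo; clear Eo.
  rewrite (csum_ext l (fun a => (y u (- a)%Z * _)%C)
    (fun k => (half_ik n k * conv l (Sm u) (z u) k u) * y u (- k)%Z)%C).
    2:{ intros k _; rewrite Z.opp_involutive; unfold z'; ring. }
  unfold y', l; rewrite (tri_pair m (half_ik n)), (tri_pair m (half_ik n)); fold l.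
  rewrite (tri_swap23 l (osc _ u) (Sm u) (z u) (y u)).
  rewrite <- tri_plus_w.
  unfold F, Low.
  set (flux := osc (fun a b c => RtoC (-3) * Ci * RtoC (IZR (a * b * c)) * w_energy N a b c)%C u).
  transitivity (tri l (fun a b c => osc (fun a b c => if some_above2 N b c then RtoC 0 else Ci * RtoC (IZR a / 2)) u a b c
     + flux a b c)%C (Sm u) (y u) (z u)).
  2:{ rewrite tri_plus_w; f_equal; rewrite <- tri_plus_1.
      apply tri_ext; intros a b c Ha Hb Hc HSm.
      destruct (in_dec Z.eq_dec b (box n)) as [Hb'|Hb']; [|rewrite (Sy u b) by auto; ring].
      destruct (in_dec Z.eq_dec c (box n)) as [Hc'|Hc']; [|rewrite (Sz u c) by auto; ring].
      unfold cut; rewrite in_box in *.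
      destruct (Z.leb_spec (Z.abs a) (Z.of_nat (2 * n))); [|lia].
      unfold Sm; ring. }
  apply tri_ext; intros a b c Ha Hb Hc HSm.
  destruct (in_dec Z.eq_dec b (box n)) as [Hb'|Hb']; [|rewrite (Sy u b) by auto; ring].
  destruct (in_dec Z.eq_dec c (box n)) as [Hc'|Hc']; [|rewrite (Sz u c) by auto; ring].
  f_equal; unfold flux, osc.
  replace (- (3 * IZR a * IZR c * IZR b) * u) with (- (3 * IZR a * IZR b * IZR c) * u) by ring.
  set (ex := cexpi _).
  assert (Eg : forall k, In k (box n) -> half_ik n (- k)%Z = (Ci * RtoC (- IZR k / 2))%C).
    intros k Hk; apply in_box in Hk; unfold half_ik, chi; rewrite Z.abs_opp, opp_IZR.
    destruct (Z.leb_spec (Z.abs k) (Z.of_nat n)); [ring|lia].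
  rewrite (Eg b Hb'), (Eg c Hc').
  replace (Ci * RtoC (- IZR c / 2) * ex + Ci * RtoC (- IZR b / 2) * ex)%C with (Ci * RtoC (IZR a / 2) * ex)%C.
  2:{ replace (IZR a / 2) with (- IZR c / 2 + - IZR b / 2); [rewrite RtoC_plus; ring|].
      replace a with (- b - c)%Z by lia; rewrite minus_IZR, opp_IZR; field. }
  unfold w_energy; destruct (some_above2 N b c); [|ring].
  apply in_box_0 in Ha; apply in_box_0 in Hb; apply in_box_0 in Hc.
  replace (RtoC (-3) * Ci * RtoC (IZR (a * b * c)) * RtoC (- / 6 * / IZR (b * c)))%C with
   (Ci * RtoC (-3 * IZR (a * b * c) * (- / 6 * / IZR (b * c))))%C by (rewrite !RtoC_mult; ring).
  replace (-3 * IZR (a * b * c) * (- / 6 * / IZR (b * c))) with (IZR a / 2); [ring|].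
  rewrite !mult_IZR; field; split; now apply not_0_IZR.
(* Here [|b|, |c| <= N] forces [|a|/2 <= N], so a direct count suffices. *)
assert (BLow : forall u, Cmod (Low u) <= 2 * r * INR N * (2 * INR N + 1) ^ 2 * e u ^ 2).
  intros u; unfold Low; eapply Rle_trans; [apply Cmod_tri|].
  set (f := fun b : Z => if (Z.abs b <=? Z.of_nat N)%Z then e u else 0).
  assert (f0 : forall b, 0 <= f b) by (intros; unfold f; destruct (_ <=? _)%Z; auto; lra).
  apply Rle_trans with (tsum l (fun a b c => (2 * r * INR N) * (f b * f c))).
    apply tsum_le; intros a b c Ha Hb Hc HSm; rewrite Cmod_osc.
    assert (Hpos : 0 <= 2 * r * INR N * (f b * f c)) by (repeat apply Rmult_le_pos; auto; lra).
    destruct (some_above2 N b c) eqn:Eh; [rewrite Cmod_0; lra|].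
    unfold some_above2 in Eh; apply Bool.negb_false_iff, andb_prop in Eh; destruct Eh as [Eb Ec].
    unfold f; rewrite Eb, Ec; apply Z.leb_le in Eb; apply Z.leb_le in Ec.
    assert (HS1 : Cmod (Sm u a) <= 2 * r).
      apply (l2le_term l (fun k => Cmod (Sm u k))); auto; now apply HSl.
    assert (HS2 := l2le_term _ _ _ _ (My u) Hb). assert (HS3 := l2le_term _ _ _ _ (Mz u) Hc).
    assert (Ha2 : Rabs (IZR a) <= 2 * INR N).
      rewrite <- abs_IZR, INR_IZR_INZ, <- mult_IZR; apply IZR_le; lia.
    rewrite Cmod_mult, Cmod_Ci, Rmult_1_l, Cmod_R; unfold Rdiv.
    rewrite Rabs_mult, (Rabs_pos_eq (/ 2)) by lra.
    replace (2 * r * INR N * (e u * e u)) with (INR N * (2 * r * e u * e u)) by ring.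
    apply Rmult_le_compat; try lra.
      apply Rmult_le_pos; [apply Rabs_pos|lra].
      repeat apply Rmult_le_pos; apply Cmod_ge_0.
    apply Rmult_le_compat; auto; try apply Cmod_ge_0.
      apply Rmult_le_pos; apply Cmod_ge_0.
    apply Rmult_le_compat; auto; apply Cmod_ge_0.
  assert (Sf : rsum l f <= (2 * INR N + 1) * e u) by now apply rsum_count.
  eapply Rle_trans; [apply (tsum_free_1 l f f (2 * r * INR N) ((2 * INR N + 1) * e u) ((2 * INR N + 1) * e u)); auto|].
    repeat apply Rmult_le_pos; lra.
    apply Rmult_le_pos; auto; lra.
  apply Req_le; ring.
set (h := fun u => fst (E u) - fst (HA u) - fst (HB u)).
set (dh := fun u => fst (Low u + ((F (V u) u - dHA u) + (F (U u) u - dHB u)))%C).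
assert (HKr : 320 / INR K * r ^ 2 <= / 8).
  assert (K0 : 0 < INR K) by now apply lt_0_INR.
  apply Rmult_le_reg_r with (INR K); auto.
  replace (320 / INR K * r ^ 2 * INR K) with (320 * r ^ 2) by (field; lra); lra.
assert (Hdr : 2 / 3 * r * delta <= / 8).
  unfold delta; apply Rmult_le_reg_r with (r + 1); [lra|].
  replace (2 / 3 * r * (3 / (16 * (r + 1))) * (r + 1)) with (r / 8) by (field; lra); lra.
assert (Hh : forall u, 0 < u < T -> Rabs (h u - e u ^ 2) <= / 2 * e u ^ 2).
  intros u Hu; unfold h; rewrite HE.
  destruct (EA u Hu) as (_ & _ & B1), (EB u Hu) as (_ & _ & B2).
  replace (e u ^ 2 - fst (HA u) - fst (HB u) - e u ^ 2) with (- (fst (HA u) + fst (HB u))) by ring.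
  rewrite Rabs_Ropp; eapply Rle_trans; [apply Rabs_triang|].
  assert (C1 := re_le_Cmod (HA u)). assert (C2 := re_le_Cmod (HB u)). unfold Re in C1, C2.
  assert (Hq := pow2_ge_0 (e u)).
  assert ((2 / 3 * r * delta + 320 / INR K * r ^ 2) * e u ^ 2 <= / 4 * e u ^ 2).
    apply Rmult_le_compat_r; auto; lra.
  lra.
assert (Hdh : forall u, 0 < u < T -> is_derive h u (dh u) /\ Rabs (dh u) <= 2 * c0 * h u).
  intros u Hu; destruct (EA u Hu) as (D1 & B1 & _), (EB u Hu) as (D2 & B2 & _).
  split.
    unfold h, dh.
    replace (fst _) with (minus (minus (fst (Low u + (F (V u) u + F (U u) u))%C) (fst (dHA u))) (fst (dHB u)))
      by (unfold minus, plus, opp; simpl; ring).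
    apply @is_derive_minus; [apply @is_derive_minus|].
      now apply DE. apply D1. apply D2.
  assert (Hhu := Hh u Hu); apply Rabs_le_between in Hhu.
  apply Rle_trans with (c0 * e u ^ 2); [|nra].
  unfold dh; eapply Rle_trans; [apply re_le_Cmod|].
  eapply Rle_trans; [apply Cmod_triangle|].
  eapply Rle_trans; [apply Rplus_le_compat_l, Cmod_triangle|].
  specialize (BLow u); unfold c0.
  change (Cmod (F (V u) u - dHA u) <= (5 * (6 + 2 * (2 * INR K + 1) ^ 3) * r ^ 2 + 240 * r ^ 3 + 1) * e u ^ 2) in B1.
  change (Cmod (F (U u) u - dHB u) <= (5 * (6 + 2 * (2 * INR K + 1) ^ 3) * r ^ 2 + 240 * r ^ 3 + 1) * e u ^ 2) in B2.
  lra.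
assert (Hg := gronwall T h dh (2 * c0) s t Hdh ltac:(lra) Hs Ht).
assert (H1 := Hh s Hs); assert (H2 := Hh t Ht).
apply Rabs_le_between in H1; apply Rabs_le_between in H2.
rewrite <- !Hee.
assert (Hexp := exp_pos (2 * c0 * T)).
assert (exp (2 * c0 * T) * h s <= exp (2 * c0 * T) * (3 / 2 * e s ^ 2)).
  apply Rmult_le_compat_l; lra.
lra.
Qed.

(** * Linear ordinary differential equations *)

Lemma continuous_rsum {A} (l : list A) (f : A -> R -> R) t :
  (forall a, In a l -> continuous (f a) t) -> continuous (fun s => rsum l (fun a => f a s)) t.
Proof.
induction l as [|a l IH]; simpl; intros H; [apply continuous_const|].
apply (continuous_plus (f a)); auto.
Qed.

Lemma Rabs_rsum {A} (l : list A) f : Rabs (rsum l f) <= rsum l (fun a => Rabs (f a)).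
Proof.
induction l as [|a l IH]; simpl; [rewrite Rabs_R0; lra|].
eapply Rle_trans; [apply Rabs_triang|lra].
Qed.

Lemma continuous_Rmult (f g : R -> R) t : continuous f t -> continuous g t ->
  continuous (fun s => f s * g s) t.
Proof. exact (continuous_mult f g t). Qed.

Lemma is_derive_RInt_cont (f : R -> R) t0 c t :
  (forall s, continuous f s) -> is_derive (fun s => c + RInt f t0 s) t (f t).
Proof.
intros Hf; replace (f t) with (plus 0 (f t)) by (unfold plus; simpl; ring).
apply @is_derive_plus; [apply @is_derive_const|].
apply (is_derive_RInt f _ t0); auto.
apply filter_forall; intros s; apply @RInt_correct, @ex_RInt_continuous; auto.
Qed.

Section Picard.
Variables (A : Type) (l : list A) (a : A -> A -> R -> R) (K t0 : R) (h : A -> R).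
Hypotheses (Ha : forall i j t, continuous (a i j) t) (HK : forall i j t, Rabs (a i j t) <= K).

Fixpoint picard (k : nat) (i : A) (t : R) : R :=
  match k with
  | O => h i
  | S k => h i + RInt (fun s => rsum l (fun j => a i j s * picard k j s)) t0 t
  end.

Let L := INR (length l).
Let H := rsum l (fun j => Rabs (h j)).
Let c := 2 * (K * L) + 1.
(* The weight [cosh (c (t - t0))] makes the Picard map a contraction on both sides of [t0]. *)
Let E t := exp (c * (t - t0)) + exp (- c * (t - t0)).

Lemma K_nonneg : l <> nil -> 0 <= K.
Proof.
destruct l as [|j l']; [tauto|]; intros _.
eapply Rle_trans; [apply Rabs_pos|apply (HK j j 0)].
Qed.

Lemma KL_nonneg : 0 <= K * L.
Proof.
unfold L; destruct l as [|j l'] eqn:El; [simpl; lra|].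
apply Rmult_le_pos; [apply K_nonneg; congruence|apply pos_INR].
Qed.

Lemma E_ge_1 t : 1 <= E t.
Proof.
unfold E; assert (H1 := exp_pos (c * (t - t0))); assert (H2 := exp_pos (- c * (t - t0))).
destruct (Rle_dec 0 (c * (t - t0))) as [H0|H0].
  assert (1 + c * (t - t0) <= exp (c * (t - t0))) by apply exp_ineq1_le; lra.
assert (1 + - c * (t - t0) <= exp (- c * (t - t0))) by apply exp_ineq1_le; lra.
Qed.

Lemma E_continuous t : continuous E t.
Proof.
apply (ex_derive_continuous E); unfold E; auto_derive; auto.
Qed.

(** [P] is the primitive of [B * E] that vanishes at [t0], a multiple of [sinh (c (t - t0))], and
    [|sinh| <= cosh]. *)
Lemma RInt_weight f B t :
  0 <= B -> (forall s, continuous f s) -> (forall s, Rabs (f s) <= B * E s) ->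
  Rabs (RInt f t0 t) <= B / c * E t.
Proof.
intros HB Hf Hb.
assert (Hc : 0 < c) by (generalize KL_nonneg; unfold c; lra).
set (P := fun s => B / c * (exp (c * (s - t0)) - exp (- c * (s - t0)))).
assert (HP : forall s, is_derive P s (B * E s)).
  intros s; unfold P, E; auto_derive; auto; unfold Rminus; field; lra.
assert (HE : forall s, continuous (fun s => B * E s) s).
  intros s; apply continuous_Rmult; [apply continuous_const|apply E_continuous].
assert (HPI : forall x y, is_RInt (fun s => B * E s) x y (P y - P x)).
  intros x y; apply (is_RInt_derive P); auto.
assert (HfI : forall x y, is_RInt f x y (RInt f x y)).
  intros x y; apply @RInt_correct, @ex_RInt_continuous; auto.
assert (P0 : P t0 = 0) by (unfold P; rewrite !Rminus_diag, !Rmult_0_r; ring).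
assert (HPt : Rabs (P t) <= B / c * E t).
  unfold P; rewrite Rabs_mult, (Rabs_pos_eq (B / c)) by (apply Rdiv_le_0_compat; auto).
  apply Rmult_le_compat_l; [apply Rdiv_le_0_compat; auto|].
  unfold E; generalize (exp_pos (c * (t - t0))) (exp_pos (- c * (t - t0))); intros.
  apply Rabs_le; lra.
destruct (Rle_dec t0 t) as [Ht|Ht].
  assert (N := norm_RInt_le f (fun s => B * E s) t0 t _ _ Ht (fun s _ => Hb s) (HfI t0 t) (HPI t0 t)).
  unfold norm in N; simpl in N; unfold abs in N; simpl in N.
  generalize (Rle_abs (P t)); lra.
assert (Ht' : t <= t0) by lra.
assert (N := norm_RInt_le f (fun s => B * E s) t t0 _ _ Ht' (fun s _ => Hb s) (HfI t t0) (HPI t t0)).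
unfold norm in N; simpl in N; unfold abs in N; simpl in N.
rewrite <- (opp_RInt_swap f) in N by (eexists; apply HfI).
unfold opp in N; simpl in N; rewrite Rabs_Ropp in N.
generalize (Rle_abs (- P t)); rewrite Rabs_Ropp; lra.
Qed.

Lemma picard_continuous k i t : continuous (picard k i) t.
Proof.
revert i t; induction k as [|k IH]; intros i t; [apply continuous_const|].
apply (ex_derive_continuous (picard (S k) i)); eexists; simpl; apply is_derive_RInt_cont.
intros s; apply continuous_rsum; intros j _; now apply continuous_Rmult.
Qed.

Lemma sum_weight (x : A -> R) i t B : 0 <= B -> (forall j, In j l -> Rabs (x j) <= B * E t) ->
  Rabs (rsum l (fun j => a i j t * x j)) <= K * L * B * E t.
Proof.
intros HB Hx.
eapply Rle_trans; [apply Rabs_rsum|].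
apply Rle_trans with (rsum l (fun _ => K * (B * E t))).
  apply rsum_le; intros j Hj; rewrite Rabs_mult; apply Rmult_le_compat; auto; apply Rabs_pos.
rewrite rsum_const; fold L; apply Req_le; ring.
Qed.

(** One integration multiplies a bound relative to [E] by [K L / c], and [c = 2 K L + 1] makes this
    at most one half. *)
Lemma picard_step k i t : Rabs (picard (S k) i t - picard k i t) <= H * (/ 2) ^ k * E t.
Proof.
assert (H0 : 0 <= H) by (apply rsum_nonneg; intros; apply Rabs_pos).
assert (Hc := KL_nonneg).
assert (Hhalf : forall B, 0 <= B -> K * L * B / c <= B * / 2).
  intros B HB; unfold c; apply Rmult_le_reg_r with (2 * (K * L) + 1); [lra|].
  replace (K * L * B / (2 * (K * L) + 1) * (2 * (K * L) + 1)) with (K * L * B) by (field; lra); nra.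
revert i t; induction k as [|k IH]; intros i t.
  assert (Ed : forall x y : R, x + y - x = y) by (intros; ring).
  cbn [picard]; rewrite Ed.
  eapply Rle_trans; [apply (RInt_weight _ (K * L * H))|].
  - apply Rmult_le_pos; auto.
  - intros s; apply continuous_rsum; intros j _; apply continuous_Rmult; auto; apply continuous_const.
  - intros s; apply sum_weight; auto; intros j Hj.
    apply Rle_trans with (H * 1).
      rewrite Rmult_1_r; apply (rsum_ge_term l (fun j => Rabs (h j))); auto; intros; apply Rabs_pos.
    apply Rmult_le_compat_l; auto; apply E_ge_1.
  - apply Rmult_le_compat_r; [generalize (E_ge_1 t); lra|].
    specialize (Hhalf H H0); simpl; lra.
change (Rabs ((h i + RInt (fun s => rsum l (fun j => a i j s * picard (S k) j s)) t0 t) -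
  (h i + RInt (fun s => rsum l (fun j => a i j s * picard k j s)) t0 t)) <= H * (/ 2) ^ S k * E t).
set (f := fun k s => rsum l (fun j => a i j s * picard k j s)).
assert (Hf : forall k s, continuous (f k) s).
  intros k' s; apply continuous_rsum; intros j _; apply continuous_Rmult; auto; apply picard_continuous.
assert (HI : forall k, ex_RInt (f k) t0 t) by (intros; apply @ex_RInt_continuous; auto).
replace (_ - _) with (RInt (fun s => f (S k) s - f k s) t0 t).
2:{ assert (Es : forall x y z : R, y - z = (x + y) - (x + z)) by (intros; ring).
    transitivity (RInt (f (S k)) t0 t - RInt (f k) t0 t); [|apply Es].
    apply (RInt_minus (f (S k)) (f k)); auto. }
assert (HB : 0 <= H * (/ 2) ^ k) by (apply Rmult_le_pos; auto; apply pow_le; lra).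
eapply Rle_trans; [apply (RInt_weight _ (K * L * (H * (/ 2) ^ k)))|].
- apply Rmult_le_pos; auto.
- intros s; apply (continuous_minus (f (S k)) (f k)); auto.
- intros s; unfold f.
  replace (_ - _) with (rsum l (fun j => a i j s * (picard (S k) j s - picard k j s))).
    now apply sum_weight.
  rewrite (rsum_ext l _ (fun j => a i j s * picard (S k) j s + -1 * (a i j s * picard k j s)))
    by (intros; ring).
  rewrite rsum_plus, rsum_scal; ring.
- apply Rmult_le_compat_r; [generalize (E_ge_1 t); lra|].
  specialize (Hhalf _ HB); simpl; lra.
Qed.

Lemma picard_far k p i t :
  Rabs (picard (k + p) i t - picard k i t) <= 2 * H * (/ 2) ^ k * E t * (1 - (/ 2) ^ p).
Proof.
induction p as [|p IH].
  rewrite Nat.add_0_r, Rminus_diag, Rabs_R0; simpl; lra.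
rewrite Nat.add_succ_r.
replace (_ - _) with ((picard (S (k + p)) i t - picard (k + p) i t) + (picard (k + p) i t - picard k i t)) by ring.
eapply Rle_trans; [apply Rabs_triang|].
assert (Hs := picard_step (k + p) i t); rewrite pow_add in Hs.
change ((/ 2) ^ S p) with (/ 2 * (/ 2) ^ p); lra.
Qed.

Definition picard_lim (i : A) (t : R) : R := real (Lim_seq (fun k => picard k i t)).

Lemma picard_limP i t : is_lim_seq (fun k => picard k i t) (picard_lim i t).
Proof.
apply Lim_seq_correct'.
apply ex_lim_seq_cauchy_corr; intros eps.
assert (H0 : 0 <= H) by (apply rsum_nonneg; intros; apply Rabs_pos).
assert (HE := E_ge_1 t).
set (B := 2 * H * E t).
assert (HB : 0 <= B) by (unfold B; repeat apply Rmult_le_pos; lra).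
destruct (pow_lt_1_zero (/ 2)) with (y := eps / (2 * (B + 1))) as [N HN].
  rewrite Rabs_pos_eq; lra.
  apply Rdiv_lt_0_compat; [apply cond_pos|lra].
assert (HNN : 2 * B * (/ 2) ^ N < eps).
  specialize (HN N (le_n _)); rewrite Rabs_pos_eq in HN by (apply pow_le; lra).
  apply (Rmult_lt_compat_r (2 * (B + 1))) in HN; [|lra].
  replace (eps / (2 * (B + 1)) * (2 * (B + 1))) with (pos eps) in HN by (field; lra).
  assert (0 < (/ 2) ^ N) by (apply pow_lt; lra); lra.
assert (Hfar : forall n, (N <= n)%nat -> Rabs (picard n i t - picard N i t) <= B * (/ 2) ^ N).
  intros n Hn; replace n with (N + (n - N))%nat by lia.
  eapply Rle_trans; [apply picard_far|].
  replace (2 * H * (/ 2) ^ N * E t) with (B * (/ 2) ^ N) by (unfold B; ring).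
  assert (0 < (/ 2) ^ (n - N)) by (apply pow_lt; lra).
  assert (0 <= B * (/ 2) ^ N) by (apply Rmult_le_pos; auto; apply pow_le; lra).
  nra.
exists N; intros n m Hn Hm.
replace (picard n i t - picard m i t) with
  ((picard n i t - picard N i t) - (picard m i t - picard N i t)) by ring.
eapply Rle_lt_trans; [apply Rabs_triang|]; rewrite Rabs_Ropp.
generalize (Hfar n Hn) (Hfar m Hm); lra.
Qed.

Lemma picard_lim_far k i t : Rabs (picard_lim i t - picard k i t) <= 2 * H * (/ 2) ^ k * E t.
Proof.
assert (H0 : 0 <= H) by (apply rsum_nonneg; intros; apply Rabs_pos).
assert (HE := E_ge_1 t).
assert (HB : 0 <= 2 * H * (/ 2) ^ k * E t).
  repeat apply Rmult_le_pos; try lra; apply pow_le; lra.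
assert (Hl : is_lim_seq (fun p => Rabs (picard (p + k) i t - picard k i t))
   (Rabs (picard_lim i t - picard k i t))).
  apply (is_lim_seq_abs _ (Finite (picard_lim i t - picard k i t))).
  apply is_lim_seq_minus'; [|apply is_lim_seq_const].
  now apply (is_lim_seq_incr_n (fun p => picard p i t)), picard_limP.
refine (is_lim_seq_le _ _ _ (Finite (2 * H * (/ 2) ^ k * E t)) _ Hl (is_lim_seq_const _)).
intros p; cbv beta; rewrite Nat.add_comm; eapply Rle_trans; [apply picard_far|].
assert (0 < (/ 2) ^ p) by (apply pow_lt; lra); nra.
Qed.

Lemma small_half B eps : 0 <= B -> 0 < eps -> exists k, B * (/ 2) ^ k < eps.
Proof.
intros HB He.
destruct (pow_lt_1_zero (/ 2)) with (y := eps / (B + 1)) as [N HN].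
  rewrite Rabs_pos_eq; lra.
  apply Rdiv_lt_0_compat; lra.
exists N; specialize (HN N (le_n _)); rewrite Rabs_pos_eq in HN by (apply pow_le; lra).
apply (Rmult_lt_compat_r (B + 1)) in HN; [|lra].
replace (eps / (B + 1) * (B + 1)) with eps in HN by (field; lra).
assert (0 < (/ 2) ^ N) by (apply pow_lt; lra); lra.
Qed.

Lemma picard_lim_continuous i t : continuous (picard_lim i) t.
Proof.
assert (H0 : 0 <= H) by (apply rsum_nonneg; intros; apply Rabs_pos).
assert (HE := E_ge_1 t).
apply (filterlim_locally (picard_lim i)); intros eps.
destruct (small_half (2 * H * (2 * E t + 1)) (eps / 2)) as [k Hk].
  apply Rmult_le_pos; lra.
  generalize (cond_pos eps); lra.
assert (He2 : 0 < eps / 2) by (generalize (cond_pos eps); lra).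
assert (L1 := proj1 (filterlim_locally _ _) (E_continuous t) (mkposreal 1 Rlt_0_1)).
assert (L2 := proj1 (filterlim_locally _ _) (picard_continuous k i t) (mkposreal _ He2)).
generalize (filter_and _ _ L1 L2); apply filter_imp; intros s [B1 B2].
unfold ball in *; simpl in *; unfold AbsRing_ball, abs, minus, plus, opp in *; simpl in *.
replace (picard_lim i s + - picard_lim i t) with
  ((picard_lim i s - picard k i s) + ((picard k i s + - picard k i t) - (picard_lim i t - picard k i t))) by ring.
eapply Rle_lt_trans; [apply Rabs_triang|].
eapply Rle_lt_trans; [apply Rplus_le_compat_l, Rabs_triang|]; rewrite Rabs_Ropp.
assert (F1 := picard_lim_far k i s); assert (F2 := picard_lim_far k i t).
assert (HEs : E s <= E t + 1) by (apply Rabs_def2 in B1; lra).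
assert (Hp : 0 < (/ 2) ^ k) by (apply pow_lt; lra).
assert (2 * H * (/ 2) ^ k * E s <= 2 * H * (/ 2) ^ k * (E t + 1)).
  apply Rmult_le_compat_l; auto; apply Rmult_le_pos; lra.
replace (2 * H * (2 * E t + 1) * (/ 2) ^ k) with (2 * H * (/ 2) ^ k * (E t + 1) + 2 * H * (/ 2) ^ k * E t) in Hk by ring.
lra.
Qed.

Lemma picard_lim_eq i t :
  picard_lim i t = h i + RInt (fun s => rsum l (fun j => a i j s * picard_lim j s)) t0 t.
Proof.
assert (H0 : 0 <= H) by (apply rsum_nonneg; intros; apply Rabs_pos).
assert (HE := E_ge_1 t); assert (Hc := KL_nonneg).
apply Rminus_diag_uniq.
set (f := fun s => rsum l (fun j => a i j s * picard_lim j s)).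
set (g := fun k s => rsum l (fun j => a i j s * picard k j s)).
assert (Hf : forall s, continuous f s).
  intros s; apply continuous_rsum; intros j _; apply continuous_Rmult; auto; apply picard_lim_continuous.
assert (Hg : forall k s, continuous (g k) s).
  intros k s; apply continuous_rsum; intros j _; apply continuous_Rmult; auto; apply picard_continuous.
assert (Hall : forall k, Rabs (picard_lim i t - (h i + RInt f t0 t)) <= 4 * H * E t * (/ 2) ^ k).
  intros k.
  assert (Hp : 0 < (/ 2) ^ k) by (apply pow_lt; lra).
  replace (picard_lim i t - (h i + RInt f t0 t)) with
    ((picard_lim i t - picard (S k) i t) - RInt (fun s => f s - g k s) t0 t).
  2:{ replace (RInt (fun s => f s - g k s) t0 t) with (RInt f t0 t - RInt (g k) t0 t).
        change (picard (S k) i t) with (h i + RInt (g k) t0 t); ring.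
      symmetry; apply (RInt_minus f (g k)); apply @ex_RInt_continuous; auto. }
  eapply Rle_trans; [apply Rabs_triang|]; rewrite Rabs_Ropp.
  assert (HB : 0 <= 2 * H * (/ 2) ^ k) by (apply Rmult_le_pos; lra).
  assert (I : Rabs (RInt (fun s => f s - g k s) t0 t) <= K * L * (2 * H * (/ 2) ^ k) / c * E t).
    apply RInt_weight.
    - apply Rmult_le_pos; auto.
    - intros s; apply (continuous_minus f (g k)); auto.
    - intros s; unfold f, g.
      replace (_ - _) with (rsum l (fun j => a i j s * (picard_lim j s - picard k j s))).
        apply sum_weight; auto; intros j _; apply picard_lim_far.
      rewrite (rsum_ext l _ (fun j => a i j s * picard_lim j s + -1 * (a i j s * picard k j s)))
        by (intros; ring).
      rewrite rsum_plus, rsum_scal; ring.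
  assert (Hhalf : K * L * (2 * H * (/ 2) ^ k) / c <= 2 * H * (/ 2) ^ k).
    unfold c; apply Rmult_le_reg_r with (2 * (K * L) + 1); [lra|].
    replace (K * L * (2 * H * (/ 2) ^ k) / (2 * (K * L) + 1) * (2 * (K * L) + 1)) with
      (K * L * (2 * H * (/ 2) ^ k)) by (field; lra); nra.
  assert (F := picard_lim_far (S k) i t); simpl pow in F.
  assert (K * L * (2 * H * (/ 2) ^ k) / c * E t <= 2 * H * (/ 2) ^ k * E t).
    apply Rmult_le_compat_r; lra.
  assert (0 <= H * (/ 2) ^ k * E t) by (repeat apply Rmult_le_pos; lra).
  lra.
apply Rabs_eq_0; apply Rle_antisym; [|apply Rabs_pos].
apply le_epsilon; intros eps Heps.
destruct (small_half (4 * H * E t) eps) as [k Hk]; auto.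
  repeat apply Rmult_le_pos; lra.
specialize (Hall k); lra.
Qed.

(** Bounded coefficients give a solution on the whole line with data at any [t0]; the duality
    argument prescribes data at the later time and looks backwards. *)
Lemma linear_ode : exists x : A -> R -> R, (forall i, x i t0 = h i) /\
  forall i t, is_derive (x i) t (rsum l (fun j => a i j t * x j t)).
Proof.
exists picard_lim; split.
  intros i; rewrite picard_lim_eq, RInt_point; unfold zero; simpl; ring.
intros i t.
apply (is_derive_ext (fun t => h i + RInt (fun s => rsum l (fun j => a i j s * picard_lim j s)) t0 t)).
  intros s; symmetry; apply picard_lim_eq.
apply (is_derive_RInt_cont (fun s => rsum l (fun j => a i j s * picard_lim j s))).
intros s; apply continuous_rsum; intros j _; apply continuous_Rmult; auto; apply picard_lim_continuous.
Qed.
End Picard.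

(** * Duality and interpolation for the truncated flow *)

Definition Ccont (f : R -> C) (t : R) : Prop :=
  continuous (fun s => fst (f s)) t /\ continuous (fun s => snd (f s)) t.

Lemma Ccont_const c t : Ccont (fun _ => c) t.
Proof. split; apply continuous_const. Qed.

Lemma Ccont_plus f g t : Ccont f t -> Ccont g t -> Ccont (fun s => f s + g s)%C t.
Proof.
intros [H1 H2] [H3 H4]; split; simpl.
- exact (continuous_plus (fun s => fst (f s)) (fun s => fst (g s)) t H1 H3).
- exact (continuous_plus (fun s => snd (f s)) (fun s => snd (g s)) t H2 H4).
Qed.

Lemma Ccont_mult f g t : Ccont f t -> Ccont g t -> Ccont (fun s => f s * g s)%C t.
Proof.
intros [H1 H2] [H3 H4]; split; simpl.
- apply (continuous_minus (fun s => fst (f s) * fst (g s)) (fun s => snd (f s) * snd (g s)));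
    now apply continuous_Rmult.
- apply (continuous_plus (fun s => fst (f s) * snd (g s)) (fun s => snd (f s) * fst (g s)));
    now apply continuous_Rmult.
Qed.

Lemma Ccont_csum {A} (l : list A) (f : A -> R -> C) t :
  (forall a, In a l -> Ccont (f a) t) -> Ccont (fun s => csum l (fun a => f a s)) t.
Proof.
induction l as [|a l IH]; simpl; intros H; [apply Ccont_const|].
apply Ccont_plus; auto.
Qed.

Lemma Cder_cont f t d : Cder f t d -> Ccont f t.
Proof.
intros [H1 H2]; split.
- apply (ex_derive_continuous (fun s => fst (f s))); eexists; eauto.
- apply (ex_derive_continuous (fun s => snd (f s))); eexists; eauto.
Qed.

Lemma Ccont_cexpi c t : Ccont (fun s => cexpi (c * s)) t.
Proof. eapply Cder_cont, Cder_cexpi. Qed.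

Lemma Ccont_ext f g t : (forall s, f s = g s) -> Ccont f t -> Ccont g t.
Proof.
intros E [H1 H2]; split;
  [apply (continuous_ext (fun s => fst (f s)))|apply (continuous_ext (fun s => snd (f s)))]; auto;
  intros s; now rewrite E.
Qed.

Lemma Ccont_cmod2 f t : Ccont f t -> continuous (fun s => Cmod (f s) ^ 2) t.
Proof.
intros [H1 H2].
apply (continuous_ext (fun s => fst (f s) * fst (f s) + snd (f s) * snd (f s))).
  intros s; rewrite Cmod2_alt; unfold Re, Im; simpl; now rewrite !Rmult_1_r.
apply (continuous_plus (fun s => fst (f s) * fst (f s)) (fun s => snd (f s) * snd (f s)));
  now apply continuous_Rmult.
Qed.

(** The equations hold only inside [(0,T)]; continuity carries the estimates to the end points. *)
Lemma closed_bound T (f : R -> R) c :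
  0 < T -> (forall t, continuous f t) -> (forall t, 0 < t < T -> f t <= c) ->
  forall t, 0 <= t <= T -> f t <= c.
Proof.
intros HT Hf Hc t Ht; apply Rnot_lt_le; intros Hlt.
assert (He : 0 < f t - c) by lra.
assert (HL := proj1 (filterlim_locally _ _) (Hf t) (mkposreal _ He)).
destruct HL as [d Hd].
assert (Hd0 := cond_pos d).
set (q := Rmin (d / 2) (T / 4)).
assert (Hq : 0 < q <= d / 2 /\ q <= T / 4).
  unfold q; generalize (Rmin_l (d / 2) (T / 4)) (Rmin_r (d / 2) (T / 4)); intros.
  assert (0 < Rmin (d / 2) (T / 4)) by (apply Rmin_case; lra); lra.
assert (Hex : exists s, 0 < s < T /\ Rabs (s - t) < d).
  destruct (Rle_dec t (T / 2)); [exists (t + q)|exists (t - q)]; split; try lra; apply Rabs_def1; lra.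
destruct Hex as (s & Hs & Hsd).
specialize (Hd s Hsd); specialize (Hc s Hs).
unfold ball in Hd; simpl in Hd; unfold AbsRing_ball, abs, minus, plus, opp in Hd; simpl in Hd.
apply Rabs_def2 in Hd; lra.
Qed.

Lemma closed_bound2 T (f g : R -> R) :
  0 < T -> (forall t, continuous f t) -> (forall t, continuous g t) ->
  (forall s t, 0 < s < T -> 0 < t < T -> f t <= g s) ->
  forall s t, 0 <= s <= T -> 0 <= t <= T -> f t <= g s.
Proof.
intros HT Hf Hg H s t Hs Ht.
apply (closed_bound T f); auto; clear t Ht; intros t Ht.
assert (E : - g s <= - f t); [|lra].
apply (closed_bound T (fun s => - g s)); auto.
  intros u; apply (continuous_opp g); auto.
intros u Hu; specialize (H u t Hu Ht); lra.
Qed.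

Lemma mass_continuous n (y : R -> Z -> C) :
  (forall k t, Ccont (fun s => y s k) t) -> forall t, continuous (fun s => mass n (y s)) t.
Proof. intros H t; apply continuous_rsum; intros k _; now apply Ccont_cmod2. Qed.

(** The symplectic form of KdV, truncated: [d/dx] is inverted in one argument, and no conjugate is
    taken. *)
Definition sympl (n : nat) (x y : Z -> C) : C :=
  csum (box n) (fun k => x k * y (- k)%Z * RtoC (/ IZR k))%C.

Lemma sympl_cont n (x y : R -> Z -> C) :
  (forall k t, Ccont (fun s => x s k) t) -> (forall k t, Ccont (fun s => y s k) t) ->
  forall t, Ccont (fun s => sympl n (x s) (y s)) t.
Proof.
intros Hx Hy t; apply Ccont_csum; intros k _; apply Ccont_mult; [|apply Ccont_const].
now apply Ccont_mult.
Qed.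

Definition flow_coef (n : nat) (S : R -> Z -> C) (k b : Z) (t : R) : C :=
  if mem (box n) k then
    (Ci * RtoC (IZR k / 2) * csum (box (2 * n)) (fun a =>
      if (a + b =? k)%Z then cexpi (3 * IZR k * IZR a * IZR b * t) * S t a else RtoC 0))%C
  else RtoC 0.

Lemma flow_coef_conv n S y k t : In k (box n) -> (forall b, ~ In b (box n) -> y b = RtoC 0) ->
  csum (box n) (fun b => flow_coef n S k b t * y b)%C =
  (Ci * RtoC (IZR k / 2) * conv (box (2 * n)) (S t) y k t)%C.
Proof.
intros Hk Hy; apply memP in Hk; unfold flow_coef, conv; rewrite Hk.
rewrite csum_exchange, (csum_sub (box n) (box (2 * n))); try apply NoDup_box; [|apply incl_box; lia|].
  rewrite <- csum_scal; apply csum_ext; intros b _.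
  rewrite <- Cmult_assoc, <- csum_scal_r; f_equal; apply csum_ext; intros a _.
  destruct (_ =? _)%Z; ring.
intros b _ Hb; rewrite (csum_ext _ _ (fun _ => RtoC 0)), csum_0; auto.
intros a _; rewrite (Hy b Hb); destruct (_ =? _)%Z; ring.
Qed.

Lemma csum_parts {A} (l : list A) f :
  csum l f = (rsum l (fun a => fst (f a)), rsum l (fun a => snd (f a))).
Proof. induction l as [|a l IH]; simpl; auto; now rewrite IH. Qed.

(** Complex modes become pairs of real unknowns, tagged by a boolean ([true] for the real part); [a]
    is the real two by two block of multiplication by [flow_coef], bounded since only finitely many
    modes enter. *)
Lemma flow_exists T n (S : R -> Z -> C) m t0 h :
  (forall k t, Ccont (fun s => S s k) t) -> (forall t, l2 (S t) m) ->
  (forall k, ~ In k (box n) -> h k = RtoC 0) ->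
  exists y, flow T n S y /\ forall k, y t0 k = h k.
Proof.
intros HSc HSb Hh.
assert (m0 : 0 <= m) by exact (proj1 (HSb 0 nil (NoDup_nil _))).
set (a := fun (i j : Z * bool) t =>
  let M := flow_coef n S (fst i) (fst j) t in
  match snd i, snd j with
  | true, true => fst M | true, false => - snd M
  | false, true => snd M | false, false => fst M end).
assert (Mc : forall k b t, Ccont (flow_coef n S k b) t).
  intros k b t; unfold flow_coef; destruct (mem _ _); [|apply Ccont_const].
  apply Ccont_mult; [apply Ccont_const|apply Ccont_csum; intros x _].
  destruct (_ =? _)%Z; [|apply Ccont_const].
  apply Ccont_mult; [apply Ccont_cexpi|apply HSc].
assert (Mb : forall k b t, Cmod (flow_coef n S k b t) <= INR n * (INR (length (box (2 * n))) * m)).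
  intros k b t; unfold flow_coef.
  assert (Hp : 0 <= INR n * (INR (length (box (2 * n))) * m)).
    repeat apply Rmult_le_pos; auto; apply pos_INR.
  destruct (mem (box n) k) eqn:Hk; [|rewrite Cmod_0; auto].
  apply memP, in_box in Hk.
  rewrite !Cmod_mult, Cmod_Ci, Rmult_1_l, Cmod_R.
  apply Rmult_le_compat; try apply Cmod_ge_0; [apply Rabs_pos| |].
    unfold Rdiv; rewrite Rabs_mult, (Rabs_pos_eq (/ 2)), <- abs_IZR by lra.
    assert (IZR (Z.abs k) <= INR n) by (rewrite INR_IZR_INZ; apply IZR_le; lia).
    generalize (pos_INR n); lra.
  eapply Rle_trans; [apply Cmod_csum|]; rewrite <- rsum_const; apply rsum_le; intros c Hc.
  destruct (_ =? _)%Z; [|rewrite Cmod_0; auto].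
  rewrite Cmod_mult, Cmod_cexpi, Rmult_1_l.
  apply (l2le_term (box (2 * n)) (fun k => Cmod (S t k))); auto; apply HSb, NoDup_box.
destruct (linear_ode (Z * bool) (list_prod (box n) (true :: false :: nil)) a
  (INR n * (INR (length (box (2 * n))) * m)) t0
  (fun i => if snd i then fst (h (fst i)) else snd (h (fst i)))) as (x & Hx0 & Hx).
  intros [i []] [j []] t; unfold a; cbn [fst snd]; try apply Mc.
  apply (continuous_opp (fun s => snd (flow_coef n S i j s))); apply Mc.
  assert (Hsnd : forall c : C, Rabs (snd c) <= Cmod c).
    intros c; eapply Rle_trans; [apply Rmax_r|apply Rmax_Cmod].
  intros [i []] [j []] t; unfold a; cbn [fst snd]; rewrite ?Rabs_Ropp;
    (eapply Rle_trans; [|apply (Mb i j t)]); try apply re_le_Cmod; apply Hsnd.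
set (y := fun t k => if mem (box n) k then (x (k, true) t, x (k, false) t) else RtoC 0).
assert (Hs : forall t k, ~ In k (box n) -> y t k = RtoC 0).
  intros t k Hk; unfold y; destruct (mem (box n) k) eqn:E; auto; apply memP in E; tauto.
assert (Hd : forall t k, In k (box n) ->
   Cder (fun s => y s k) t (csum (box n) (fun b => flow_coef n S k b t * y t b)%C)).
  intros t k Hk; apply memP in Hk; unfold y; rewrite Hk, csum_parts; split; cbn [fst snd].
  - assert (E := Hx (k, true) t); rewrite rsum_list_prod in E.
    match type of E with is_derive _ _ ?X => replace (rsum _ _) with X; [exact E|] end.
    apply rsum_ext; intros b Hb; apply memP in Hb; rewrite Hb; unfold a; cbn; ring.
  - assert (E := Hx (k, false) t); rewrite rsum_list_prod in E.
    match type of E with is_derive _ _ ?X => replace (rsum _ _) with X; [exact E|] end.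
    apply rsum_ext; intros b Hb; apply memP in Hb; rewrite Hb; unfold a; cbn; ring.
exists y; split; [split|].
- exact Hs.
- intros k t; destruct (in_dec Z.eq_dec k (box n)) as [Hk|Hk].
    exact (Cder_cont _ _ _ (Hd t k Hk)).
  apply (Ccont_ext (fun _ => RtoC 0)); [|apply Ccont_const].
  intros s; now rewrite Hs.
- intros t k _ Hk; eapply Cder_eq; [now apply Hd|]; apply flow_coef_conv; auto.
- intros k; unfold y; destruct (mem (box n) k) eqn:E.
    rewrite !Hx0; cbn; now destruct (h k).
  rewrite Hh; auto; intros Hk; apply memP in Hk; congruence.
Qed.

Lemma conv_plus_r l p q q' k t :
  conv l p (fun k => q k + q' k)%C k t = (conv l p q k t + conv l p q' k t)%C.
Proof. now rewrite conv_sym, conv_plus_l, conv_sym, (conv_sym l q'). Qed.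

Lemma flow_plus T n S y z :
  flow T n S y -> flow T n S z -> flow T n S (fun t k => y t k + z t k)%C.
Proof.
intros Hy Hz; split.
- intros t k Hk; rewrite (fl_supp _ _ _ _ Hy), (fl_supp _ _ _ _ Hz); auto; ring.
- intros k t; apply Ccont_plus; [apply (fl_cont _ _ _ _ Hy)|apply (fl_cont _ _ _ _ Hz)].
- intros t k Ht Hk; eapply Cder_eq.
    apply Cder_plus; [now apply (fl_der _ _ _ _ Hy)|now apply (fl_der _ _ _ _ Hz)].
  rewrite conv_plus_r; ring.
Qed.

Lemma flow_opp T n S y : flow T n S y -> flow T n S (fun t k => RtoC (-1) * y t k)%C.
Proof.
intros Hy; split.
- intros t k Hk; rewrite (fl_supp _ _ _ _ Hy); auto; ring.
- intros k t; apply Ccont_mult; [apply Ccont_const|apply (fl_cont _ _ _ _ Hy)].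
- intros t k Ht Hk; eapply Cder_eq; [apply Cder_scal; now apply (fl_der _ _ _ _ Hy)|].
  replace (conv (box (2 * n)) (S t) (fun k => RtoC (-1) * y t k)%C k t) with
    (RtoC (-1) * conv (box (2 * n)) (S t) (y t) k t)%C; [ring|].
  unfold conv; rewrite <- csum_scal; apply csum_ext; intros a _; rewrite <- csum_scal.
  apply csum_ext; intros b _; destruct (_ =? _)%Z; ring.
Qed.

(* Both halves of the derivative are the same trilinear sum, with opposite signs. *)
Lemma sympl_flow_const T n S x y : 0 < T -> flow T n S x -> flow T n S y ->
  forall s t, 0 <= s <= T -> 0 <= t <= T ->
  fst (sympl n (x t) (y t)) <= fst (sympl n (x s) (y s)).
Proof.
intros HT Hx Hy.
assert (Hc := sympl_cont n x y (fl_cont _ _ _ _ Hx) (fl_cont _ _ _ _ Hy)).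
apply (closed_bound2 T (fun t => fst (sympl n (x t) (y t))) (fun t => fst (sympl n (x t) (y t)))); auto;
  try (intros u; apply Hc).
assert (Hd : forall t, 0 < t < T -> Cder (fun s => sympl n (x s) (y s)) t (RtoC 0)).
  intros t Ht; eapply Cder_eq.
    apply Cder_csum; intros k Hk; apply Cder_mult; [|apply Cder_const].
    apply Cder_mult; [now apply (fl_der _ _ _ _ Hx)|apply (fl_der _ _ _ _ Hy)]; auto.
    rewrite in_box in *; lia.
  cbv beta.
  set (g := fun k : Z => (RtoC (chi n k) * (Ci * RtoC (/ 2)))%C).
  set (l := box (2 * n)).
  assert (Hchi : forall k, In k (box n) -> chi n k = 1).
    intros k Hk; apply in_box in Hk; unfold chi; destruct (Z.leb_spec (Z.abs k) (Z.of_nat n)); auto; lia.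
  assert (Hci : forall k, k <> 0%Z -> (Ci * RtoC (IZR k / 2) * RtoC (/ IZR k))%C = (Ci * RtoC (/ 2))%C).
    intros k Hk; rewrite <- Cmult_assoc, <- RtoC_mult; do 2 f_equal; field; now apply not_0_IZR.
  transitivity (csum l (fun k => g k * conv l (S t) (x t) k t * y t (- k)%Z)%C +
    - csum l (fun k => g k * conv l (S t) (y t) k t * x t (- k)%Z)%C)%C.
  { unfold l; rewrite !(csum_sub (box n) (box (2 * n)) (fun k => (g k * _ * _)%C));
      try apply NoDup_box; try (apply incl_box; lia).
    2:{ intros k _ Hk; rewrite (fl_supp _ _ _ _ Hx (t) (- k)%Z); [ring|].
        intros Hk'; apply Hk; rewrite in_box in *; lia. }
    2:{ intros k _ Hk; rewrite (fl_supp _ _ _ _ Hy (t) (- k)%Z); [ring|].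
        intros Hk'; apply Hk; rewrite in_box in *; lia. }
    fold l.
    rewrite <- (csum_box_opp n (fun k => (g k * conv l (S t) (y t) k t * x t (- k)%Z)%C)).
    replace (- csum (box n) _)%C with (RtoC (-1) * csum (box n)
      (fun k => g (- k)%Z * conv l (S t) (y t) (- k) t * x t (- - k)%Z))%C
      by (rewrite RtoC_m1; ring).
    rewrite <- csum_scal, <- csum_plus; apply csum_ext; intros k Hk.
    assert (Hk0 := in_box_0 _ _ Hk).
    unfold g; rewrite chi_opp, Z.opp_involutive, (Hchi k Hk), <- (Hci k Hk0), opp_IZR.
    replace (- IZR k / 2) with (-1 * (IZR k / 2)) by field; rewrite RtoC_mult; ring. }
  unfold l; rewrite (tri_pair (2 * n) g), (tri_pair (2 * n) g), (tri_swap23 _ _ (S t) (y t)).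
  match goal with |- (?u + - ?v)%C = _ => replace v with u; [ring|] end.
  apply tri_ext; intros a b c _ _ _ _.
  destruct (in_dec Z.eq_dec b (box n)) as [Hb|Hb]; [|rewrite (fl_supp _ _ _ _ Hx t b) by auto; ring].
  destruct (in_dec Z.eq_dec c (box n)) as [Hc'|Hc']; [|rewrite (fl_supp _ _ _ _ Hy t c) by auto; ring].
  f_equal; unfold osc, g; rewrite !chi_opp, !Hchi by auto; do 2 f_equal; ring.
(* With zero derivative the real part is constant; the inequality, available for both orders of the
   times, is an equality. *)
intros s t Hs Ht.
assert (E := Lipschitz_interval T _ (fun _ => RtoC 0) 0 s t
  (fun u Hu => conj (Hd u Hu) (Req_le _ _ Cmod_0)) Hs Ht).
rewrite Rmult_0_l in E; apply Rabs_le_between in E; lra.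
Qed.

Definition neg_mass (n : nat) (y : Z -> C) : R := rsum (box n) (fun k => inv k ^ 2 * Cmod (y k) ^ 2).

(** The quadratic K-functional between [H^0] and [H^{-1}]: mode by mode, the minimum of
    [|p|^2 + lam |q|^2 / k^2] over [p + q = y_k]. *)
Definition qform (lam : R) (n : nat) (y : Z -> C) : R :=
  rsum (box n) (fun k => lam / (IZR k ^ 2 + lam) * Cmod (y k) ^ 2).

Definition weak_mass (alpha : R) (n : nat) (y : Z -> C) : R :=
  rsum (box n) (fun k => Rpower (IZR k ^ 2) (- alpha) * Cmod (y k) ^ 2).

Lemma inv_sq k : k <> 0%Z -> inv k ^ 2 = / IZR k ^ 2.
Proof.
intros Hk; rewrite <- Rinv_abs_inv, RPow_abs, Rabs_pos_eq by (auto; apply pow2_ge_0).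
now rewrite pow_inv.
Qed.

Lemma Cmod_sympl n x y P Q :
  0 <= P -> 0 <= Q ->
  rsum (box n) (fun k => (inv k * Cmod (x k)) ^ 2) <= P ^ 2 ->
  rsum (box n) (fun k => Cmod (y (- k)%Z) ^ 2) <= Q ^ 2 ->
  Cmod (sympl n x y) <= P * Q.
Proof.
intros HP HQ H1 H2; unfold sympl; eapply Rle_trans; [apply Cmod_csum|].
eapply Rle_trans; [|exact (rsum_CS _ _ _ P Q HP HQ H1 H2)].
apply rsum_le; intros k Hk; apply in_box_0 in Hk.
rewrite !Cmod_mult, Cmod_R, Rinv_abs_inv by auto; lra.
Qed.

Section Duality.
Variables (T D : R) (n : nat) (S : R -> Z -> C).
Hypotheses (HT : 0 < T) (HD : 0 <= D).
Hypothesis Hmass : forall y, flow T n S y -> forall s t, 0 <= s <= T -> 0 <= t <= T ->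
  mass n (y t) <= D * mass n (y s).
Hypothesis Hex : forall t0 h, (forall k, ~ In k (box n) -> h k = RtoC 0) ->
  exists y, flow T n S y /\ forall k, y t0 k = h k.

(* The truncated flow preserves the form [sympl], so the [H^0] bound for the dual data
   [x_k = - conj (y_{-k}) / k] is an [H^{-1}] bound for [y]. *)
Lemma neg_mass_bound y : flow T n S y -> forall s t, 0 <= s <= T -> 0 <= t <= T ->
  neg_mass n (y t) <= D * neg_mass n (y s).
Proof.
intros Hy s t Hs Ht.
set (h := fun k => (RtoC (- / IZR k) * Cconj (y t (- k)%Z))%C).
destruct (Hex t h) as (x & Hx & Hxt).
  intros k Hk; unfold h; rewrite (fl_supp _ _ _ _ Hy), Cconj_0; [ring|].
  intros Hk'; apply Hk; rewrite in_box in *; lia.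
set (P := neg_mass n (y t)).
assert (HP0 : 0 <= P).
  apply rsum_nonneg; intros; apply Rmult_le_pos; apply pow2_ge_0.
assert (HQ0 : 0 <= neg_mass n (y s)).
  apply rsum_nonneg; intros; apply Rmult_le_pos; apply pow2_ge_0.
assert (E1 : fst (sympl n (y t) (x t)) = P).
  unfold sympl; rewrite (csum_ext _ _ (fun k => RtoC (inv k ^ 2 * Cmod (y t k) ^ 2))), csum_RtoC; auto.
  intros k Hk; apply in_box_0 in Hk; rewrite Hxt; unfold h.
  rewrite Z.opp_involutive, opp_IZR, RtoC_mult, Cmod2_conj.
  replace (inv k ^ 2) with ((- / - IZR k) * / IZR k); [rewrite RtoC_mult; ring|].
  rewrite inv_sq by auto; assert (IZR k <> 0) by now apply not_0_IZR.
  field; auto.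
assert (E2 : mass n (x t) = P).
  unfold mass, P, neg_mass.
  rewrite <- (rsum_box_opp n (fun k => inv k ^ 2 * Cmod (y t k) ^ 2)).
  apply rsum_ext; intros k Hk; apply in_box_0 in Hk; rewrite Hxt; unfold h.
  rewrite Cmod_mult, Cmod_conj, Cmod_R, Rabs_Ropp, Rinv_abs_inv, inv_opp by auto; ring.
assert (E3 := Hmass x Hx t s Ht Hs); rewrite E2 in E3.
assert (E4 := sympl_flow_const T n S y x HT Hy Hx s t Hs Ht); rewrite E1 in E4.
assert (E5 : Cmod (sympl n (y s) (x s)) <= sqrt (neg_mass n (y s)) * sqrt (D * P)).
  apply Cmod_sympl; try apply sqrt_pos.
    rewrite pow2_sqrt by auto; apply Req_le, rsum_ext; intros; ring.
  rewrite pow2_sqrt by (apply Rmult_le_pos; auto).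
  rewrite (rsum_box_opp n (fun k => Cmod (x s k) ^ 2)); exact E3.
assert (E6 : P <= sqrt (neg_mass n (y s) * (D * P))).
  rewrite sqrt_mult by (auto; apply Rmult_le_pos; auto).
  eapply Rle_trans; [exact E4|]; eapply Rle_trans; [apply Rle_abs|].
  eapply Rle_trans; [apply re_le_Cmod|exact E5].
assert (E7 : P * P <= neg_mass n (y s) * (D * P)).
  rewrite <- (sqrt_sqrt (neg_mass n (y s) * (D * P))) by (apply Rmult_le_pos; auto; apply Rmult_le_pos; auto).
  now apply Rmult_le_compat.
assert (0 <= D * neg_mass n (y s)) by now apply Rmult_le_pos.
nra.
Qed.

(** Uniqueness, from the mass bound; it allows a flow to be decomposed according to a decomposition
    of its data. *)
Lemma flow_zero y t0 : flow T n S y -> 0 <= t0 <= T -> (forall k, y t0 k = RtoC 0) ->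
  forall t k, 0 <= t <= T -> y t k = RtoC 0.
Proof.
intros Hy Ht0 H0 t k Ht.
destruct (in_dec Z.eq_dec k (box n)) as [Hk|Hk]; [|now apply (fl_supp _ _ _ _ Hy)].
assert (E := Hmass y Hy t0 t Ht0 Ht).
assert (E0 : mass n (y t0) = 0).
  unfold mass; rewrite (rsum_ext _ _ (fun _ => 0)), rsum_0; auto.
  intros j _; rewrite H0, Cmod_0; ring.
rewrite E0, Rmult_0_r in E.
assert (E1 : Cmod (y t k) ^ 2 <= mass n (y t)).
  apply (rsum_ge_term (box n) (fun k => Cmod (y t k) ^ 2)); auto; intros; apply pow2_ge_0.
apply Cmod_eq_0; generalize (Cmod_ge_0 (y t k)); nra.
Qed.

(** The data at time [s] are split by the exact minimiser of the K-functional. The flows of the two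
    parts are bounded in [H^0] and [H^{-1}] respectively, and at time [t] any splitting dominates
    the minimum. *)
Lemma qform_bound lam y : 0 < lam -> flow T n S y -> forall s t, 0 <= s <= T -> 0 <= t <= T ->
  qform lam n (y t) <= D * qform lam n (y s).
Proof.
intros Hlam Hy s t Hs Ht.
assert (Hk2 : forall k : Z, 0 < IZR k ^ 2 + lam) by (intros k; generalize (pow2_ge_0 (IZR k)); lra).
set (ha := fun k => (RtoC (lam / (IZR k ^ 2 + lam)) * y s k)%C).
set (hb := fun k => (RtoC (IZR k ^ 2 / (IZR k ^ 2 + lam)) * y s k)%C).
destruct (Hex s ha) as (ya & Hya & Eya).
  intros k Hk; unfold ha; rewrite (fl_supp _ _ _ _ Hy); auto; ring.
destruct (Hex s hb) as (yb & Hyb & Eyb).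
  intros k Hk; unfold hb; rewrite (fl_supp _ _ _ _ Hy); auto; ring.
assert (Hdec : forall k, y t k = (ya t k + yb t k)%C).
  intros k.
  assert (E := flow_zero _ s (flow_plus _ _ _ _ _ Hy (flow_opp _ _ _ _ (flow_plus _ _ _ _ _ Hya Hyb))) Hs).
  cbv beta in E.
  assert (E' : forall k, (y s k + RtoC (-1) * (ya s k + yb s k))%C = RtoC 0).
    intros j; rewrite Eya, Eyb; unfold ha, hb.
    transitivity (y s j * (RtoC 1 + RtoC (-1) * RtoC (lam / (IZR j ^ 2 + lam) + IZR j ^ 2 / (IZR j ^ 2 + lam))))%C.
      rewrite RtoC_plus; ring.
    replace (_ + IZR j ^ 2 / _) with 1 by (field; specialize (Hk2 j); lra).
    rewrite <- RtoC_mult, <- RtoC_plus; replace (1 + -1 * 1) with 0 by ring; ring.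
  specialize (E E' t k Ht).
  replace (y t k) with ((y t k + RtoC (-1) * (ya t k + yb t k)) + (ya t k + yb t k))%C.
    rewrite E; ring.
  rewrite RtoC_m1; ring.
apply Rle_trans with (mass n (ya t) + lam * neg_mass n (yb t)).
  unfold qform, mass, neg_mass; rewrite <- rsum_scal, <- rsum_plus; apply rsum_le; intros k Hk.
  apply in_box_0 in Hk.
  assert (Htri : Cmod (y t k) <= Cmod (ya t k) + Cmod (yb t k)) by (rewrite Hdec; apply Cmod_triangle).
  generalize (Cmod_ge_0 (y t k)) (Cmod_ge_0 (ya t k)) (Cmod_ge_0 (yb t k)).
  revert Htri; generalize (Cmod (y t k)) (Cmod (ya t k)) (Cmod (yb t k)); intros u p q Hu u0 p0 q0.
  rewrite inv_sq by auto.
  assert (Hk0 : IZR k <> 0) by now apply not_0_IZR.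
  assert (HX : 0 < IZR k ^ 2) by now apply pow2_gt_0.
  revert HX Hk0; generalize (IZR k); intros x HX Hk0.
  apply Rmult_le_reg_r with (x ^ 2 + lam); [lra|].
  replace (lam / (x ^ 2 + lam) * u ^ 2 * (x ^ 2 + lam)) with (lam * u ^ 2) by (field; lra).
  apply Rle_trans with (lam * (p + q) ^ 2).
    apply Rmult_le_compat_l; [lra|]; apply pow_incr; lra.
  (* The excess of a splitting over the minimum is exactly this square, which vanishes at the
     minimiser. *)
  assert (Hsq := pow2_ge_0 (p * x - lam * q / x)).
  replace ((p ^ 2 + lam * (/ x ^ 2 * q ^ 2)) * (x ^ 2 + lam)) with
    (lam * (p + q) ^ 2 + (p * x - lam * q / x) ^ 2) by (field; auto); lra.
apply Rle_trans with (D * (mass n (ya s) + lam * neg_mass n (yb s))).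
  assert (E1 := Hmass ya Hya s t Hs Ht); assert (E2 := neg_mass_bound yb Hyb s t Hs Ht); nra.
apply Rmult_le_compat_l; auto.
unfold qform, mass, neg_mass; rewrite <- rsum_scal, <- rsum_plus; apply Req_le, rsum_ext; intros k Hk.
apply in_box_0 in Hk; rewrite Eya, Eyb; unfold ha, hb; rewrite !Cmod_mult, !Cmod_R.
assert (Hk0 : IZR k <> 0) by now apply not_0_IZR.
specialize (Hk2 k); rewrite inv_sq by auto.
rewrite !(Rpow_mult_distr (Rabs _)), !RPow_abs.
rewrite !(Rabs_pos_eq (_ ^ 2)) by apply pow2_ge_0.
field; split; auto; lra.
Qed.
End Duality.

(** * Power weights as dyadic sums of K-functional weights *)

Lemma pow4_bracket X : 1 <= X -> exists j, 4 ^ j <= X < 4 ^ S j.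
Proof.
intros HX.
assert (H : forall N, X < 4 ^ N -> exists j, 4 ^ j <= X < 4 ^ S j).
  induction N as [|N IH]; intros H; [simpl in H; lra|].
  destruct (Rlt_le_dec X (4 ^ N)); auto; now exists N.
destruct (Pow_x_infinity 4) with (b := X + 1) as [N HN].
  rewrite Rabs_pos_eq; lra.
apply (H N); specialize (HN N (le_n _)).
rewrite Rabs_pos_eq in HN by (apply pow_le; lra); lra.
Qed.

Lemma Rpower_pow4 j y : Rpower (4 ^ j) y = Rpower 4 y ^ j.
Proof.
rewrite <- Rpower_pow by lra; rewrite Rpower_mult.
rewrite <- (Rpower_pow j (Rpower 4 y)) by apply exp_pos; rewrite Rpower_mult; f_equal; ring.
Qed.

Lemma Rpower_antitone x y a : 0 <= a -> 0 < x <= y -> Rpower y (- a) <= Rpower x (- a).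
Proof.
intros Ha Hx; rewrite !Rpower_Ropp; apply Rinv_le_contravar; [apply exp_pos|].
now apply Rle_Rpower_l.
Qed.

(** With [p = 4^{-alpha}], a dyadic form of the integral of [lam^{-alpha} / (X + lam)] over
    [lam > 0], which is a multiple of [X^{-alpha}] for [0 < alpha < 1]. *)
Definition wsum (p : R) (J : nat) (X : R) : R :=
  rsum (seq 0 (S J)) (fun j => p ^ j * (4 ^ j / (X + 4 ^ j))).

Lemma wsum_S p J X : wsum p (S J) X = wsum p J X + p ^ S J * (4 ^ S J / (X + 4 ^ S J)).
Proof. unfold wsum; rewrite (seq_S (S J)), rsum_app; cbn [rsum Nat.add]; ring. Qed.

Lemma pow4_pos j : 0 < 4 ^ j.
Proof. apply pow_lt; lra. Qed.

(* Geometric sums on both sides of the index where [4^j] crosses [X]. *)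
Lemma wsum_bounds alpha : 0 < alpha < 1 -> exists c, 0 < c /\
  forall J X, 1 <= X ->
    wsum (Rpower 4 (- alpha)) J X <= c * Rpower X (- alpha) /\
    (X < 4 ^ S J -> Rpower X (- alpha) <= 5 * wsum (Rpower 4 (- alpha)) J X).
Proof.
intros Ha; set (p := Rpower 4 (- alpha)).
assert (p0 : 0 < p) by apply exp_pos.
(* The two inequalities [p < 1 < 4 p] are the condition [0 < alpha < 1]: terms decay upwards like
   [p^j] and downwards like [(4 p)^j]. *)
assert (p1 : p < 1).
  unfold p; rewrite Rpower_Ropp, <- Rinv_1; apply Rinv_lt_contravar.
    rewrite Rmult_1_l; apply exp_pos.
  rewrite <- (Rpower_O 4) at 1 by lra; apply Rpower_lt; lra.
assert (p4 : 1 < 4 * p).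
  unfold p; replace 4 with (Rpower 4 1) at 1 by (apply Rpower_1; lra).
  rewrite <- Rpower_plus, <- (Rpower_O 4) at 1 by lra; apply Rpower_lt; lra.
set (c := (4 * p / (4 * p - 1) + p / (1 - p)) / p).
assert (c0 : 0 < c).
  unfold c; apply Rdiv_lt_0_compat; auto; apply Rplus_lt_0_compat; apply Rdiv_lt_0_compat; lra.
exists c; split; auto; intros J X HX.
destruct (pow4_bracket X HX) as (j0 & Hj1 & Hj2).
assert (pp : forall j, 0 < p ^ j) by (intros; now apply pow_lt).
assert (term0 : forall j, 0 <= p ^ j * (4 ^ j / (X + 4 ^ j))).
  intros j; assert (H4 := pow4_pos j); apply Rmult_le_pos; [left; apply pp|].
  apply Rdiv_le_0_compat; lra.
assert (mono : forall J i, wsum p J X <= wsum p (J + i) X).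
  intros J' i; induction i as [|i IH]; [rewrite Nat.add_0_r; lra|].
  rewrite Nat.add_succ_r, wsum_S; generalize (term0 (S (J' + i))); lra.
split.
- assert (H1 : forall J, (J <= j0)%nat -> wsum p J X <= (4 * p) ^ S J / ((4 * p - 1) * 4 ^ j0)).
    assert (H40 := pow4_pos j0).
    assert (Ht : forall j, p ^ j * (4 ^ j / (X + 4 ^ j)) <= (4 * p) ^ j / 4 ^ j0).
      intros j; rewrite Rpow_mult_distr; assert (H4 := pow4_pos j).
      replace (4 ^ j * p ^ j / 4 ^ j0) with (p ^ j * (4 ^ j / 4 ^ j0)) by (field; lra).
      apply Rmult_le_compat_l; [left; apply pp|].
      apply Rmult_le_compat_l; [lra|]; apply Rinv_le_contravar; lra.
    induction J0 as [|J0 IH]; intros HJ.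
      unfold wsum; cbn [rsum seq]; rewrite Rplus_0_r; eapply Rle_trans; [apply Ht|].
      simpl; apply Rmult_le_reg_r with ((4 * p - 1) * 4 ^ j0); [apply Rmult_lt_0_compat; lra|].
      field_simplify; lra.
    rewrite wsum_S; eapply Rle_trans; [apply Rplus_le_compat; [apply IH; lia|apply Ht]|].
    apply Req_le; simpl; field; lra.
  assert (H2 : forall i, wsum p (j0 + i) X <= (4 * p) ^ S j0 / ((4 * p - 1) * 4 ^ j0) +
      (p ^ S j0 - p ^ S (j0 + i)) / (1 - p)).
    induction i as [|i IH].
      rewrite Nat.add_0_r; eapply Rle_trans; [apply H1; auto|]; apply Req_le; field.
      split; [|split]; generalize (pow4_pos j0); lra.
    rewrite Nat.add_succ_r, wsum_S.
    assert (Ht : p ^ S (j0 + i) * (4 ^ S (j0 + i) / (X + 4 ^ S (j0 + i))) <= p ^ S (j0 + i)).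
      rewrite <- (Rmult_1_r (p ^ S (j0 + i))) at 2; apply Rmult_le_compat_l; [left; apply pp|].
      assert (H4 := pow4_pos (S (j0 + i))).
      apply Rmult_le_reg_r with (X + 4 ^ S (j0 + i)); [lra|].
      replace (4 ^ S (j0 + i) / (X + 4 ^ S (j0 + i)) * (X + 4 ^ S (j0 + i))) with (4 ^ S (j0 + i)) by (field; lra).
      lra.
    eapply Rle_trans; [apply Rplus_le_compat; [apply IH|apply Ht]|].
    apply Req_le; change (p ^ S (S (j0 + i))) with (p * p ^ S (j0 + i)); field.
    generalize (pow4_pos j0); split; [|split]; lra.
  apply Rle_trans with (p ^ j0 * (p * c)).
    apply Rle_trans with (wsum p (j0 + J) X).
      rewrite Nat.add_comm; apply mono.
    eapply Rle_trans; [apply H2|].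
    assert (H40 := pow4_pos j0).
    unfold c; replace (p ^ j0 * (p * ((4 * p / (4 * p - 1) + p / (1 - p)) / p))) with
      (p ^ j0 * (4 * p) / (4 * p - 1) + p ^ j0 * p / (1 - p)) by (field; lra).
    apply Rplus_le_compat.
      simpl; rewrite Rpow_mult_distr; apply Req_le; field; lra.
    apply Rmult_le_compat_r; [left; apply Rinv_0_lt_compat; lra|].
    simpl; generalize (pp (S (j0 + J))); simpl; lra.
  assert (Hp : p ^ j0 * p <= Rpower X (- alpha)).
    replace (p ^ j0 * p) with (Rpower (4 ^ S j0) (- alpha)).
      apply Rpower_antitone; lra.
    rewrite Rpower_pow4; fold p; simpl; ring.
  apply Rle_trans with (c * (p ^ j0 * p)); [lra|].
  apply Rmult_le_compat_l; lra.
- intros HJ.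
  assert (Hj0J : (j0 <= J)%nat).
    destruct (le_lt_dec j0 J) as [|Hlt]; auto.
    assert (4 ^ S J <= 4 ^ j0) by (apply Rle_pow; [lra|lia]); lra.
  assert (H40 := pow4_pos j0).
  (* The single term [j0] is enough for the lower bound: [X < 4 * 4^j0] makes the quotient at least
     [1/5]. *)
  assert (Hterm : p ^ j0 * / 5 <= p ^ j0 * (4 ^ j0 / (X + 4 ^ j0))).
    apply Rmult_le_compat_l; [left; apply pp|].
    apply Rmult_le_reg_r with (X + 4 ^ j0); [lra|].
    replace (4 ^ j0 / (X + 4 ^ j0) * (X + 4 ^ j0)) with (4 ^ j0) by (field; lra).
    simpl in Hj2; lra.
  assert (Hle : p ^ j0 * (4 ^ j0 / (X + 4 ^ j0)) <= wsum p J X).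
    apply (rsum_ge_term (seq 0 (S J)) (fun j => p ^ j * (4 ^ j / (X + 4 ^ j)))); auto.
    apply in_seq; lia.
  assert (Hp : Rpower X (- alpha) <= p ^ j0).
    unfold p; rewrite <- Rpower_pow4; apply Rpower_antitone; lra.
  lra.
Qed.

(** The K-functional bounds are summed with weights [4^{-alpha j}]. At [alpha = 1] one would have
    [4 p = 1] and lose a logarithm, so that end point is the [H^{-1}] bound itself. *)
Lemma weak_mass_bound alpha : 0 < alpha <= 1 -> exists c, 0 < c /\
  forall T D n S, 0 < T -> 0 <= D ->
  (forall y, flow T n S y -> forall s t, 0 <= s <= T -> 0 <= t <= T -> mass n (y t) <= D * mass n (y s)) ->
  (forall t0 h, (forall k, ~ In k (box n) -> h k = RtoC 0) ->
     exists y, flow T n S y /\ forall k, y t0 k = h k) ->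
  forall y, flow T n S y -> forall s t, 0 <= s <= T -> 0 <= t <= T ->
    weak_mass alpha n (y t) <= c * D * weak_mass alpha n (y s).
Proof.
intros [Ha0 Ha1].
destruct (Req_dec alpha 1) as [->|Hne].
  exists 1; split; [lra|]; intros T D n S HT HD Hm Hex y Hy s t Hs Ht.
  assert (E : forall x, weak_mass 1 n x = neg_mass n x).
    intros x; apply rsum_ext; intros k Hk; apply in_box_0 in Hk; f_equal.
    assert (0 < IZR k ^ 2) by (apply pow2_gt_0; now apply not_0_IZR).
    now rewrite Rpower_Ropp, Rpower_1, inv_sq.
  rewrite !E, Rmult_1_l; now apply (neg_mass_bound T D n S).
destruct (wsum_bounds alpha) as (c & Hc & Hw); [lra|].
exists (5 * c); split; [lra|].
intros T D n S HT HD Hm Hex y Hy s t Hs Ht.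
set (p := Rpower 4 (- alpha)) in *.
(* [J] grows with [n] so that [4^(J+1)] exceeds every [k^2]; the constants of [wsum_bounds] do not
   depend on [J]. *)
destruct (pow4_bracket (INR n ^ 2 + 1)) as (J & _ & HJ); [generalize (pow2_ge_0 (INR n)); lra|].
assert (HX : forall k, In k (box n) -> 1 <= IZR k ^ 2 < 4 ^ Datatypes.S J).
  intros k Hk; apply in_box in Hk.
  assert (E : IZR k ^ 2 = IZR (Z.abs k) ^ 2).
    rewrite abs_IZR, RPow_abs, Rabs_pos_eq; auto; apply pow2_ge_0.
  rewrite E.
  assert (H1 : 1 <= IZR (Z.abs k)) by (apply IZR_le; lia).
  assert (H2 : IZR (Z.abs k) <= INR n) by (rewrite INR_IZR_INZ; apply IZR_le; lia).
  split; nra.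
assert (HE : forall x, rsum (box n) (fun k => wsum p J (IZR k ^ 2) * Cmod (x k) ^ 2) =
   rsum (seq 0 (Datatypes.S J)) (fun j => p ^ j * qform (4 ^ j) n x)).
  intros x; unfold wsum, qform.
  rewrite (rsum_ext (box n) _ (fun k => rsum (seq 0 (Datatypes.S J))
    (fun j => p ^ j * (4 ^ j / (IZR k ^ 2 + 4 ^ j) * Cmod (x k) ^ 2)))).
    rewrite rsum_exchange; apply rsum_ext; intros j _; apply rsum_scal.
  intros k _; rewrite <- rsum_scal_r; apply rsum_ext; intros; ring.
assert (p0 : 0 < p) by apply exp_pos.
apply Rle_trans with (5 * rsum (box n) (fun k => wsum p J (IZR k ^ 2) * Cmod (y t k) ^ 2)).
  unfold weak_mass; rewrite <- rsum_scal; apply rsum_le; intros k Hk.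
  destruct (HX k Hk) as [X1 X2]; destruct (Hw J _ X1) as [_ W].
  rewrite <- Rmult_assoc; apply Rmult_le_compat_r; [apply pow2_ge_0|auto].
rewrite HE.
apply Rle_trans with (5 * (D * rsum (seq 0 (Datatypes.S J)) (fun j => p ^ j * qform (4 ^ j) n (y s)))).
  apply Rmult_le_compat_l; [lra|]; rewrite <- rsum_scal; apply rsum_le; intros j _.
  assert (Q := qform_bound T D n S HT HD Hm Hex (4 ^ j) y (pow4_pos j) Hy s t Hs Ht).
  apply Rle_trans with (p ^ j * (D * qform (4 ^ j) n (y s))); [|lra].
  apply Rmult_le_compat_l; auto; apply pow_le; lra.
rewrite <- HE.
replace (5 * c * D * weak_mass alpha n (y s)) with (5 * (D * (c * weak_mass alpha n (y s)))) by ring.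
apply Rmult_le_compat_l; [lra|]; apply Rmult_le_compat_l; auto.
unfold weak_mass; rewrite <- rsum_scal; apply rsum_le; intros k Hk.
destruct (HX k Hk) as [X1 _]; destruct (Hw J _ X1) as [W _].
rewrite <- Rmult_assoc; apply Rmult_le_compat_r; [apply pow2_ge_0|auto].
Qed.

(** * Pairing a difference of solutions with a truncated flow *)

Definition some_above (n : nat) (a b c : Z) : bool :=
  negb ((Z.abs a <=? Z.of_nat n)%Z && (Z.abs b <=? Z.of_nat n)%Z && (Z.abs c <=? Z.of_nat n)%Z).

(** By zero sum, a frequency above [n >= 2 n2] forces [b] or [c] above [n2], where the inverse sum
    is a tail of size [delta]. The growth [|a| B] of a differentiated factor is absorbed by
    [inv a]. *)
Lemma tri_some_above l w x y z t n n2 B m1 m2 delta :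
  NoDup l -> (forall k, In k l -> k <> 0%Z) -> 0 <= B -> (2 * n2 <= n)%nat ->
  0 <= delta -> 4 / INR (S n2) <= delta ^ 2 ->
  l2le l (fun k => Cmod (y k)) m1 -> l2le l (fun k => Cmod (z k)) m2 ->
  (forall a, In a l -> Cmod (x a) <= Rabs (IZR a) * B) ->
  (forall a b c, In a l -> In b l -> In c l ->
     Cmod (w a b c) <= if some_above n a b c then / 6 * (inv a * inv b * inv c) else 0) ->
  Cmod (tri l (osc w t) x y z) <= 2 / 3 * B * m1 * m2 * delta.
Proof.
intros Hl H0 HB Hn2 Hd HN Hy Hz Hx Hw.
eapply Rle_trans; [apply Cmod_tri|].
set (f := fun x : Z -> C => fun b => Cmod (x b) * inv b).
set (ft := fun x : Z -> C => fun b => if (Z.abs b <=? Z.of_nat n2)%Z then 0 else Cmod (x b) * inv b).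
assert (f0 : forall x b, 0 <= f x b).
  intros; unfold f; apply Rmult_le_pos; [apply Cmod_ge_0|apply inv_nonneg].
assert (ft0 : forall x b, 0 <= ft x b).
  intros; unfold ft; destruct (_ <=? _)%Z; [lra|apply f0].
assert (m10 := proj1 Hy). assert (m20 := proj1 Hz).
apply Rle_trans with (tsum l (fun a b c => (/ 6 * B) * (ft y b * f z c)) +
    tsum l (fun a b c => (/ 6 * B) * (f y b * ft z c))).
  rewrite <- tsum_plus; apply tsum_le; intros a b c Ha Hb Hc HS.
  assert (P1 : forall u v, 0 <= u -> 0 <= v -> 0 <= / 6 * B * (u * v)).
    intros; repeat apply Rmult_le_pos; auto; lra.
  assert (P2 := P1 _ _ (ft0 y b) (f0 z c)).
  assert (P3 := P1 _ _ (f0 y b) (ft0 z c)).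
  rewrite Cmod_osc; specialize (Hw a b c Ha Hb Hc); specialize (Hx a Ha).
  set (Y := Cmod (x a) * Cmod (y b) * Cmod (z c)).
  assert (HY : 0 <= Y) by (unfold Y; repeat apply Rmult_le_pos; apply Cmod_ge_0).
  destruct (some_above n a b c) eqn:Eb.
    apply Rle_trans with (/ 6 * B * (f y b * f z c)).
      apply Rle_trans with (/ 6 * (inv a * inv b * inv c) * (Rabs (IZR a) * B * (Cmod (y b) * Cmod (z c)))).
        apply Rmult_le_compat; auto using Cmod_ge_0.
        unfold Y; rewrite Rmult_assoc; apply Rmult_le_compat_r; auto.
        apply Rmult_le_pos; apply Cmod_ge_0.
      replace (/ 6 * (inv a * inv b * inv c) * (Rabs (IZR a) * B * (Cmod (y b) * Cmod (z c)))) with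
        (/ 6 * B * ((Rabs (IZR a) * inv a) * (f y b * f z c))) by (unfold f; ring).
      rewrite Rabs_inv_l by auto; lra.
    revert P2 P3; unfold ft; fold (f y b) (f z c); unfold some_above in Eb.
    destruct (Z.leb_spec (Z.abs b) (Z.of_nat n2)), (Z.leb_spec (Z.abs c) (Z.of_nat n2)); try (intros; lra).
    exfalso.
    destruct (Z.leb_spec (Z.abs a) (Z.of_nat n)); [|lia].
    destruct (Z.leb_spec (Z.abs b) (Z.of_nat n)); [|lia].
    destruct (Z.leb_spec (Z.abs c) (Z.of_nat n)); [discriminate|lia].
  apply Rle_trans with (0 * Y); [now apply Rmult_le_compat_r|lra].
assert (Sy : rsum l (f y) <= 2 * m1) by now apply (sum_inv l (fun b => Cmod (y b))).
assert (Sz : rsum l (f z) <= 2 * m2) by now apply (sum_inv l (fun b => Cmod (z b))).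
assert (Ty : rsum l (ft y) <= m1 * delta) by now apply (sum_inv_tail l (fun b => Cmod (y b))).
assert (Tz : rsum l (ft z) <= m2 * delta) by now apply (sum_inv_tail l (fun b => Cmod (z b))).
assert (I1 : tsum l (fun a b c => (/ 6 * B) * (ft y b * f z c)) <= (/ 6 * B) * ((m1 * delta) * (2 * m2))).
  apply tsum_free_1; auto; [lra|now apply Rmult_le_pos].
assert (I2 : tsum l (fun a b c => (/ 6 * B) * (f y b * ft z c)) <= (/ 6 * B) * ((2 * m1) * (m2 * delta))).
  apply tsum_free_1; auto; lra.
lra.
Qed.

(* Chosen so that [-3 i a b c * w_flux] is [(i/2) (chi n c - chi n b)], the multiplier of the pairing. *)
Definition w_flux (n : nat) (a b c : Z) : C :=
  RtoC (/ 6 * (chi n b - chi n c) * / IZR (a * b * c)).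

Lemma w_flux_bound n a b c : a <> 0%Z -> b <> 0%Z -> c <> 0%Z ->
  Cmod (w_flux n a b c) <= if some_above n a b c then / 6 * (inv a * inv b * inv c) else 0.
Proof.
intros Ha Hb Hc; unfold w_flux; rewrite Cmod_R, !Rabs_mult, !mult_IZR, !Rinv_mult, !Rabs_mult.
rewrite (Rabs_pos_eq (/ 6)) by lra; rewrite !Rinv_abs_inv by auto.
assert (Hi : 0 <= inv a * inv b * inv c) by (repeat apply Rmult_le_pos; apply inv_nonneg).
destruct (some_above n a b c) eqn:Eb.
  apply Rmult_le_compat_r; auto.
  assert (Rabs (chi n b - chi n c) <= 1).
    generalize (chi_bounds n b) (chi_bounds n c); intros; apply Rabs_le; lra.
  lra.
unfold some_above in Eb; apply Bool.negb_false_iff, andb_prop in Eb; destruct Eb as [Eb Ec].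
apply andb_prop in Eb; destruct Eb as [_ Eb].
unfold chi; rewrite Eb, Ec, Rminus_diag, Rabs_R0; lra.
Qed.

(** If the difference of solutions obeyed the truncated equation too, the pairing would be constant;
    only interactions with a frequency above [n] change it. One division by the phase suffices: the
    form has already removed the derivative, and after the new loss of one frequency two inverse
    factors remain. The index [n0] depends on the flow only through the bound [Y]. *)
Lemma sympl_flux T V NLV U NLU r Y eta :
  0 < T -> sol T V NLV -> sol T U NLU -> (forall t, l2 (V t) r) -> (forall t, l2 (U t) r) ->
  0 <= Y -> 0 < eta -> exists n0, forall n y, (n0 <= n)%nat ->
    flow T n (fun t k => V t k + U t k)%C y ->
    (forall t, 0 <= t <= T -> mass n (y t) <= Y ^ 2) ->
    forall s t, 0 <= s <= T -> 0 <= t <= T ->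
      fst (sympl n (fun k => V t k - U t k)%C (y t)) <=
      fst (sympl n (fun k => V s k - U s k)%C (y s)) + eta.
Proof.
intros HT HV HU Hr Hr' HY Heta.
assert (r0 : 0 <= r) by exact (r_nonneg V r Hr).
set (Sm := fun t k => (V t k + U t k)%C). set (Z := fun t k => (V t k - U t k)%C).
(* The three released sums contribute [4/3 + 4/3 + 8/3] over the time interval; the correction [H]
   contributes [8/3] at each end. *)
set (c1 := T * (16 / 3 * r ^ 3 * Y) + 16 / 3 * r ^ 2 * Y).
assert (Hc1 : 0 <= c1).
  assert (P1 : 0 <= r ^ 2) by now apply pow_le. assert (P2 : 0 <= r ^ 3) by now apply pow_le.
  unfold c1; apply Rplus_le_le_0_compat; [apply Rmult_le_pos; [lra|]|]; apply Rmult_le_pos; lra.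
set (delta := eta / (2 * (c1 + 1))).
assert (Hdelta : 0 < delta) by (apply Rdiv_lt_0_compat; lra).
destruct (inverse_below delta Hdelta) as [n2 HN'].
exists (2 * n2)%nat; intros n y Hn Hy HyY.
assert (Zc : forall k t, Ccont (fun s => Z s k) t).
  intros k t; apply (Ccont_ext (fun s => V s k + RtoC (-1) * U s k)%C).
    intros s; unfold Z; rewrite RtoC_m1; ring.
  apply Ccont_plus; [apply (sol_cont _ _ _ HV)|].
  apply Ccont_mult; [apply Ccont_const|apply (sol_cont _ _ _ HU)].
assert (Oc := sympl_cont n Z y Zc (fl_cont _ _ _ _ Hy)).
apply (closed_bound2 T (fun t => fst (sympl n (Z t) (y t))) (fun t => fst (sympl n (Z t) (y t)) + eta)); auto.
  intros t; apply Oc.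
  intros t; apply (continuous_plus (fun t => fst (sympl n (Z t) (y t)))); [apply Oc|apply continuous_const].
(* The box [m] comes after [n]: its tails must beat the number of modes in [Rem]. *)
set (c2 := T * ((2 * INR n + 1) * (2 * r * Y))).
assert (Hn0 := pos_INR n).
assert (Hc2 : 0 <= c2) by (unfold c2; repeat apply Rmult_le_pos; lra).
set (eps := eta / (2 * (c2 + 1))).
assert (Heps : 0 < eps) by (apply Rdiv_lt_0_compat; lra).
destruct (sol_tail _ _ _ HV eps Heps) as [m1 Hm1].
destruct (sol_tail _ _ _ HU eps Heps) as [m2 Hm2].
set (m := (m1 + m2 + 2 * n)%nat).
assert (HVt : forall t, l2 (tailZ m (V t)) eps).
  intros u; apply (l2_tail_mono m1); auto; unfold m; lia.
assert (HUt : forall t, l2 (tailZ m (U t)) eps).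
  intros u; apply (l2_tail_mono m2); auto; unfold m; lia.
set (l := box m). assert (Hl : NoDup l) by apply NoDup_box.
assert (Hl0 : forall k, In k l -> k <> 0%Z) by (intros k; apply in_box_0).
assert (Sy := fl_supp _ _ _ _ Hy).
assert (HSl : forall u, l2 (Sm u) (2 * r)).
  intros u; replace (2 * r) with (r + r) by ring; now apply l2_plus.
assert (HZl : forall u, l2 (Z u) (2 * r)).
  intros u; replace (2 * r) with (r + r) by ring.
  apply (l2_plus (V u) (fun k => - U u k)%C); auto.
  intros L HL; apply (l2le_mod L _ (U u)); [now apply Hr'|intros k; rewrite Cmod_opp; lra].
assert (HyL : forall u, 0 <= u <= T -> l2le l (fun k => Cmod (y u k)) Y).
  intros u Hu; split; auto; split; [intros; apply Cmod_ge_0|].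
  rewrite (rsum_sub (box n) l); auto using NoDup_box; [now apply HyY|unfold l; apply incl_box; unfold m; lia|].
  intros k _ Hk; rewrite Sy, Cmod_0; auto; ring.
set (Sm' := fun t k => (dV NLV t k + dV NLU t k)%C).
set (Z' := fun t k => (dV NLV t k - dV NLU t k)%C).
set (y' := fun t k => (half_ik n k * conv l (Sm t) (y t) k t)%C).
assert (Dy : forall u k, 0 < u < T -> In k l -> Cder (fun v => y v k) u (y' u k)).
  intros u k Hu Hk; apply (flow_der_box T n m Sm y); auto; unfold m; lia.
assert (DS : forall u k, 0 < u < T -> In k l ->
   Cder (fun v => Sm v k) u (Sm' u k) /\ Cmod (Sm' u k) <= Rabs (IZR k) * r ^ 2 /\
   Cder (fun v => Z v k) u (Z' u k) /\ Cmod (Z' u k) <= Rabs (IZR k) * r ^ 2).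
  intros u k Hu Hk.
  destruct (proj2 (proj2 (reg_sol T V NLV r HV Hr l u Hl Hu)) k Hk) as [A1 A2].
  destruct (proj2 (proj2 (reg_sol T U NLU r HU Hr' l u Hl Hu)) k Hk) as [A3 A4].
  split; [now apply Cder_plus|split; [|split]].
  - unfold Sm'; eapply Rle_trans; [apply Cmod_triangle|]; lra.
  - eapply Cder_eq; [eapply Cder_ext; [|apply (Cder_plus _ _ _ _ _ A1 (Cder_scal (RtoC (-1)) _ _ _ A3))]|].
      intros v; unfold Z; cbv beta.
      rewrite RtoC_m1; ring.
    unfold Z'; rewrite RtoC_m1; ring.
  - unfold Z'; eapply Rle_trans; [apply Cmod_triangle|]; rewrite Cmod_opp; lra.
assert (By : forall u k, 0 < u < T -> Cmod (y' u k) <= Rabs (IZR k) * (r * Y)).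
  intros u k Hu; unfold y'; rewrite Cmod_mult.
  replace (Rabs (IZR k) * (r * Y)) with (Rabs (IZR k) / 2 * (2 * r * Y)) by field.
  apply Rmult_le_compat; try apply Cmod_ge_0; [apply Cmod_half_ik|].
  apply Cmod_conv; auto; [now apply HSl|apply HyL; lra].
set (rho := fun t k => ((NLV t k - conv l (V t) (V t) k t) - (NLU t k - conv l (U t) (U t) k t))%C).
set (Rem := fun t => csum (box n) (fun k => Ci * RtoC (/ 2) * rho t k * y t (- k)%Z)%C).
set (F := fun t => tri l (osc (fun a b c => RtoC (-3) * Ci * RtoC (IZR (a * b * c)) * w_flux n a b c)%C t)
  (Sm t) (Z t) (y t)).
set (H := fun t => tri l (osc (w_flux n) t) (Sm t) (Z t) (y t)).
assert (Hw : forall a b c, In a l -> In b l -> In c l ->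
   Cmod (w_flux n a b c) <= if some_above n a b c then / 6 * (inv a * inv b * inv c) else 0).
  intros; apply w_flux_bound; auto.
assert (Hw2 : forall a b c, In a l -> In b l -> In c l ->
   Cmod (w_flux n b a c) <= if some_above n a b c then / 6 * (inv a * inv b * inv c) else 0).
  intros a b c Ha Hb Hc; eapply Rle_trans; [apply Hw; auto|].
  unfold some_above; rewrite (Bool.andb_comm (Z.abs b <=? _)%Z), (Rmult_comm (inv b)); lra.
assert (Hw3 : forall a b c, In a l -> In b l -> In c l ->
   Cmod (w_flux n b c a) <= if some_above n a b c then / 6 * (inv a * inv b * inv c) else 0).
  intros a b c Ha Hb Hc; eapply Rle_trans; [apply Hw; auto|].
  unfold some_above; rewrite (Bool.andb_comm _ (Z.abs a <=? _)%Z), Bool.andb_assoc.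
  replace (inv b * inv c * inv a) with (inv a * inv b * inv c) by ring; lra.
assert (HH : forall t, 0 < t < T -> exists R1, Cder H t (F t + R1)%C /\ Cmod R1 <= 16 / 3 * r ^ 3 * Y * delta).
  intros t Ht; eexists; split.
    apply (Cder_tri l (w_flux n) Sm Z y (Sm' t) (Z' t) (y' t) t); intros k Hk;
      [now apply DS|now apply DS|now apply Dy].
  eapply Rle_trans; [apply Cmod_plus3|].
  assert (T1 : Cmod (tri l (osc (w_flux n) t) (Sm' t) (Z t) (y t)) <= 2 / 3 * r ^ 2 * (2 * r) * Y * delta).
    apply (tri_some_above l _ _ _ _ t n n2); auto; try lra; [apply pow2_ge_0|now apply HZl|apply HyL; lra|].
    intros a Ha; now apply DS.
  assert (T2 : Cmod (tri l (osc (w_flux n) t) (Sm t) (Z' t) (y t)) <= 2 / 3 * r ^ 2 * (2 * r) * Y * delta).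
    rewrite tri_swap12, (tri_ext l _ (osc (fun a b c => w_flux n b a c) t) _ (Z' t) _ (Sm t) _ (y t)).
      apply (tri_some_above l _ _ _ _ t n n2); auto; try lra; [apply pow2_ge_0|now apply HSl|apply HyL; lra|].
      intros a Ha; now apply DS.
    intros; f_equal; unfold osc; do 3 f_equal; ring.
  assert (T3 : Cmod (tri l (osc (w_flux n) t) (Sm t) (Z t) (y' t)) <= 2 / 3 * (r * Y) * (2 * r) * (2 * r) * delta).
    rewrite tri_swap23, tri_swap12, (tri_ext l _ (osc (fun a b c => w_flux n b c a) t) _ (y' t) _ (Sm t) _ (Z t)).
      apply (tri_some_above l _ _ _ _ t n n2); auto; try lra;
        [apply Rmult_le_pos; auto|now apply HSl|now apply HZl].
    intros; f_equal; unfold osc; do 3 f_equal; ring.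
  lra.
assert (HHb : forall t, 0 < t < T -> Cmod (H t) <= 8 / 3 * r ^ 2 * Y * delta).
  intros t Ht; replace (8 / 3 * r ^ 2 * Y * delta) with (2 / 3 * (2 * r) * (2 * r) * Y * delta) by field.
  apply (tri_some_above l _ _ _ _ t n n2); auto; try lra; [now apply HZl|apply HyL; lra|].
  intros a Ha; eapply Rle_trans; [apply (l2le_term l (fun k => Cmod (Sm t k)) (2 * r)); auto; now apply HSl|].
  generalize (Rabs_IZR_ge1 a (Hl0 a Ha)); nra.
assert (HRem : forall t, 0 < t < T -> Cmod (Rem t) <= (2 * INR n + 1) * (2 * r * eps * Y)).
  intros t Ht; unfold Rem; eapply Rle_trans; [apply Cmod_csum|].
  eapply Rle_trans; [|apply (rsum_count (box n) n); [apply NoDup_box|apply Rmult_le_pos; auto; apply Rmult_le_pos; lra]].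
  apply rsum_le; intros k Hk; assert (Hk' := Hk); apply in_box in Hk'.
  destruct (Z.leb_spec (Z.abs k) (Z.of_nat n)); [|lia].
  rewrite !Cmod_mult, Cmod_Ci, Cmod_R, (Rabs_pos_eq (/ 2)), Rmult_1_l by lra.
  apply Rmult_le_compat; try apply Cmod_ge_0.
    apply Rmult_le_pos; [lra|apply Cmod_ge_0].
    assert (Cmod (rho t k) <= 2 * r * eps + 2 * r * eps); [|lra].
    unfold rho; eapply Rle_trans; [apply Cmod_triangle|]; rewrite Cmod_opp; apply Rplus_le_compat.
      now apply (NL_approx T V NLV r HV Hr).
    now apply (NL_approx T U NLU r HU Hr').
  apply (l2le_term l (fun k => Cmod (y t k)) Y); [apply HyL; lra|].
  unfold l; rewrite in_box; unfold m; lia.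
assert (DO : forall t, 0 < t < T -> Cder (fun s => sympl n (Z s) (y s)) t (F t + Rem t)%C).
  intros t Ht; eapply Cder_eq.
    apply Cder_csum; intros k Hk; apply Cder_mult; [|apply Cder_const].
    assert (Hkl : In k l) by (unfold l, m; rewrite in_box in *; lia).
    apply Cder_mult; [now apply DS|apply Dy; auto]; unfold l, m; rewrite in_box in *; lia.
  cbv beta.
  set (g := fun k : BinNums.Z => (RtoC (chi n k) * (Ci * RtoC (/ 2)))%C).
  assert (Hchi : forall k, In k (box n) -> chi n k = 1).
    intros k Hk; apply in_box in Hk; unfold chi; destruct (Z.leb_spec (Z.abs k) (Z.of_nat n)); auto; lia.
  assert (Hci : forall k, k <> 0%Z -> (Ci * RtoC (IZR k / 2) * RtoC (/ IZR k))%C = (Ci * RtoC (/ 2))%C).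
    intros k Hk; rewrite <- Cmult_assoc, <- RtoC_mult; do 2 f_equal; field; now apply not_0_IZR.
  assert (EF : F t = (csum l (fun k => g k * conv l (Sm t) (Z t) k t * y t (- k)%Z)%C +
     RtoC (-1) * csum l (fun k => g k * conv l (Sm t) (y t) k t * Z t (- k)%Z)%C)%C).
    unfold l; rewrite (tri_pair m g), (tri_pair m g), (tri_swap23 _ _ (Sm t) (y t)); fold l.
    rewrite <- tri_scal, <- tri_plus_w; unfold F; apply tri_ext; intros a b c Ha Hb Hc _; f_equal.
    unfold osc, g, w_flux; rewrite !chi_opp.
    replace (- (3 * IZR a * IZR c * IZR b) * t) with (- (3 * IZR a * IZR b * IZR c) * t) by ring.
    set (ex := cexpi _).
    apply Hl0 in Ha; apply Hl0 in Hb; apply Hl0 in Hc.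
    replace (RtoC (-3) * Ci * RtoC (IZR (a * b * c)) * RtoC (/ 6 * (chi n b - chi n c) * / IZR (a * b * c)))%C
      with (Ci * RtoC (-3 * IZR (a * b * c) * (/ 6 * (chi n b - chi n c) * / IZR (a * b * c))))%C
      by (rewrite (RtoC_mult (-3 * _)), (RtoC_mult (-3)); ring).
    replace (-3 * IZR (a * b * c) * (/ 6 * (chi n b - chi n c) * / IZR (a * b * c))) with
      (/ 2 * chi n c + -1 * (/ 2 * chi n b)).
      rewrite RtoC_plus, !RtoC_mult; ring.
    rewrite !mult_IZR; field; repeat split; now apply not_0_IZR.
  rewrite EF; unfold Rem.
  assert (Esub : forall f : BinNums.Z -> C, csum l (fun k => g k * f k)%C = csum (box n) (fun k => Ci * RtoC (/ 2) * f k)%C).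
    intros f; unfold l; rewrite (csum_sub (box n) (box m)); try apply NoDup_box.
    - apply csum_ext; intros k Hk; unfold g; rewrite Hchi by auto; ring.
    - apply incl_box; unfold m; lia.
    - intros k Hkm Hk; rewrite in_box in *; unfold g, chi.
      destruct (Z.leb_spec (Z.abs k) (Z.of_nat n)); [lia|ring].
  rewrite (csum_ext l (fun k => (g k * conv l (Sm t) (Z t) k t * y t (- k)%Z)%C)
     (fun k => (g k * (conv l (Sm t) (Z t) k t * y t (- k)%Z))%C)) by (intros; ring).
  rewrite (csum_ext l (fun k => (g k * conv l (Sm t) (y t) k t * Z t (- k)%Z)%C)
     (fun k => (g k * (conv l (Sm t) (y t) k t * Z t (- k)%Z))%C)) by (intros; ring).
  rewrite !Esub.
  rewrite <- (csum_box_opp n (fun k => (Ci * RtoC (/ 2) * (conv l (Sm t) (y t) k t * Z t (- k)%Z))%C)).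
  rewrite <- csum_scal, <- !csum_plus; apply csum_ext; intros k Hk.
  assert (Hk0 := in_box_0 _ _ Hk).
  rewrite Z.opp_involutive; unfold y', Z', dV, half_ik, rho; rewrite chi_opp, (Hchi k Hk), opp_IZR.
  (* The identity [(V + U)(V - U) = V V - U U] for the symmetric convolution makes the difference
     obey a linear equation. *)
  assert (EC : conv l (Sm t) (Z t) k t = (conv l (V t) (V t) k t - conv l (U t) (U t) k t)%C).
    unfold Sm, Z; rewrite conv_plus_l.
    rewrite (conv_ext l (V t) (V t) (fun k => V t k - U t k)%C (fun k => V t k + RtoC (-1) * U t k)%C);
      auto.
    2:{ intros; rewrite RtoC_m1; ring. }
    rewrite (conv_ext l (U t) (U t) (fun k => V t k - U t k)%C (fun k => V t k + RtoC (-1) * U t k)%C);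
      auto.
    2:{ intros; rewrite RtoC_m1; ring. }
    rewrite !conv_plus_r.
    assert (Eneg : forall p q, conv l p (fun k => RtoC (-1) * q k)%C k t = (- conv l p q k t)%C).
      intros p q; transitivity (RtoC (-1) * conv l p q k t)%C.
        unfold conv; rewrite <- csum_scal; apply csum_ext; intros a _; rewrite <- csum_scal.
        apply csum_ext; intros b _; destruct (_ =? _)%Z; ring.
      rewrite RtoC_m1; ring.
    rewrite !Eneg, (conv_sym l (U t) (V t)); ring.
  rewrite EC, <- (Hci k Hk0).
  replace (RtoC (- IZR k / 2)) with (RtoC (-1) * RtoC (IZR k / 2))%C
    by (rewrite <- RtoC_mult; f_equal; field).
  ring.
intros s t Hs Ht.
set (P := fun t => (sympl n (Z t) (y t) + RtoC (-1) * H t)%C).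
assert (HP : Rabs (fst (P t) - fst (P s)) <=
    (16 / 3 * r ^ 3 * Y * delta + (2 * INR n + 1) * (2 * r * eps * Y)) * Rabs (t - s)).
  (* [HH] provides [R1] separately at each time, so the derivative is named as a function through
     [Derive]. *)
  apply (Lipschitz_interval T P (fun u => (Derive (fun v => fst (P v)) u, Derive (fun v => snd (P v)) u))); auto.
  intros u Hu; destruct (HH u Hu) as (R1 & D1 & B1).
  assert (DP : Cder P u (Rem u + - R1)%C).
    eapply Cder_eq; [apply Cder_plus; [now apply DO|apply Cder_scal, D1]|].
    rewrite RtoC_m1; ring.
  destruct DP as [DP1 DP2].
  assert (E1 : Derive (fun v : R => fst (P v)) u = fst (Rem u + - R1)%C) by (apply is_derive_unique; exact DP1).
  assert (E2 : Derive (fun v : R => snd (P v)) u = snd (Rem u + - R1)%C) by (apply is_derive_unique; exact DP2).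
  cbv beta; rewrite E1, E2, <- surjective_pairing.
  split; [now split|].
  eapply Rle_trans; [apply Cmod_triangle|]; rewrite Cmod_opp; specialize (HRem u Hu); lra.
assert (Hst : Rabs (t - s) <= T) by (apply Rabs_le; lra).
assert (HF : forall u, fst (P u) = fst (sympl n (Z u) (y u)) - fst (H u)).
  intros u; unfold P; simpl; ring.
rewrite !HF in HP.
assert (F1 := Rle_trans _ _ _ (re_le_Cmod (H s)) (HHb s Hs)).
assert (F2 := Rle_trans _ _ _ (re_le_Cmod (H t)) (HHb t Ht)).
unfold Re in F1, F2; apply Rabs_le_between in F1; apply Rabs_le_between in F2.
set (k1 := 16 / 3 * r ^ 3 * Y * delta + (2 * INR n + 1) * (2 * r * eps * Y)) in *.
assert (Hk1 : 0 <= k1).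
  specialize (HRem s Hs); destruct (HH s Hs) as (R1 & _ & B1).
  generalize (Cmod_ge_0 (Rem s)) (Cmod_ge_0 R1); unfold k1; lra.
assert (HP' : k1 * Rabs (t - s) <= k1 * T) by now apply Rmult_le_compat_l.
assert (Hsum : k1 * T + 2 * (8 / 3 * r ^ 2 * Y * delta) <= eta).
  replace (k1 * T + 2 * (8 / 3 * r ^ 2 * Y * delta)) with (c1 * delta + c2 * eps)
    by (unfold k1, c1, c2; field).
  assert (A1 : c1 * delta <= eta / 2).
    unfold delta; apply Rmult_le_reg_r with (2 * (c1 + 1)); [lra|].
    replace (c1 * (eta / (2 * (c1 + 1))) * (2 * (c1 + 1))) with (c1 * eta) by (field; lra); nra.
  assert (A2 : c2 * eps <= eta / 2).
    unfold eps; apply Rmult_le_reg_r with (2 * (c2 + 1)); [lra|].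
    replace (c2 * (eta / (2 * (c2 + 1))) * (2 * (c2 + 1))) with (c2 * eta) by (field; lra); nra.
  lra.
apply Rabs_le_between in HP; lra.
Qed.

(** * From solutions to their Fourier data *)

Lemma rsum_seq_sum_n f n : rsum (seq 0 (S n)) f = sum_n f n.
Proof.
induction n as [|n IH]; [rewrite sum_O; simpl; ring|].
rewrite (seq_S (S n)), rsum_app, IH, sum_Sn; cbn [rsum Nat.add]; unfold plus; simpl; ring.
Qed.

Lemma rsum_seq_le_Series f n : (forall n, 0 <= f n) -> ex_series f -> rsum (seq 0 n) f <= Series f.
Proof.
intros Hf He.
apply Rle_trans with (sum_n f n).
  rewrite <- rsum_seq_sum_n, (seq_S n), rsum_app; cbn [rsum Nat.add]; specialize (Hf n); lra.
apply (is_lim_seq_incr_compare (sum_n f)).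
  exact (Series_correct f He).
intros m; rewrite sum_Sn; unfold plus; simpl; specialize (Hf (S m)); lra.
Qed.

Lemma ex_series_bounded f B : (forall n, 0 <= f n) -> (forall n, rsum (seq 0 n) f <= B) ->
  ex_series f /\ Series f <= B.
Proof.
intros Hf HB.
assert (HBn : forall n, sum_n f n <= B) by (intros; rewrite <- rsum_seq_sum_n; auto).
assert (Hex : ex_series f).
  apply ex_finite_lim_seq_incr with B; auto.
  intros m; rewrite sum_Sn; unfold plus; simpl; specialize (Hf (S m)); lra.
split; auto.
exact (is_lim_seq_le _ _ (Finite _) (Finite B) HBn (Series_correct f Hex) (is_lim_seq_const B)).
Qed.

(** Partial sums of the squared [Hdot s] norm. The base [k^2] is positive for both signs of [k], as
    [Rpower] requires. *)
Definition wbox (s : R) (n : nat) (x : Z -> C) : R :=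
  rsum (box n) (fun k => Rpower (IZR k ^ 2) s * Cmod (x k) ^ 2).

Lemma Rpower_sq x s : 0 < x -> Rpower (x ^ 2) s = Rpower x (2 * s).
Proof. intros Hx; rewrite <- (Rpower_pow 2) by auto; rewrite Rpower_mult; f_equal; simpl; ring. Qed.

Lemma hterm_nonneg s x n : 0 <= hterm s x n.
Proof.
unfold hterm; apply Rmult_le_pos; [left; apply exp_pos|].
generalize (pow2_ge_0 (Cmod (x (Z.of_nat (S n))))) (pow2_ge_0 (Cmod (x (- Z.of_nat (S n))%Z))); lra.
Qed.

Lemma wbox_hterm s n x : wbox s n x = rsum (seq 0 n) (hterm s x).
Proof.
induction n as [|n IH]; [reflexivity|].
unfold wbox; rewrite rsum_box_S; fold (wbox s n x); rewrite IH, seq_S, rsum_app; cbn [rsum Nat.add].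
assert (Hp : 0 < INR (S n)) by (apply lt_0_INR; lia).
assert (E1 : Rpower (IZR (Z.of_nat (S n)) ^ 2) s = Rpower (INR (S n)) (2 * s)).
  rewrite <- INR_IZR_INZ; now apply Rpower_sq.
assert (E2 : Rpower (IZR (- Z.of_nat (S n)) ^ 2) s = Rpower (INR (S n)) (2 * s)).
  rewrite <- E1; f_equal; rewrite opp_IZR; ring.
rewrite E1, E2; unfold hterm; ring.
Qed.

Lemma mass_wbox n x : mass n x = wbox 0 n x.
Proof.
apply rsum_ext; intros k Hk; apply in_box_0 in Hk.
rewrite Rpower_O; [ring|apply pow2_gt_0; now apply not_0_IZR].
Qed.

(** The maximum accounts for the value 0 that [sqrt] takes at negative numbers. *)
Lemma Hnorm_sq s x : Hnorm s x ^ 2 = Rmax 0 (Series (hterm s x)).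
Proof.
unfold Hnorm; destruct (Rle_dec 0 (Series (hterm s x))) as [H|H].
  rewrite pow2_sqrt, Rmax_right; auto.
rewrite sqrt_neg_0, Rmax_left by lra; ring.
Qed.

Lemma wbox_le_Hnorm s n x : in_Hdot s x -> wbox s n x <= Hnorm s x ^ 2.
Proof.
intros Hx; rewrite wbox_hterm, Hnorm_sq.
eapply Rle_trans; [apply rsum_seq_le_Series; [apply hterm_nonneg|exact Hx]|apply Rmax_r].
Qed.

Lemma Hnorm_le s x B : 0 <= B -> (forall n, wbox s n x <= B ^ 2) -> Hnorm s x <= B.
Proof.
intros HB H; unfold Hnorm.
destruct (ex_series_bounded (hterm s x) (B ^ 2)) as [_ HS].
  apply hterm_nonneg. intros n; rewrite <- wbox_hterm; apply H.
rewrite <- (sqrt_pow2 B HB); now apply sqrt_le_1_alt.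
Qed.

Lemma in_Hdot_bounded s x B : (forall n, wbox s n x <= B) -> in_Hdot s x.
Proof.
intros H; apply (ex_series_bounded (hterm s x) B); [apply hterm_nonneg|].
intros n; rewrite <- wbox_hterm; apply H.
Qed.

Lemma wbox_mono s n x : s <= 0 -> wbox s n x <= wbox 0 n x.
Proof.
intros Hs; apply rsum_le; intros k Hk; apply Rmult_le_compat_r; [apply pow2_ge_0|].
assert (HX : 1 <= IZR k ^ 2).
  apply in_box_0 in Hk; rewrite <- (Rabs_pos_eq (IZR k ^ 2)), <- RPow_abs by apply pow2_ge_0.
  generalize (Rabs_IZR_ge1 k Hk); nra.
apply Rle_Rpower; auto.
Qed.

Lemma Cmod_minus_sq x y : Cmod (x - y)%C ^ 2 <= 2 * Cmod x ^ 2 + 2 * Cmod y ^ 2.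
Proof.
assert (H := Cmod_triangle x (- y)%C); rewrite Cmod_opp in H.
assert (H1 := Cmod_ge_0 (x + - y)%C); assert (H2 := Cmod_ge_0 x); assert (H3 := Cmod_ge_0 y).
unfold Cminus; assert (0 <= (Cmod x - Cmod y) ^ 2) by apply pow2_ge_0; nra.
Qed.

Lemma in_Hdot_vsub x y : in_Hdot 0 x -> in_Hdot 0 y -> in_Hdot 0 (vsub x y).
Proof.
intros Hx Hy; apply (in_Hdot_bounded 0 _ (2 * Hnorm 0 x ^ 2 + 2 * Hnorm 0 y ^ 2)); intros n.
assert (H1 := wbox_le_Hnorm 0 n x Hx); assert (H2 := wbox_le_Hnorm 0 n y Hy).
rewrite <- mass_wbox in *.
apply Rle_trans with (2 * mass n x + 2 * mass n y); [|lra].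
unfold mass; rewrite <- !rsum_scal, <- rsum_plus; apply rsum_le; intros k _; apply Cmod_minus_sq.
Qed.

(** A [seqZ] carries an arbitrary entry at index 0; setting it to zero allows sums over arbitrary
    lists of integers. *)
Definition drop_zero (x : Z -> C) (k : Z) : C := if (k =? 0)%Z then RtoC 0 else x k.

Lemma wbox_drop_zero s n x : wbox s n (drop_zero x) = wbox s n x.
Proof.
apply rsum_ext; intros k Hk; apply in_box_0 in Hk; unfold drop_zero.
destruct (Z.eqb_spec k 0); [tauto|auto].
Qed.

Lemma l2_mass x m : 0 <= m -> x 0%Z = RtoC 0 -> (forall n, mass n x <= m ^ 2) -> l2 x m.
Proof.
intros Hm H0 H l Hl; split; [auto|split; [intros; apply Cmod_ge_0|]].
destruct (list_bound l) as [n Hn].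
apply Rle_trans with (rsum (0%Z :: box n) (fun k => Cmod (x k) ^ 2)).
  apply rsum_incl; auto; [|intros; apply pow2_ge_0].
  intros k Hk; destruct (Z.eq_dec k 0) as [->|]; [now left|right; apply in_box].
  specialize (Hn k Hk); lia.
cbn [rsum]; rewrite H0, Cmod_0; specialize (H n); unfold mass in H; lra.
Qed.

Lemma l2_mass_le x m n : l2 x m -> mass n x <= m ^ 2.
Proof. intros H; exact (proj2 (proj2 (H (box n) (NoDup_box n)))). Qed.

Lemma l2_drop_zero x : in_Hdot 0 x -> l2 (drop_zero x) (Hnorm 0 x).
Proof.
intros Hx; apply l2_mass; [apply sqrt_pos|reflexivity|].
intros n; rewrite mass_wbox, wbox_drop_zero; now apply wbox_le_Hnorm.
Qed.

Lemma mass_tail n M x : (n <= M)%nat -> mass M (tailZ n x) + mass n x = mass M x.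
Proof.
intros H; unfold mass.
rewrite <- (rsum_ext (box n) (fun k => Cmod (cut n x k) ^ 2)).
  rewrite <- (rsum_sub (box n) (box M)); auto using NoDup_box, incl_box.
    rewrite <- rsum_plus; apply rsum_ext; intros k _; unfold tailZ, cut.
    destruct (_ <=? _)%Z; rewrite Cmod_0; ring.
  intros k Hk Hk'; rewrite cut_out, Cmod_0; auto; [ring|eapply in_box_0; eauto].
intros k Hk; apply in_box in Hk; unfold cut; destruct (Z.leb_spec (Z.abs k) (Z.of_nat n)); auto; lia.
Qed.

Lemma mass_incr n M x : (n <= M)%nat -> mass n x <= mass M x.
Proof. intros H; rewrite <- (mass_tail n M x H); generalize (mass_nonneg M (tailZ n x)); lra. Qed.

(** The partial masses increase to a finite limit, and the mass beyond [n] is at most what is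
    missing at [n]. *)
Lemma tail_exists x m eps : l2 x m -> 0 < eps -> exists n, l2 (tailZ n x) eps.
Proof.
intros Hx He.
assert (He2 : 0 < eps ^ 2) by now apply pow_lt.
destruct (ex_finite_lim_seq_incr (fun n => mass n x) (m ^ 2)) as [L HL].
  intros n; apply mass_incr; auto. intros n; now apply l2_mass_le.
assert (Hinc : forall n, mass n x <= L).
  intros n; apply (is_lim_seq_incr_compare (fun n => mass n x)); auto; intros; apply mass_incr; auto.
apply is_lim_seq_spec in HL; destruct (HL (mkposreal _ He2)) as [n Hn]; exists n.
specialize (Hn n (le_n _)); simpl in Hn; apply Rabs_def2 in Hn.
apply l2_mass; [lra|unfold tailZ; destruct (Z.leb_spec (Z.abs 0) (Z.of_nat n)); [auto|simpl in *; lia]|].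
intros M; destruct (le_lt_dec n M) as [HnM|HnM].
  generalize (mass_tail n M x HnM) (Hinc M); lra.
unfold mass; rewrite (rsum_ext _ _ (fun _ => 0)), rsum_0; [lra|].
intros k Hk; apply in_box in Hk; unfold tailZ; destruct (Z.leb_spec (Z.abs k) (Z.of_nat n)); [rewrite Cmod_0; ring|lia].
Qed.

(** Compactness of [[0,T]] by a supremum: [E] collects the [x] such that one index serves all of
    [[0,x]], and monotonicity in the index merges two neighbourhoods. *)
Lemma compact_nat T (P : nat -> R -> Prop) : 0 <= T ->
  (forall n m t, (n <= m)%nat -> P n t -> P m t) ->
  (forall t, 0 <= t <= T -> exists n d, 0 < d /\ forall s, 0 <= s <= T -> Rabs (s - t) < d -> P n s) ->
  exists n, forall t, 0 <= t <= T -> P n t.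
Proof.
intros HT Hmono Hloc.
set (E := fun x => 0 <= x <= T /\ exists n, forall s, 0 <= s <= x -> P n s).
assert (E0 : E 0).
  split; [lra|]; destruct (Hloc 0) as (n & d & Hd & Hn); [lra|]; exists n.
  intros s Hs; apply Hn; [lra|]; replace (s - 0) with 0 by lra; now rewrite Rabs_R0.
destruct (completeness E) as [c [Hub Hlub]].
  exists T; intros x [Hx _]; lra. now exists 0.
assert (Hc : 0 <= c <= T) by (split; [now apply Hub|apply Hlub; intros x [Hx _]; lra]).
destruct (Hloc c Hc) as (n & d & Hd & Hn).
assert (Hx : exists x, E x /\ c - d < x).
  apply NNPP; intros Hno; assert (c <= c - d); [|lra].
  apply Hlub; intros x Hx; apply Rnot_lt_le; intros Hlt; apply Hno; eauto.
destruct Hx as (x & [Hx [n' Hn']] & Hxc).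
set (y := Rmin T (c + d / 2)).
assert (Hy : y <= T /\ y <= c + d / 2) by (split; [apply Rmin_l|apply Rmin_r]).
assert (Hall : forall s, 0 <= s <= y -> P (n + n')%nat s).
  intros s Hs; destruct (Rle_dec s x) as [Hsx|Hsx].
    apply (Hmono n'); [lia|apply Hn'; lra].
  apply (Hmono n); [lia|apply Hn; [lra|apply Rabs_def1; lra]].
destruct (Rle_dec T (c + d / 2)) as [Hd'|Hd'].
  exists (n + n')%nat; intros s Hs; apply Hall; unfold y; rewrite Rmin_left; auto.
exfalso; assert (Hy' : y = c + d / 2) by (apply Rmin_right; lra).
assert (y <= c); [|lra].
apply Hub; split; [lra|eauto].
Qed.

Lemma Cmod_le_parts c : Cmod c <= Rabs (fst c) + Rabs (snd c).
Proof.
assert (H0 := Cmod_ge_0 c); assert (H := Cmod2_alt c); unfold Re, Im in H.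
assert (H1 := Rabs_pos (fst c)); assert (H2 := Rabs_pos (snd c)).
assert (E1 : Rabs (fst c) ^ 2 = fst c ^ 2) by apply pow2_abs.
assert (E2 : Rabs (snd c) ^ 2 = snd c ^ 2) by apply pow2_abs.
nra.
Qed.

Lemma Rabs_snd_le c : Rabs (snd c) <= Cmod c.
Proof. eapply Rle_trans; [apply Rmax_r|apply Rmax_Cmod]. Qed.

(* Unlike in [conv], only the first index is restricted to the box, as in the partial sums of [nl_term]. *)
Definition nl_partial (m : nat) (x : Z -> C) (k : Z) (t : R) : C :=
  csum (box m) (fun a => cexpi (3 * IZR k * IZR a * IZR (k - a) * t) * (x a * x (k - a)%Z))%C.

(** In the difference the second index [k - a] lies beyond [m], and Cauchy-Schwarz applies. *)
Lemma nl_partial_conv m x k t r eps : x 0%Z = RtoC 0 -> l2 x r -> l2 (tailZ m x) eps ->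
  Cmod (nl_partial m x k t - conv (box m) x x k t)%C <= r * eps.
Proof.
intros H0 Hr He.
set (tl := fun a => tailZ m x (k - a)%Z).
assert (E : (nl_partial m x k t - conv (box m) x x k t)%C =
  csum (box m) (fun a => cexpi (3 * IZR k * IZR a * IZR (k - a) * t) * (x a * tl a))%C).
  unfold nl_partial, conv.
  assert (EC : forall a, csum (box m) (fun b => if (a + b =? k)%Z then
     cexpi (3 * IZR k * IZR a * IZR b * t) * (x a * x b) else RtoC 0)%C =
     (cexpi (3 * IZR k * IZR a * IZR (k - a) * t) * (x a * cut m x (k - a)%Z))%C).
    intros a; destruct (in_dec Z.eq_dec (k - a)%Z (box m)) as [Hi|Hi].
      rewrite (csum_single _ _ (k - a)%Z (NoDup_box m) Hi).
        destruct (Z.eqb_spec (a + (k - a)) k); [|lia].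
        apply in_box in Hi; unfold cut; destruct (Z.leb_spec (Z.abs (k - a)) (Z.of_nat m)); [auto|lia].
      intros b _ Hb; destruct (Z.eqb_spec (a + b) k); auto; lia.
    rewrite (csum_ext _ _ (fun _ => RtoC 0)), csum_0.
      destruct (Z.eq_dec (k - a) 0) as [Ek|Ek].
        unfold cut; rewrite Ek, H0; destruct (_ <=? _)%Z; ring.
      rewrite (cut_out m x (k - a)); auto; ring.
    intros b Hb; destruct (Z.eqb_spec (a + b) k); auto.
    exfalso; apply Hi; now replace (k - a)%Z with b by lia.
  rewrite (csum_ext (box m) (fun a => csum (box m) _) _ (fun a _ => EC a)).
  replace (csum (box m) (fun a => cexpi (3 * IZR k * IZR a * IZR (k - a) * t) * (x a * x (k - a)%Z))%C) with
    (csum (box m) (fun a => cexpi (3 * IZR k * IZR a * IZR (k - a) * t) * (x a * tl a))%C +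
     csum (box m) (fun a => cexpi (3 * IZR k * IZR a * IZR (k - a) * t) * (x a * cut m x (k - a)%Z))%C)%C.
    ring.
  rewrite <- csum_plus; apply csum_ext; intros a _.
  unfold tl; rewrite <- (cut_tail m x (k - a)%Z) at 1; ring.
rewrite E; eapply Rle_trans; [apply Cmod_csum|].
rewrite (rsum_ext _ _ (fun a => Cmod (x a) * Cmod (tl a)))
  by (intros; rewrite !Cmod_mult, Cmod_cexpi; ring).
apply rsum_CS.
- exact (proj1 (Hr nil (NoDup_nil _))).
- exact (proj1 (He nil (NoDup_nil _))).
- now apply l2_mass_le.
- unfold tl; rewrite <- (rsum_map (fun a => k - a)%Z (box m) (fun b => Cmod (tailZ m x b) ^ 2)).
  apply He, NoDup_map_inj; [intros; lia|apply NoDup_box].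
Qed.

(** The series converges absolutely by Cauchy-Schwarz. A zero entry at index 0 removes [k1 = 0] and
    [k1 = k], exactly the indices excluded in [nl_summand]. *)
Lemma nl_term_lim x k t r : l2 (drop_zero x) r ->
  forall rho, 0 < rho -> exists m0, forall m, (m0 <= m)%nat ->
    Cmod (nl_partial m (drop_zero x) k t - nl_term x k t)%C <= rho.
Proof.
intros Hr rho Hrho.
set (X := drop_zero x).
set (f := fun n => (nl_summand x k t (Z.of_nat (S n)) + nl_summand x k t (- Z.of_nat (S n))%Z)%C).
assert (Hs : forall a, a <> 0%Z -> nl_summand x k t a =
   (cexpi (3 * IZR k * IZR a * IZR (k - a) * t) * (X a * X (k - a)%Z))%C).
  intros a Ha; unfold nl_summand, X, drop_zero.
  destruct (Z.eqb_spec a 0), (Z.eqb_spec a k), (Z.eqb_spec (k - a) 0); simpl; try tauto; try lia; ring.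
assert (Hpart : forall n, csum (seq 0 n) f = nl_partial n X k t).
  induction n as [|n IH]; [reflexivity|].
  unfold nl_partial; rewrite csum_box_S; fold (nl_partial n X k t).
  rewrite <- IH, seq_S, csum_app; cbn [csum Nat.add]; unfold f at 2.
  rewrite !Hs by lia; ring.
assert (Habs : forall n, rsum (seq 0 n) (fun j => Cmod (f j)) <= r * r).
  intros n; apply Rle_trans with (rsum (box n) (fun a => Cmod (X a) * Cmod (X (k - a)%Z))).
    induction n as [|n IH]; [simpl; lra|].
    rewrite rsum_box_S, seq_S, rsum_app; cbn [rsum Nat.add].
    assert (Hf : Cmod (f n) <= Cmod (X (Z.of_nat (S n))) * Cmod (X (k - Z.of_nat (S n))%Z) +
       Cmod (X (- Z.of_nat (S n))%Z) * Cmod (X (k - - Z.of_nat (S n))%Z)).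
      unfold f; eapply Rle_trans; [apply Cmod_triangle|].
      rewrite !Hs by lia; rewrite !Cmod_mult, !Cmod_cexpi; lra.
    lra.
  assert (r0 : 0 <= r) by exact (proj1 (Hr nil (NoDup_nil _))).
  apply rsum_CS; auto; [now apply l2_mass_le|].
  rewrite <- (rsum_map (fun a => k - a)%Z (box n) (fun b => Cmod (X b) ^ 2)).
  apply Hr, NoDup_map_inj; [intros; lia|apply NoDup_box].
assert (Hex : forall p : C -> R, (forall c, Rabs (p c) <= Cmod c) -> ex_series (fun n => p (f n))).
  intros p Hp; apply ex_series_Rabs.
  apply (ex_series_bounded (fun n => Rabs (p (f n))) (r * r)); [intros; apply Rabs_pos|].
  intros n; apply Rle_trans with (2 := Habs n); apply rsum_le; auto.
assert (Hlim : forall p : C -> R, (forall c, Rabs (p c) <= Cmod c) ->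
   exists m0, forall m, (m0 <= m)%nat -> Rabs (rsum (seq 0 m) (fun n => p (f n)) - Series (fun n => p (f n))) <= rho / 2).
  intros p Hp.
  assert (HS := Series_correct _ (Hex p Hp)).
  assert (HS' : is_lim_seq (sum_n (fun n => p (f n))) (Series (fun n => p (f n)))) by exact HS.
  apply is_lim_seq_spec in HS'.
  assert (Hr2 : 0 < rho / 2) by lra.
  destruct (HS' (mkposreal _ Hr2)) as [m0 Hm0]; exists (S m0); intros m Hm.
  destruct m as [|m]; [lia|]; rewrite rsum_seq_sum_n; left; apply Hm0; lia.
destruct (Hlim fst re_le_Cmod) as [m1 Hm1].
destruct (Hlim snd Rabs_snd_le) as [m2 Hm2].
exists (m1 + m2)%nat; intros m Hm.
rewrite <- Hpart, csum_parts.
eapply Rle_trans; [apply Cmod_le_parts|].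
specialize (Hm1 m ltac:(lia)); specialize (Hm2 m ltac:(lia)).
unfold nl_term, Cminus, Cplus, Copp; cbn [fst snd].
change (Rabs (rsum (seq 0 m) (fun n => fst (f n)) - Series (fun n => fst (f n))) +
        Rabs (rsum (seq 0 m) (fun n => snd (f n)) - Series (fun n => snd (f n))) <= rho).
lra.
Qed.

(** Freezes a solution outside [[0,T]], so that continuity holds at every real time. *)
Definition clamp (T t : R) : R := Rmax 0 (Rmin t T).

Lemma clamp_in T t : 0 < T -> 0 <= clamp T t <= T.
Proof.
intros HT; unfold clamp; split; [apply Rmax_l|].
apply Rmax_lub; [lra|apply Rmin_r].
Qed.

Lemma clamp_id T t : 0 <= t <= T -> clamp T t = t.
Proof. intros H; unfold clamp; rewrite Rmin_left, Rmax_right; lra. Qed.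

Lemma clamp_lip T s t : Rabs (clamp T s - clamp T t) <= Rabs (s - t).
Proof.
unfold clamp, Rmax, Rmin.
destruct (Rle_dec s T), (Rle_dec t T); repeat (destruct (Rle_dec _ _)); unfold Rabs; repeat destruct (Rcase_abs _); lra.
Qed.

Lemma locally_interval T t : 0 < t < T -> locally t (fun s => 0 < s < T).
Proof.
intros Ht; assert (Hmin : 0 < Rmin t (T - t)) by (apply Rmin_case; lra).
exists (mkposreal _ Hmin); intros s Hs.
unfold ball in Hs; simpl in Hs; unfold AbsRing_ball, abs, minus, plus, opp in Hs; simpl in Hs.
apply Rabs_def2 in Hs; generalize (Rmin_l t (T - t)) (Rmin_r t (T - t)); lra.
Qed.

(** Continuity in [H^0] and compactness of [[0,T]] give a common radius and uniform tails. The
    radius [r] is crude and depends on the solution; [solution_l2_bound] later replaces it by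
    [M]. *)
Lemma solution_sol T v0 v : 0 < T -> is_solution T v0 v ->
  exists r, (forall t, l2 (drop_zero (v (clamp T t))) r) /\
    sol T (fun t => drop_zero (v (clamp T t))) (fun t k => nl_term (v t) k t).
Proof.
intros HT (Hin & Hcont & Heq).
set (V := fun t => drop_zero (v (clamp T t))).
assert (HVin : forall t, in_Hdot 0 (v (clamp T t))) by (intros t; apply Hin, clamp_in, HT).
assert (Hclose : forall t eps, 0 <= t <= T -> 0 < eps -> exists d, 0 < d /\ forall s, 0 <= s <= T ->
   Rabs (s - t) < d -> l2 (fun k => V s k - V t k)%C eps).
  intros t eps Ht He; destruct (Hcont t Ht eps He) as (d & Hd & Hd'); exists d; split; auto.
  intros s Hs Hst; specialize (Hd' s Hs Hst).
  assert (H2 := l2_drop_zero _ (in_Hdot_vsub _ _ (proj2 (Hin s Hs)) (proj2 (Hin t Ht)))).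
  intros l Hl; destruct (H2 l Hl) as (P1 & P2 & P3); split; [lra|split; [intros; apply Cmod_ge_0|]].
  apply Rle_trans with (Hnorm 0 (vsub (v s) (v t)) ^ 2); [|nra].
  apply Rle_trans with (2 := P3); apply Req_le, rsum_ext; intros k _.
  unfold V, drop_zero, vsub; rewrite !clamp_id by auto; destruct (k =? 0)%Z; [|auto].
  replace (RtoC 0 - RtoC 0)%C with (RtoC 0) by ring; auto.
destruct (compact_nat T (fun n t => l2 (V t) (INR n))) as [N HN]; [lra|..].
  intros n m t Hnm H l Hl; destruct (H l Hl) as (P1 & P2 & P3).
  assert (INR n <= INR m) by now apply le_INR.
  split; [lra|split; [auto|nra]].
  intros t Ht; destruct (Hclose t 1 Ht Rlt_0_1) as (d & Hd & Hd').
  destruct (INR_above (Hnorm 0 (v t) + 1)) as (n & _ & Hn); exists n, d; split; auto.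
  intros s Hs Hst; specialize (Hd' s Hs Hst).
  assert (HVt : l2 (V t) (Hnorm 0 (v t))).
    unfold V; rewrite clamp_id by auto; apply l2_drop_zero, Hin, Ht.
  intros l Hl; destruct (l2_plus _ _ _ _ HVt Hd' l Hl) as (P1 & P2 & P3).
  split; [lra|split; [intros; apply Cmod_ge_0|]].
  apply Rle_trans with ((Hnorm 0 (v t) + 1) ^ 2); [|nra].
  apply Rle_trans with (2 := P3); apply Req_le, rsum_ext; intros k _; do 2 f_equal; ring.
assert (Hr : forall t, l2 (V t) (INR N)).
  intros t; specialize (HN (clamp T t) (clamp_in T t HT)).
  unfold V in HN; rewrite (clamp_id T (clamp T t)) in HN by now apply clamp_in.
  exact HN.
exists (INR N); split; [exact Hr|].
assert (Htail : forall eps, 0 < eps -> exists n, forall t, l2 (tailZ n (V t)) eps).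
  intros eps He.
  destruct (compact_nat T (fun n t => l2 (tailZ n (V t)) eps)) as [n Hn]; [lra|..].
    intros n m t Hnm H; now apply (l2_tail_mono n m).
    intros t Ht; assert (He2 : 0 < eps / 2) by lra.
    destruct (Hclose t (eps / 2) Ht He2) as (d & Hd & Hd').
    destruct (tail_exists _ _ _ (Hr t) He2) as [n Hn]; exists n, d; split; auto.
    intros s Hs Hst; specialize (Hd' s Hs Hst).
    assert (Hsum : l2 (fun k => tailZ n (V t) k + tailZ n (fun k => V s k - V t k)%C k)%C (eps / 2 + eps / 2)).
      apply l2_plus; auto; intros l Hl; apply (l2le_mod l _ _ _ (Hd' l Hl)); intros; apply Cmod_tail.
    intros l Hl; destruct (Hsum l Hl) as (P1 & P2 & P3).
    replace (eps / 2 + eps / 2) with eps in P3 by field.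
    split; [lra|split; [intros; apply Cmod_ge_0|]].
    apply Rle_trans with (2 := P3); apply Req_le, rsum_ext; intros k _; do 2 f_equal.
    unfold tailZ; destruct (_ <=? _)%Z; ring.
  exists n; intros t; specialize (Hn (clamp T t) (clamp_in T t HT)).
  unfold V in Hn; rewrite (clamp_id T (clamp T t)) in Hn by now apply clamp_in.
  exact Hn.
assert (Vc : forall k t, Ccont (fun s => V s k) t).
  intros k t.
  assert (HL : forall eps : posreal, locally t (fun s => Cmod (V s k - V t k)%C < eps)).
    intros eps; assert (He2 : 0 < eps / 2) by (generalize (cond_pos eps); lra).
    destruct (Hclose (clamp T t) (eps / 2) (clamp_in T t HT) He2) as (d & Hd & Hd').
    exists (mkposreal d Hd); intros s Hs.
    assert (Hs' : Rabs (clamp T s - clamp T t) < d) by (eapply Rle_lt_trans; [apply clamp_lip|exact Hs]).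
    specialize (Hd' (clamp T s) (clamp_in T s HT) Hs').
    unfold V in Hd'; rewrite !(clamp_id T (clamp T _)) in Hd' by now apply clamp_in.
    assert (Hk := l2le_term (k :: nil) _ _ k (Hd' (k :: nil) ltac:(constructor; [tauto|constructor])) (or_introl eq_refl)).
    cbv beta in Hk; unfold V; generalize (cond_pos eps); lra.
  split; apply filterlim_locally; intros eps; generalize (HL eps); apply filter_imp; intros s Hs;
    (eapply Rle_lt_trans; [|exact Hs]).
    apply (re_le_Cmod (V s k - V t k)%C).
  apply (Rabs_snd_le (V s k - V t k)%C).
assert (V0 : forall t, V t 0%Z = RtoC 0) by reflexivity.
assert (Hlim : forall t k rho, 0 < t < T -> 0 < rho -> exists m0, forall m, (m0 <= m)%nat ->
    Cmod (conv (box m) (V t) (V t) k t - nl_term (v t) k t)%C <= rho).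
  intros t k rho Ht Hrho.
  assert (EV : V t = drop_zero (v t)) by (unfold V; rewrite clamp_id by lra; auto).
  assert (Hrt := Hr t); rewrite EV in Hrt.
  destruct (nl_term_lim (v t) k t _ Hrt (rho / 2)) as [m1 Hm1]; [lra|].
  assert (Hp := pos_INR N).
  destruct (Htail (rho / (2 * (INR N + 1)))) as [m2 Hm2]; [apply Rdiv_lt_0_compat; lra|].
  exists (m1 + m2)%nat; intros m Hm; rewrite EV.
  specialize (Hm1 m ltac:(lia)).
  assert (Ht2 := l2_tail_mono m2 m _ _ ltac:(lia) (Hm2 t)); rewrite EV in Ht2.
  assert (HC := nl_partial_conv m _ k t _ _ eq_refl Hrt Ht2).
  replace (conv (box m) (drop_zero (v t)) (drop_zero (v t)) k t - nl_term (v t) k t)%C with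
    ((nl_partial m (drop_zero (v t)) k t - nl_term (v t) k t) +
     - (nl_partial m (drop_zero (v t)) k t - conv (box m) (drop_zero (v t)) (drop_zero (v t)) k t))%C by ring.
  eapply Rle_trans; [apply Cmod_triangle|]; rewrite Cmod_opp.
  assert (INR N * (rho / (2 * (INR N + 1))) <= rho / 2); [|lra].
  apply Rmult_le_reg_r with (2 * (INR N + 1)); [lra|].
  replace (INR N * (rho / (2 * (INR N + 1))) * (2 * (INR N + 1))) with (INR N * rho) by (field; lra); nra.
split; auto.
- intros t k; unfold V, drop_zero; destruct (Z.eqb_spec k 0), (Z.eqb_spec (- k) 0); try lia.
    now rewrite Cconj_0.
  now apply (Hin _ (clamp_in T t HT)).
- intros t k Ht.
  destruct (Z.eq_dec k 0) as [->|Hk].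
    eapply Cder_eq; [apply (Cder_ext (fun _ => RtoC 0)); [intros; now rewrite V0|apply Cder_const]|].
    unfold Rdiv; rewrite Rmult_0_l; ring.
  set (g := fun tau => nl_term (v tau) k tau).
  (* The nonlinear term is a uniform limit of box convolutions, each continuous in time; its
     continuity lets the integral equation be differentiated. *)
  assert (Hg : Ccont g t).
    assert (HL : forall eps : posreal, locally t (fun s => Cmod (g s - g t)%C < eps)).
      intros eps; assert (He := cond_pos eps); assert (Hp := pos_INR N).
      destruct (Htail (eps / (8 * (INR N + 1)))) as [m Hm]; [apply Rdiv_lt_0_compat; lra|].
      assert (Hap : forall s, 0 < s < T -> Cmod (g s - conv (box m) (V s) (V s) k s)%C <= eps / 4).
        intros s Hs; eapply Rle_trans.
          apply (conv_limit_approx _ _ _ k s m _ (Hr s) (Hm s)); intros rho Hrho; now apply Hlim.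
        apply Rmult_le_reg_r with (8 * (INR N + 1)); [lra|].
        replace (2 * INR N * (eps / (8 * (INR N + 1))) * (8 * (INR N + 1))) with (2 * INR N * eps) by (field; lra); nra.
      assert (Hcc : Ccont (fun s => conv (box m) (V s) (V s) k s) t).
        unfold conv; apply Ccont_csum; intros a _; apply Ccont_csum; intros b _.
        destruct (_ =? _)%Z; [|apply Ccont_const].
        apply Ccont_mult; [apply Ccont_cexpi|apply Ccont_mult; apply Vc].
      destruct Hcc as [Hc1 Hc2].
      assert (He8 : 0 < eps / 8) by lra.
      assert (L1 := proj1 (filterlim_locally _ _) Hc1 (mkposreal _ He8)).
      assert (L2 := proj1 (filterlim_locally _ _) Hc2 (mkposreal _ He8)).
      assert (L3 := locally_interval T t Ht).
      generalize (filter_and _ _ L3 (filter_and _ _ L1 L2)); apply filter_imp; intros s (Hs & B1 & B2).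
      assert (B : Cmod (conv (box m) (V s) (V s) k s - conv (box m) (V t) (V t) k t)%C < eps / 4).
        eapply Rle_lt_trans; [apply Cmod_le_parts|].
        unfold ball in B1, B2; simpl in B1, B2; unfold AbsRing_ball, abs, minus, plus, opp in B1, B2; simpl in B1, B2.
        simpl; lra.
      replace (g s - g t)%C with ((g s - conv (box m) (V s) (V s) k s) +
        (conv (box m) (V s) (V s) k s - conv (box m) (V t) (V t) k t) +
        - (g t - conv (box m) (V t) (V t) k t))%C by ring.
      eapply Rle_lt_trans; [apply Cmod_plus3|]; rewrite Cmod_opp.
      generalize (Hap s Hs) (Hap t Ht); lra.
    split; apply filterlim_locally; intros eps; generalize (HL eps); apply filter_imp; intros s Hs;
      (eapply Rle_lt_trans; [|exact Hs]).
      apply (re_le_Cmod (g s - g t)%C).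
    apply (Rabs_snd_le (g s - g t)%C).
  set (I1 := fun s => RInt (fun tau => fst (g tau)) 0 s).
  set (I2 := fun s => RInt (fun tau => snd (g tau)) 0 s).
  assert (HI : forall s, 0 <= s <= T -> is_RInt (fun tau => fst (g tau)) 0 s (I1 s) /\
     is_RInt (fun tau => snd (g tau)) 0 s (I2 s) /\
     v s k = (v0 k + RtoC (1 / 2) * (Ci * RtoC (IZR k)) * (I1 s, I2 s))%C).
    intros s Hs; destruct (Heq k Hk s Hs) as (I & HI & HE).
    assert (J1 : is_RInt (fun tau => fst (g tau)) 0 s (fst I)).
      apply (@is_RInt_fct_extend_fst R_NormedModule R_NormedModule g 0 s I); exact HI.
    assert (J2 : is_RInt (fun tau => snd (g tau)) 0 s (snd I)).
      apply (@is_RInt_fct_extend_snd R_NormedModule R_NormedModule g 0 s I); exact HI.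
    assert (K1 : I1 s = fst I) by (apply is_RInt_unique; exact J1).
    assert (K2 : I2 s = snd I) by (apply is_RInt_unique; exact J2).
    rewrite K1, K2; split; [exact J1|split; [exact J2|]].
    rewrite <- surjective_pairing, <- HE; ring.
  assert (L3 := locally_interval T t Ht).
  destruct Hg as [Hg1 Hg2].
  assert (D1 : is_derive I1 t (fst (g t))).
    apply (is_derive_RInt (fun tau => fst (g tau)) I1 0); auto.
    generalize L3; apply filter_imp; intros s Hs; exact (proj1 (HI s ltac:(lra))).
  assert (D2 : is_derive I2 t (snd (g t))).
    apply (is_derive_RInt (fun tau => snd (g tau)) I2 0); auto.
    generalize L3; apply filter_imp; intros s Hs; exact (proj1 (proj2 (HI s ltac:(lra)))).
  assert (DC : Cder (fun s => v0 k + RtoC (1 / 2) * (Ci * RtoC (IZR k)) * (I1 s, I2 s))%C t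
     (Ci * RtoC (IZR k / 2) * g t)%C).
    eapply Cder_eq; [apply Cder_plus; [apply Cder_const|apply (Cder_scal _ (fun s => (I1 s, I2 s)) t (g t)); now split]|].
    replace (IZR k / 2) with (1 / 2 * IZR k) by field; rewrite RtoC_mult; ring.
  destruct DC as [DC1 DC2]; split; eapply is_derive_ext_loc; [|exact DC1| |exact DC2];
    generalize L3; apply filter_imp; intros s Hs; unfold V, drop_zero; rewrite clamp_id by lra;
    destruct (Z.eqb_spec k 0); try tauto;
    now rewrite (proj2 (proj2 (HI s ltac:(lra)))).
Qed.

(** * Lipschitz bound *)

Lemma solution_initial T v0 v k : 0 < T -> is_solution T v0 v -> drop_zero (v 0) k = drop_zero v0 k.
Proof.
intros HT (_ & _ & Heq); unfold drop_zero; destruct (Z.eqb_spec k 0) as [|Hk]; auto.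
destruct (Heq k Hk 0) as (I & HI & HE); [lra|].
assert (J1 : is_RInt (fun tau => fst (nl_term (v tau) k tau)) 0 0 (fst I)).
  apply (@is_RInt_fct_extend_fst R_NormedModule R_NormedModule (fun tau => nl_term (v tau) k tau) 0 0 I HI).
assert (J2 : is_RInt (fun tau => snd (nl_term (v tau) k tau)) 0 0 (snd I)).
  apply (@is_RInt_fct_extend_snd R_NormedModule R_NormedModule (fun tau => nl_term (v tau) k tau) 0 0 I HI).
assert (I0 : I = RtoC 0).
  rewrite (surjective_pairing I), <- (is_RInt_unique _ _ _ _ J1), <- (is_RInt_unique _ _ _ _ J2), !RInt_point.
  reflexivity.
rewrite I0 in HE.
replace (v 0 k) with ((v 0 k - v0 k) + v0 k)%C by ring; rewrite HE; ring.
Qed.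

(** In [mass_conservation] the radius [r] influences only how large the cutoff must be, not the
    final error [eta]. Letting [eta] tend to 0 bounds the solution by its data, and all later
    constants depend on [M] alone. *)
Lemma solution_l2_bound T v0 v M : 0 < T -> in_H0 v0 -> is_solution T v0 v -> Hnorm 0 v0 <= M ->
  forall t, l2 (drop_zero (v (clamp T t))) M.
Proof.
intros HT [_ Hv0] Hsol HM.
assert (H0 : 0 <= Hnorm 0 v0) by apply sqrt_pos.
destruct (solution_sol T v0 v HT Hsol) as (r & Hr & HV).
set (V := fun t => drop_zero (v (clamp T t))) in *.
intros t; apply l2_mass; [lra|reflexivity|]; intros N.
apply le_epsilon; intros eta Heta.
destruct (mass_conservation T V _ r HT HV Hr eta N Heta) as (n & HNn & Hn).
assert (Hc : forall t, continuous (fun s => mass n (V s)) t).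
  apply mass_continuous, (sol_cont _ _ _ HV).
assert (Hle : mass n (V (clamp T t)) <= mass n (V 0) + eta).
  apply (closed_bound2 T (fun t => mass n (V t)) (fun t => mass n (V t) + eta)); auto.
  - intros u; apply (continuous_plus (fun t => mass n (V t))); [apply Hc|apply continuous_const].
  - intros s u Hs Hu; specialize (Hn s u Hs Hu); apply Rabs_le_between in Hn; lra.
  - lra.
  - now apply clamp_in.
assert (E0 : mass n (V 0) = mass n v0).
  apply rsum_ext; intros k Hk; apply in_box_0 in Hk; unfold V; rewrite clamp_id by lra.
  rewrite (solution_initial T v0 v k HT Hsol); unfold drop_zero; destruct (Z.eqb_spec k 0); tauto.
assert (Et : V (clamp T t) = V t).
  unfold V; rewrite (clamp_id T (clamp T t)); auto; now apply clamp_in.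
assert (H1 := mass_incr N n (V t) HNn).
assert (H2 := wbox_le_Hnorm 0 n v0 Hv0); rewrite <- mass_wbox in H2.
rewrite Et, E0 in Hle; fold (V t); nra.
Qed.

Lemma inv_Rpower k : k <> 0%Z -> inv k ^ 2 = Rpower (IZR k ^ 2) (- 1).
Proof.
intros Hk; assert (0 < IZR k ^ 2) by (apply pow2_gt_0; now apply not_0_IZR).
now replace (-1) with (- (1)) by ring; rewrite inv_sq, Rpower_Ropp, Rpower_1.
Qed.

(** The weight [1/|k|] of the form splits as [|k|^theta] times [|k|^{-(1+theta)}], and
    Cauchy-Schwarz follows. *)
Lemma sympl_weighted n theta x y P Q : 0 <= P -> 0 <= Q ->
  wbox theta n x <= P ^ 2 -> weak_mass (1 + theta) n y <= Q ^ 2 -> Cmod (sympl n x y) <= P * Q.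
Proof.
intros HP HQ Hx Hy; unfold sympl; eapply Rle_trans; [apply Cmod_csum|].
apply Rle_trans with (rsum (box n) (fun k => (Rpower (IZR k ^ 2) (theta / 2) * Cmod (x k)) *
  (Rpower (IZR k ^ 2) (- (1 + theta) / 2) * Cmod (y (- k)%Z)))); [|apply rsum_CS; auto].
- apply rsum_le; intros k Hk; apply in_box_0 in Hk.
  rewrite !Cmod_mult, Cmod_R, Rinv_abs_inv by auto.
  assert (E : Rpower (IZR k ^ 2) (theta / 2) * Rpower (IZR k ^ 2) (- (1 + theta) / 2) = inv k).
    rewrite <- Rpower_plus; replace (theta / 2 + - (1 + theta) / 2) with (-1 * / 2) by field.
    rewrite <- Rpower_mult.
    replace (Rpower (IZR k ^ 2) (-1)) with (inv k ^ 2).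
      rewrite Rpower_sqrt; [apply sqrt_pow2, inv_nonneg|].
      apply pow_lt; unfold inv; destruct (Z.eqb_spec k 0); [tauto|].
      apply Rinv_0_lt_compat; generalize (Rabs_IZR_ge1 k Hk); lra.
    rewrite inv_Rpower by auto; f_equal.
  apply Req_le; rewrite <- E; ring.
- apply Rle_trans with (2 := Hx); apply Req_le, rsum_ext; intros k _.
  rewrite Rpow_mult_distr, <- (Rpower_pow 2) by apply exp_pos; rewrite Rpower_mult.
  do 2 f_equal; simpl; field.
- apply Rle_trans with (2 := Hy); unfold weak_mass.
  rewrite <- (rsum_box_opp n (fun k => Rpower (IZR k ^ 2) (- (1 + theta)) * Cmod (y k) ^ 2)).
  apply Req_le, rsum_ext; intros k _.
  rewrite Rpow_mult_distr, <- (Rpower_pow 2 (Rpower _ _)) by apply exp_pos; rewrite Rpower_mult.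
  replace (IZR (- k) ^ 2) with (IZR k ^ 2) by (rewrite opp_IZR; ring).
  do 2 f_equal; simpl; field.
Qed.

(** Duality from the final time: the flow takes the value [h] at [t1] and is followed back to time
    0, where the pairing is bounded by [B] and the weak norm of the flow. This gives
    [A2 <= B sqrt (ci D A2)], hence [A2 <= ci D B^2] with [D = 3 exp (e T)]. *)
Lemma Lipschitz_weak_norm M theta : 0 <= M -> -1 < theta <= 0 -> exists c e : R, 0 < c /\
  forall T V NLV U NLU B, 0 < T -> sol T V NLV -> sol T U NLU ->
  (forall t, l2 (V t) M) -> (forall t, l2 (U t) M) -> 0 <= B ->
  (forall n, wbox theta n (fun k => V 0 k - U 0 k)%C <= B ^ 2) ->
  forall t, 0 <= t <= T -> forall n, wbox theta n (fun k => V t k - U t k)%C <= c * exp (e * T) * B ^ 2.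
Proof.
intros HM Htheta.
destruct (energy_estimate M HM) as (e & He & Hen).
destruct (weak_mass_bound (1 + theta)) as (ci & Hci & Hal); [lra|].
exists (3 * ci), e; split; [lra|].
intros T V NLV U NLU B HT HV HU HVM HUM HB HB0 t1 Ht1 N.
set (S := fun t k => (V t k + U t k)%C). set (Z := fun t k => (V t k - U t k)%C).
set (D := 3 * exp (e * T)).
assert (HD : 0 < D) by (unfold D; generalize (exp_pos (e * T)); lra).
assert (Hmass : forall n y, flow T n S y -> forall s t, 0 <= s <= T -> 0 <= t <= T ->
   mass n (y t) <= D * mass n (y s)).
  intros n y Hy.
  assert (Hc := mass_continuous n y (fl_cont _ _ _ _ Hy)).
  apply (closed_bound2 T (fun t => mass n (y t)) (fun s => D * mass n (y s))); auto.
    intros t; apply (continuous_Rmult (fun _ => D)); [apply continuous_const|apply Hc].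
  intros s t Hs Ht; now apply (Hen T V NLV U NLU n y).
assert (Hex : forall n t0 h, (forall k, ~ In k (box n) -> h k = RtoC 0) ->
   exists y, flow T n S y /\ forall k, y t0 k = h k).
  intros n t0 h Hh; apply (flow_exists T n S (M + M)); auto.
    intros k t; apply Ccont_plus; [apply (sol_cont _ _ _ HV)|apply (sol_cont _ _ _ HU)].
  intros t; now apply l2_plus.
set (A2 := wbox theta N (Z t1)).
assert (HA : 0 <= A2).
  apply rsum_nonneg; intros; apply Rmult_le_pos; [left; apply exp_pos|apply pow2_ge_0].
(* The dual datum: pairing with [h] through [sympl] gives the squared weak norm of [Z t1]. *)
set (h := fun k : BinNums.Z => if mem (box N) k then
   (RtoC (- IZR k * Rpower (IZR k ^ 2) theta) * Cconj (Z t1 (- k)%Z))%C else RtoC 0).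
assert (Hh : forall n k, (N <= n)%nat -> ~ In k (box n) -> h k = RtoC 0).
  intros n k Hn Hk; unfold h; destruct (mem (box N) k) eqn:Em; auto.
  apply memP in Em; exfalso; apply Hk, (incl_box N n); auto.
assert (Hopp : forall n k, In (- k)%Z (box n) <-> In k (box n)) by (intros; rewrite !in_box; lia).
assert (Eom : forall n, (N <= n)%nat -> fst (sympl n (Z t1) h) = A2).
  intros n Hn; unfold sympl; rewrite (csum_sub (box N) (box n)); auto using NoDup_box, incl_box.
    rewrite (csum_ext _ _ (fun k => RtoC (Rpower (IZR k ^ 2) theta * Cmod (Z t1 k) ^ 2))), csum_RtoC; auto.
    intros k Hk; unfold h.
    replace (mem (box N) (- k)) with true by (symmetry; apply memP, Hopp; auto).
    apply in_box_0 in Hk; rewrite Z.opp_involutive, opp_IZR, (RtoC_mult (Rpower _ _) (Cmod _ ^ 2)), Cmod2_conj.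
    replace ((- IZR k) ^ 2) with (IZR k ^ 2) by ring.
    transitivity (RtoC (- - IZR k * Rpower (IZR k ^ 2) theta * / IZR k) * (Z t1 k * Cconj (Z t1 k)))%C.
      rewrite (RtoC_mult (- - IZR k * _)); ring.
    do 2 f_equal; field; now apply not_0_IZR.
  intros k _ Hk; rewrite (Hh N (- k)%Z) by (auto; rewrite Hopp; auto); ring.
assert (Eal : forall n, (N <= n)%nat -> weak_mass (1 + theta) n h = A2).
  intros n Hn; unfold weak_mass, A2, wbox.
  rewrite (rsum_sub (box N) (box n)); auto using NoDup_box, incl_box.
    rewrite <- (rsum_box_opp N (fun k => Rpower (IZR k ^ 2) theta * Cmod (Z t1 k) ^ 2)).
    apply rsum_ext; intros k Hk; unfold h.
    replace (mem (box N) k) with true by (symmetry; apply memP; auto).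
    apply in_box_0 in Hk.
    rewrite Cmod_mult, Cmod_conj, Cmod_R, Rpow_mult_distr, RPow_abs, Rabs_pos_eq by apply pow2_ge_0.
    replace (IZR (- k) ^ 2) with (IZR k ^ 2) by (rewrite opp_IZR; ring).
    assert (HX : 0 < IZR k ^ 2) by (apply pow2_gt_0; now apply not_0_IZR).
    replace ((- IZR k * Rpower (IZR k ^ 2) theta) ^ 2) with
      (IZR k ^ 2 * (Rpower (IZR k ^ 2) theta * Rpower (IZR k ^ 2) theta)) by ring.
    assert (E : Rpower (IZR k ^ 2) (- (1 + theta)) * IZR k ^ 2 * Rpower (IZR k ^ 2) theta = 1).
      rewrite <- (Rpower_1 (IZR k ^ 2)) at 2 by auto; rewrite <- !Rpower_plus.
      replace (- (1 + theta) + 1 + theta) with 0 by ring; now apply Rpower_O.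
    transitivity ((Rpower (IZR k ^ 2) (- (1 + theta)) * IZR k ^ 2 * Rpower (IZR k ^ 2) theta) *
      (Rpower (IZR k ^ 2) theta * Cmod (Z t1 (- k)%Z) ^ 2)); [ring|rewrite E; ring].
  intros k _ Hk; rewrite (Hh N k), Cmod_0; auto; ring.
set (mh := mass N h).
assert (Hmh : forall n, (N <= n)%nat -> mass n h = mh).
  intros n Hn; unfold mh, mass; apply rsum_sub; auto using NoDup_box, incl_box.
  intros k _ Hk; rewrite (Hh N k), Cmod_0; auto; ring.
assert (Hmh0 : 0 <= D * mh) by (apply Rmult_le_pos; [lra|apply mass_nonneg]).
(* [h] is supported in [box N] and stays fixed while [n] grows, so [sqrt (D * mh)] bounds the flows
   uniformly in [n], as [sympl_flux] requires before [n0] is chosen. *)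
assert (Hmain : A2 <= B * sqrt (ci * D * A2)).
  apply le_epsilon; intros eta Heta.
  destruct (sympl_flux T V NLV U NLU M (sqrt (D * mh)) eta HT HV HU HVM HUM (sqrt_pos _) Heta) as [n0 Hn0].
  set (n := (N + n0)%nat).
  assert (HNn : (N <= n)%nat) by (unfold n; lia).
  destruct (Hex n t1 h) as (y & Hy & Eyh); [intros k Hk; now apply (Hh n)|].
  assert (H0T : 0 <= 0 <= T) by lra.
  assert (Em1 : mass n (y t1) = mh).
    rewrite <- (Hmh n HNn); apply rsum_ext; intros k _; now rewrite Eyh.
  assert (Ea1 : weak_mass (1 + theta) n (y t1) = A2).
    rewrite <- (Eal n HNn); apply rsum_ext; intros k _; now rewrite Eyh.
  assert (Eo1 : fst (sympl n (Z t1) (y t1)) = A2).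
    rewrite <- (Eom n HNn); f_equal; apply csum_ext; intros k _; now rewrite Eyh.
  assert (HF := Hn0 n y ltac:(unfold n; lia) Hy).
  assert (HF' : fst (sympl n (Z t1) (y t1)) <= fst (sympl n (Z 0) (y 0)) + eta).
    apply HF; auto; intros t Ht; rewrite pow2_sqrt, <- Em1 by auto; now apply Hmass.
  rewrite Eo1 in HF'.
  assert (Hh0 := Hal T D n S HT (Rlt_le _ _ HD) (Hmass n) (Hex n) y Hy t1 0 Ht1 H0T).
  rewrite Ea1 in Hh0.
  assert (HcD : 0 <= ci * D * A2) by (apply Rmult_le_pos; auto; apply Rmult_le_pos; lra).
  assert (HO : Cmod (sympl n (Z 0) (y 0)) <= B * sqrt (ci * D * A2)).
    apply (sympl_weighted n theta); [exact HB|apply sqrt_pos|apply HB0|rewrite pow2_sqrt; auto].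
  generalize (Rle_trans _ _ _ (re_le_Cmod (sympl n (Z 0) (y 0))) HO); unfold Re; intros HO'.
  apply Rabs_le_between in HO'; lra.
assert (HcD : 0 <= ci * D * A2).
  apply Rmult_le_pos; auto; apply Rmult_le_pos; lra.
assert (Hsq : A2 * A2 <= (B * sqrt (ci * D * A2)) * (B * sqrt (ci * D * A2))) by now apply Rmult_le_compat.
replace ((B * sqrt (ci * D * A2)) * (B * sqrt (ci * D * A2))) with
  (B * B * (sqrt (ci * D * A2) * sqrt (ci * D * A2))) in Hsq by ring.
rewrite sqrt_sqrt in Hsq by auto.
replace (3 * ci * exp (e * T) * B ^ 2) with (ci * D * B ^ 2) by (unfold D; ring).
assert (0 <= ci * D * B ^ 2) by (apply Rmult_le_pos; [apply Rmult_le_pos; lra|apply pow2_ge_0]).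
change (A2 <= ci * D * B ^ 2).
destruct (Req_dec A2 0) as [->|HA0]; [auto|].
apply Rmult_le_reg_r with A2; [lra|].
replace (ci * D * B ^ 2 * A2) with (B * B * (ci * D * A2)) by ring; exact Hsq.
Qed.

Theorem theorem6p7 :
  forall (M theta : R), 0 < M -> -1 < theta <= 0 ->
  exists C' CM : R, 0 < C' /\ 0 < CM /\
    forall (T : R) (v0 w0 : seqZ) (v w : R -> seqZ),
      0 < T ->
      in_H0 v0 -> in_H0 w0 ->
      Hnorm 0 v0 + Hnorm 0 w0 <= M ->
      is_solution T v0 v -> is_solution T w0 w ->
      forall t, 0 <= t <= T ->
        Hnorm theta (vsub (v t) (w t)) <= C' * Rpower CM T * Hnorm theta (vsub v0 w0).
Proof.
intros M theta HM Htheta.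
destruct (Lipschitz_weak_norm M theta) as (c & e & Hc & HL); [lra|auto|].
(* Square roots of the factors in [c exp (e T)], which bounds the squared norm. *)
exists (sqrt c), (exp (e / 2)); split; [now apply sqrt_lt_R0|split; [apply exp_pos|]].
intros T v0 w0 v w HT Hv0 Hw0 HMn Hv Hw t Ht.
assert (P1 : 0 <= Hnorm 0 v0) by apply sqrt_pos.
assert (P2 : 0 <= Hnorm 0 w0) by apply sqrt_pos.
destruct (solution_sol T v0 v HT Hv) as (_ & _ & HV).
destruct (solution_sol T w0 w HT Hw) as (_ & _ & HW).
assert (BV := solution_l2_bound T v0 v M HT Hv0 Hv ltac:(lra)).
assert (BW := solution_l2_bound T w0 w M HT Hw0 Hw ltac:(lra)).
set (B := Hnorm theta (vsub v0 w0)).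
assert (HB : 0 <= B) by apply sqrt_pos.
assert (Hdot : in_Hdot theta (vsub v0 w0)).
  assert (H0 := in_Hdot_vsub v0 w0 (proj2 Hv0) (proj2 Hw0)).
  apply (in_Hdot_bounded theta _ (Hnorm 0 (vsub v0 w0) ^ 2)); intros n.
  eapply Rle_trans; [apply wbox_mono; lra|now apply wbox_le_Hnorm].
assert (Hsub : forall s x y n, wbox s n (fun k => drop_zero x k - drop_zero y k)%C = wbox s n (vsub x y)).
  intros s x y n; apply rsum_ext; intros k Hk; apply in_box_0 in Hk; unfold drop_zero, vsub.
  destruct (Z.eqb_spec k 0); [tauto|auto].
assert (Hexp : sqrt c * Rpower (exp (e / 2)) T * B = sqrt c * exp (e * T / 2) * B).
  unfold Rpower; rewrite ln_exp; do 3 f_equal; field.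
rewrite Hexp.
apply Hnorm_le.
  repeat apply Rmult_le_pos; auto; [apply sqrt_pos|left; apply exp_pos].
intros n.
rewrite !Rpow_mult_distr, pow2_sqrt by lra.
replace (exp (e * T / 2) ^ 2) with (exp (e * T)).
2:{ simpl; rewrite Rmult_1_r, <- exp_plus; f_equal; field. }
assert (HLt : wbox theta n (fun k => drop_zero (v (clamp T t)) k - drop_zero (w (clamp T t)) k)%C <= c * exp (e * T) * B ^ 2).
  apply (HL T _ _ _ _ B HT HV HW BV BW HB); auto.
  intros m; rewrite (clamp_id T 0) by lra.
  apply Rle_trans with (wbox theta m (vsub v0 w0)); [|now apply wbox_le_Hnorm].
  rewrite <- Hsub; apply Req_le, rsum_ext; intros k _; cbv beta.
  now rewrite (solution_initial T v0 v k HT Hv), (solution_initial T w0 w k HT Hw).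
rewrite clamp_id, Hsub in HLt by auto; exact HLt.
Qed.
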